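(* Let $\alpha\geq-\frac12$. The operators $\mathcal{M}$ and $\mathcal{D}_{\alpha,S}$ given by $$\mathcal{M}f(q)=qf(q),\qquad \mathcal{D}_{\alpha,S}f(q)=\partial_Sf(q)+(2\alpha+1)q^{-1}f^o(q),$$ with domains $D(\mathcal{M})=\{f\in\mathcal{F}^{\alpha}_{Slice}(\mathbb{H}):\mathcal{M}f\in\mathcal{F}^{\alpha}_{Slice}(\mathbb{H})\}$ and $D(\mathcal{D}_{\alpha,S})=\{f\in\mathcal{F}^{\alpha}_{Slice}(\mathbb{H}):\mathcal{D}_{\alpha,S}f\in\mathcal{F}^{\alpha}_{Slice}(\mathbb{H})\}$, are closed densely defined right quaternionic linear operators that are adjoints of each other on the slice Cholewinski-Fock space $\mathcal{F}^{\alpha}_{Slice}(\mathbb{H})$. Moreover, they satisfy the commutation rule $$[\mathcal{D}_{\alpha,S};\mathcal{M}]=\mathcal{I}+(2\alpha+1)A,$$ where $\mathcal{I}$ is the identity operator and $Af(q)=f(-q)$.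
   Context: $\mathbb{H}$ is the skew field of quaternions, $\mathbb{S}=\{q\in\mathbb{H}: q^2=-1\}$, and $\mathbb{C}_I=\mathbb{R}+\mathbb{R}I$ for $I\in\mathbb{S}$. A function $f:\mathbb{H}\to\mathbb{H}$ is entire slice (left) regular if it is real differentiable and, for every $I\in\mathbb{S}$, its restriction $f_I$ to $\mathbb{C}_I$ has continuous partial derivatives and satisfies $\frac12(\partial_x+I\partial_y)f_I(x+yI)=0$; equivalently $f(q)=\sum_{n\ge 0}q^na_n$ with $a_n\in\mathbb{H}$, converging on all of $\mathbb{H}$. Put $f^e(q)=\frac{f(q)+f(-q)}2$, $f^o(q)=\frac{f(q)-f(-q)}2$. The slice derivative is $\partial_Sf(x+yI)=\frac12(\partial_x-I\partial_y)f_I(x+yI)$ for $y\ne0$ and $\partial_Sf(x)=\partial_xf(x)$ for $x$ real; thus $\partial_S\sum q^na_n=\sum nq^{n-1}a_n$. The function $q^{-1}f^o(q)$ is extended by continuity to $q=0$. Let $\mathrm{Mac}_\alpha(x)=\int_0^\infty e^{-x\cosh t}\cosh(\alpha t)\,dt$ ($x>0$) be the Macdonald function and, for $I\in\mathbb{S}$, on $\mathbb{C}_I$ with Lebesgue measure $d\lambda_I$, let $$d\lambda_{\alpha,I}(p)=\frac{|p|^{2\alpha+2}}{\pi 2^\alpha\Gamma(\alpha+1)}\mathrm{Mac}_\alpha(|p|^2)\,d\lambda_I(p).$$ $\mathcal{F}^{\alpha}_{Slice}(\mathbb{H})$ is the right quaternionic Hilbert space of entire slice regular $f$ such that, for $I\in\mathbb{S}$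 (the choice of $I$ is immaterial), $$\int_{\mathbb{C}_I}|f^e_I|^2d\lambda_{\alpha,I}+2(\alpha+1)\int_{\mathbb{C}_I}|f^o_I(p)|^2|p|^{-2}d\lambda_{\alpha+1,I}(p)<\infty,$$ with inner product $$\langle f,g\rangle=\int_{\mathbb{C}_I}\overline{g^e_I}f^e_I\,d\lambda_{\alpha,I}+2(\alpha+1)\int_{\mathbb{C}_I}\overline{g^o_I(p)}f^o_I(p)|p|^{-2}d\lambda_{\alpha+1,I}(p).$$ The commutator is $[\mathcal{D}_{\alpha,S};\mathcal{M}]=\mathcal{D}_{\alpha,S}\mathcal{M}-\mathcal{M}\mathcal{D}_{\alpha,S}$; the commutation rule is understood by applying the defining expressions of the operators to functions $f\in\mathcal{F}^{\alpha}_{Slice}(\mathbb{H})$. *)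

(* Defs.v *)
From HB Require Import structures.
From mathcomp Require Import all_boot all_order all_algebra.
From mathcomp Require Import all_classical all_reals all_analysis.
From mathcomp Require Import ring lra.
Set Implicit Arguments.
Unset Strict Implicit.
Unset Printing Implicit Defensive.
Import Order.TTheory GRing.Theory Num.Theory.
Import numFieldNormedType.Exports.
Local Open Scope classical_set_scope.
Local Open Scope ring_scope.

(** * Quaternions

    The real normed-module structure is that of row vectors, hence [`|q|] is
    the sup norm of the coordinates; the Euclidean modulus of a quaternion is
    [qabs]. *)

Definition quat (R : realType) : Type := 'rV[R]_4.

HB.instance Definition _ (R : realType) :=
  NormedModule.copy (quat R) 'rV[R]_4.

Section Quaternions.
Variable R : realType.
Implicit Types p q r : quat R.

Definition Quat (a b c d : R) : quat R := \row_(i < 4) [:: a; b; c; d]`_i.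
Definition qre q : R := q ord0 (inord 0).
Definition qi q : R := q ord0 (inord 1).
Definition qj q : R := q ord0 (inord 2).
Definition qk q : R := q ord0 (inord 3).

Lemma qre_Quat a b c d : qre (Quat a b c d) = a.
Proof. by rewrite /qre mxE inordK. Qed.
Lemma qi_Quat a b c d : qi (Quat a b c d) = b.
Proof. by rewrite /qi mxE inordK. Qed.
Lemma qj_Quat a b c d : qj (Quat a b c d) = c.
Proof. by rewrite /qj mxE inordK. Qed.
Lemma qk_Quat a b c d : qk (Quat a b c d) = d.
Proof. by rewrite /qk mxE inordK. Qed.

Lemma quat_eq p q :
  qre p = qre q -> qi p = qi q -> qj p = qj q -> qk p = qk q -> p = q.
Proof.
rewrite /qre /qi /qj /qk => e0 e1 e2 e3; apply/rowP => i.
rewrite -(inord_val i); case: i => [[|[|[|[|//]]]] ?] //=.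
Qed.

Lemma qre0 : qre 0 = 0. Proof. exact: mxE. Qed.
Lemma qi0 : qi 0 = 0. Proof. exact: mxE. Qed.
Lemma qj0 : qj 0 = 0. Proof. exact: mxE. Qed.
Lemma qk0 : qk 0 = 0. Proof. exact: mxE. Qed.

Lemma qreD p q : qre (p + q) = qre p + qre q. Proof. exact: mxE. Qed.
Lemma qiD p q : qi (p + q) = qi p + qi q. Proof. exact: mxE. Qed.
Lemma qjD p q : qj (p + q) = qj p + qj q. Proof. exact: mxE. Qed.
Lemma qkD p q : qk (p + q) = qk p + qk q. Proof. exact: mxE. Qed.

Lemma qreN q : qre (- q) = - qre q. Proof. exact: mxE. Qed.
Lemma qiN q : qi (- q) = - qi q. Proof. exact: mxE. Qed.
Lemma qjN q : qj (- q) = - qj q. Proof. exact: mxE. Qed.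
Lemma qkN q : qk (- q) = - qk q. Proof. exact: mxE. Qed.

Lemma qreZ a q : qre (a *: q) = a * qre q. Proof. exact: mxE. Qed.
Lemma qiZ a q : qi (a *: q) = a * qi q. Proof. exact: mxE. Qed.
Lemma qjZ a q : qj (a *: q) = a * qj q. Proof. exact: mxE. Qed.
Lemma qkZ a q : qk (a *: q) = a * qk q. Proof. exact: mxE. Qed.

Definition quatE := (qre_Quat, qi_Quat, qj_Quat, qk_Quat,
  (qre0, qi0, qj0, qk0), (qreD, qiD, qjD, qkD), (qreN, qiN, qjN, qkN),
  (qreZ, qiZ, qjZ, qkZ)).

Definition qone : quat R := Quat 1 0 0 0.

Definition qmul p q : quat R :=
  Quat (qre p * qre q - qi p * qi q - qj p * qj q - qk p * qk q)
       (qre p * qi q + qi p * qre q + qj p * qk q - qk p * qj q)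
       (qre p * qj q - qi p * qk q + qj p * qre q + qk p * qi q)
       (qre p * qk q + qi p * qj q - qj p * qi q + qk p * qre q).

Definition qconj q : quat R := Quat (qre q) (- qi q) (- qj q) (- qk q).

Definition qabs2 q : R := qre q ^+ 2 + qi q ^+ 2 + qj q ^+ 2 + qk q ^+ 2.
Definition qabs q : R := Num.sqrt (qabs2 q).

Definition qinv q : quat R := (qabs2 q)^-1 *: qconj q.

Let qmulA : associative qmul.
Proof. by move=> p q r; apply: quat_eq; rewrite /qmul !quatE; ring. Qed.

Let qmul1l : left_id qone qmul.
Proof. by move=> q; apply: quat_eq; rewrite /qmul !quatE; ring. Qed.

Let qmul1r : right_id qone qmul.
Proof. by move=> q; apply: quat_eq; rewrite /qmul !quatE; ring. Qed.

Let qmulDl : left_distributive qmul +%R.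
Proof. by move=> p q r; apply: quat_eq; rewrite /qmul !quatE; ring. Qed.

Let qmulDr : right_distributive qmul +%R.
Proof. by move=> p q r; apply: quat_eq; rewrite /qmul !quatE; ring. Qed.

Let qone_neq0 : qone != 0.
Proof.
by apply/eqP => /(congr1 qre) /eqP; rewrite /qone !quatE oner_eq0.
Qed.

HB.instance Definition _ := GRing.Zmodule_isNzRing.Build (quat R)
  qmulA qmul1l qmul1r qmulDl qmulDr qone_neq0.

Lemma qoneE : 1 = Quat 1 0 0 0. Proof. by []. Qed.
Lemma qmulE p q : p * q = qmul p q. Proof. by []. Qed.

Let qscaleAl (a : R) p q : a *: (p * q) = (a *: p) * q.
Proof. by rewrite !qmulE; apply: quat_eq; rewrite /qmul !quatE; ring. Qed.

HB.instance Definition _ :=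
  GRing.Lmodule_isLalgebra.Build R (quat R) qscaleAl.

Let qscaleAr (a : R) p q : a *: (p * q) = p * (a *: q).
Proof. by rewrite !qmulE; apply: quat_eq; rewrite /qmul !quatE; ring. Qed.

HB.instance Definition _ :=
  GRing.Lalgebra_isAlgebra.Build R (quat R) qscaleAr.

Lemma qabs2_eq0 q : (qabs2 q == 0) = (q == 0).
Proof.
apply/idP/eqP => [|->]; last by rewrite /qabs2 !quatE !expr0n !addr0.
rewrite /qabs2 !paddr_eq0 ?addr_ge0 ?sqr_ge0 // !sqrf_eq0.
by case/andP => /andP[/andP[/eqP ? /eqP ?] /eqP ?] /eqP ?;
  apply: quat_eq; rewrite quatE.
Qed.

Let qmulVq : {in [pred q | q != 0], left_inverse 1 qinv *%R}.
Proof.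
move=> q; rewrite inE -qabs2_eq0 => q0; rewrite qmulE qoneE /qinv.
by apply: quat_eq; move: q0; rewrite /qmul /qconj !quatE /qabs2 => q0; field.
Qed.

Let qmulqV : {in [pred q | q != 0], right_inverse 1 qinv *%R}.
Proof.
move=> q; rewrite inE -qabs2_eq0 => q0; rewrite qmulE qoneE /qinv.
by apply: quat_eq; move: q0; rewrite /qmul /qconj !quatE /qabs2 => q0; field.
Qed.

Let qunitP p q : q * p = 1 /\ p * q = 1 -> p != 0.
Proof.
by case=> _ pq; apply: contra_eq_neq pq => ->; rewrite mul0r eq_sym oner_eq0.
Qed.

Let qinv_out : {in [predC [pred q | q != 0]], qinv =1 id}.
Proof.
move=> q; rewrite !inE negbK => /eqP ->; rewrite /qinv /qconj.
by apply: quat_eq; rewrite !quatE ?oppr0 mulr0.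
Qed.

HB.instance Definition _ := GRing.NzRing_hasMulInverse.Build (quat R)
  qmulVq qmulqV qunitP qinv_out.

Lemma qinvE q : q^-1 = qinv q. Proof. by []. Qed.

End Quaternions.

(** * Slice regular functions *)

Section SliceRegular.
Variable R : realType.
Implicit Types (f : quat R -> quat R) (I q : quat R) (x y : R).

Definition sphere : set (quat R) := [set I | I ^+ 2 = -1].

Definition slice_pt I x y : quat R := x *: 1 + y *: I.

Definition slice_dx f I x y : quat R :=
  derive1 (fun s : R => f (slice_pt I s y)) x.
Definition slice_dy f I x y : quat R :=
  derive1 (fun s : R => f (slice_pt I x s)) y.

Definition slice_regular f : Prop :=
  (forall q, differentiable f q) /\
  forall I, sphere I ->
    [/\ forall x y, derivable (fun s : R => f (slice_pt I s y)) x 1 /\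
                    derivable (fun s : R => f (slice_pt I x s)) y 1,
        continuous (fun z : R * R => slice_dx f I z.1 z.2),
        continuous (fun z : R * R => slice_dy f I z.1 z.2)
      & forall x y, 2^-1 *: (slice_dx f I x y + I * slice_dy f I x y) = 0].

Definition even_part f q : quat R := 2^-1 *: (f q + f (- q)).
Definition odd_part f q : quat R := 2^-1 *: (f q - f (- q)).

Definition qim q : quat R := q - qre q *: 1.

(* A non-real q is x + yI for exactly two pairs, (I, y) and (-I, -y), which
   give the same value; the pair with y = |Im q| > 0 is used here. *)
Definition slice_derive f q : quat R :=
  let x := qre q in
  let y := qabs (qim q) in
  let I := y^-1 *: qim q in
  if y == 0 then derive1 (fun s : R => f (s *: 1)) x
  else 2^-1 *: (slice_dx f I x y - I * slice_dy f I x y).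

Definition inv_odd_part f q : quat R :=
  if q == 0 then lim (p^-1 * odd_part f p @[p --> (0 : quat R)^'])
  else q^-1 * odd_part f q.

End SliceRegular.

(** * The slice Cholewinski-Fock space *)

Section FockSpace.
Variable R : realType.
Implicit Types (alpha : R) (I : quat R) (f g : quat R -> quat R).

Definition coshR (t : R) : R := 2^-1 * (expR t + expR (- t)).

Definition macdonald alpha (x : R) : R :=
  \int[@lebesgue_measure R]_(t in `[0, +oo[)
    (expR (- x * coshR t) * coshR (alpha * t)).

Definition Gamma (s : R) : R :=
  \int[@lebesgue_measure R]_(t in `]0, +oo[) (t `^ (s - 1) * expR (- t)).

(* The density of lambda_(alpha, I) with respect to the Lebesgue measure of
   the slice, as a function of r = |p|. *)
Definition mac_density alpha (r : R) : R :=
  r `^ (2 * alpha + 2) / (pi * 2 `^ alpha * Gamma (alpha + 1))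
  * macdonald alpha (r ^+ 2).

(* The slice C_I is identified with R * R through (x, y) |-> x + yI. *)
Definition lebesgue2 := (@lebesgue_measure R \x @lebesgue_measure R)%E.

Definition slice_of I (z : R * R) : quat R := slice_pt I z.1 z.2.

Definition fock_normsq alpha I f : \bar R :=
  (\int[lebesgue2]_z
     (qabs (even_part f (slice_of I z)) ^+ 2
      * mac_density alpha (qabs (slice_of I z)))%:E
   + (2 * (alpha + 1))%:E *
   \int[lebesgue2]_z
     (qabs (odd_part f (slice_of I z)) ^+ 2 * qabs (slice_of I z) ^- 2
      * mac_density (alpha + 1) (qabs (slice_of I z)))%:E)%E.

Definition fock_space alpha I : set (quat R -> quat R) :=
  [set f | slice_regular f /\ (fock_normsq alpha I f < +oo)%E].

Definition qintegral (h : R * R -> quat R) : quat R :=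
  Quat (\int[lebesgue2]_z qre (h z)) (\int[lebesgue2]_z qi (h z))
       (\int[lebesgue2]_z qj (h z)) (\int[lebesgue2]_z qk (h z)).

Definition fock_inner alpha I f g : quat R :=
  qintegral (fun z => let p := slice_of I z in
    mac_density alpha (qabs p) *: (qconj (even_part g p) * even_part f p))
  + (2 * (alpha + 1)) *:
  qintegral (fun z => let p := slice_of I z in
    (qabs p ^- 2 * mac_density (alpha + 1) (qabs p)) *:
      (qconj (odd_part g p) * odd_part f p)).

End FockSpace.

(** * Unbounded operators in a right quaternionic inner product space

    The space is a set [H] of functions, with the inner product [ip], right
    linear in its first argument. *)

Section Operators.
Variable R : realType.
Local Notation V := (quat R -> quat R).
Implicit Types (H : set V) (ip : V -> V -> quat R).

(* [op_map] is only meaningful on [op_dom] *)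
Record qoperator := QOperator { op_dom : set V; op_map : V -> V }.

Definition max_operator H (T : V -> V) : qoperator :=
  QOperator [set f | H f /\ H (T f)] T.

Definition right_linear_operator H (T : qoperator) : Prop :=
  [/\ op_dom T `<=` H,
      forall f, op_dom T f -> H (op_map T f),
      op_dom T (fun=> 0)
    & forall f g (a b : quat R), op_dom T f -> op_dom T g ->
        op_dom T (fun q => f q * a + g q * b) /\
        op_map T (fun q => f q * a + g q * b)
        = (fun q => op_map T f q * a + op_map T g q * b)].

Definition ip_norm ip f : R := Num.sqrt (qre (ip f f)).

Definition densely_defined H ip (T : qoperator) : Prop :=
  forall f, H f -> forall e : R, 0 < e ->
    exists2 g, op_dom T g & ip_norm ip (f \- g) < e.

Definition closed_operator H ip (T : qoperator) : Prop :=
  forall (u : nat -> V) (f g : V), (forall n, op_dom T (u n)) -> H f -> H g ->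
    ip_norm ip (u n \- f) @[n --> \oo] --> (0 : R) ->
    ip_norm ip (op_map T (u n) \- g) @[n --> \oo] --> (0 : R) ->
    op_dom T f /\ op_map T f = g.

(* S is the adjoint of T (T densely defined): the graph of S is the set of
   the pairs (g, h) of H * H with <T f, g> = <f, h> for all f in dom T. *)
Definition is_adjoint H ip (T S : qoperator) : Prop :=
  forall g h : V,
    (op_dom S g /\ op_map S g = h) <->
    [/\ H g, H h & forall f, op_dom T f -> ip (op_map T f) g = ip f h].

Definition commutator (S T : V -> V) : V -> V := fun f => S (T f) \- T (S f).

End Operators.

Section MD.
Variable R : realType.
Implicit Types (alpha : R) (f : quat R -> quat R).

Definition mul_fun f : quat R -> quat R := fun q => q * f q.

Definition dunkl_fun alpha f : quat R -> quat R := fun q =>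
  slice_derive f q + (2 * alpha + 1) *: inv_odd_part f q.

Definition reflect_fun f : quat R -> quat R := fun q => f (- q).

Definition mul_op alpha (I : quat R) : qoperator R :=
  max_operator (fock_space alpha I) mul_fun.

Definition dunkl_op alpha (I : quat R) : qoperator R :=
  max_operator (fock_space alpha I) (dunkl_fun alpha).

End MD.

(* Main.v *)
Require Import Defs.
From HB Require Import structures.
From mathcomp Require Import all_boot all_order all_algebra.
From mathcomp Require Import all_classical all_reals all_analysis.
From mathcomp Require Import measurable_realfun ring lra.
Set Implicit Arguments.
Unset Strict Implicit.
Unset Printing Implicit Defensive.
Import Order.TTheory GRing.Theory Num.Theory.
Import numFieldNormedType.Exports.
Local Open Scope classical_set_scope.
Local Open Scope ring_scope.

(* A slice regular function is its Taylor series at 0 (Cauchy's formula on a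
   slice), so everything is read off the coefficients. In the polar coordinates
   of a slice distinct powers are orthogonal, and f = sum q^n a_n has norm
   sum c_n |a_n|^2 with
     c_n = C G(2n + 2 alpha + 3) J(n + alpha + 2, alpha + [n odd]),
   where G(k) is the integral of |x|^k exp(-x^2) and J(m, b) the integral of
   cosh(bt) cosh(t)^(-m) over t >= 0, which comes from the integral formula of
   the Macdonald function. The recurrences
     G(k + 2) = (k + 1)/2 G(k),  m J(m + 1, b + 1) = (m + b) J(m, b)
   give c_(n+1) = gam_(n+1) c_n with gam_n = n + (2 alpha + 1) [n odd]. Since
   M shifts the coefficients up and D maps (a_n) to (gam_(n+1) a_(n+1)), they
   are mutually adjoint weighted shifts on a weighted l^2 space, and
   gam_(n+1) - gam_n = 1 + (2 alpha + 1) (-1)^n is the commutation rule. *)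

(** * Quaternions *)

(** Cauchy's formula yields coefficients that a priori depend on the slice and on the radius of the
    circle. They are compared on a segment of the positive real axis, which every slice contains.
    The definitions use real-valued integrals, which return 0 when the integral is infinite; the
    Macdonald integral, for instance, diverges at x = 0. The integrals are therefore handled in the
    extended reals, where Tonelli's theorem applies before finiteness is known, and are transferred
    afterwards. The factor 2 (alpha + 1) and the index alpha + 1 in the odd part of the norm are
    tuned so that even and odd powers share the constant C and the index of G; only the order b of
    the Macdonald function alternates. For k = 2n + 2 alpha + 3 the factor (k + 1)/2 of G equals the
    m of J, so m cancels and the ratio c_(n+1) / c_n is m + b, with b = alpha for n even and b =
    -(alpha + 1) for n odd. As the domains are maximal, adjointness includes an equality of domains:
    pairing with the powers q^n recovers every coefficient, and membership in the space amounts to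
    boundedness of the weighted sums of |a_n|^2. *)

Section QuatAlg.
Variable R : realType.
Implicit Types p q : quat R.

Lemma qmul_components p q :
  p * q = Quat (qre p * qre q - qi p * qi q - qj p * qj q - qk p * qk q)
       (qre p * qi q + qi p * qre q + qj p * qk q - qk p * qj q)
       (qre p * qj q - qi p * qk q + qj p * qre q + qk p * qi q)
       (qre p * qk q + qi p * qj q - qj p * qi q + qk p * qre q).
Proof. by []. Qed.

Lemma qre_one : qre (1 : quat R) = 1. Proof. by rewrite qoneE quatE. Qed.
Lemma qi_one : qi (1 : quat R) = 0. Proof. by rewrite qoneE quatE. Qed.
Lemma qj_one : qj (1 : quat R) = 0. Proof. by rewrite qoneE quatE. Qed.
Lemma qk_one : qk (1 : quat R) = 0. Proof. by rewrite qoneE quatE. Qed.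
Definition qoneEs := (qre_one, qi_one, qj_one, qk_one).

Lemma qabs2M p q : qabs2 (p * q) = qabs2 p * qabs2 q.
Proof. by rewrite qmul_components /qabs2 !quatE; ring. Qed.

Lemma qabs2_ge0 q : 0 <= qabs2 q.
Proof. by rewrite /qabs2 !addr_ge0// sqr_ge0. Qed.

Lemma qabs_ge0 q : 0 <= qabs q. Proof. exact: sqrtr_ge0. Qed.

Lemma qabs_sqr q : qabs q ^+ 2 = qabs2 q.
Proof. by rewrite sqr_sqrtr// qabs2_ge0. Qed.

Lemma qabsM p q : qabs (p * q) = qabs p * qabs q.
Proof. by rewrite /qabs qabs2M sqrtrM// qabs2_ge0. Qed.

Lemma qabs_eq0 q : (qabs q == 0) = (q == 0).
Proof. by rewrite /qabs sqrtr_eq0 le_eqVlt ltNge qabs2_ge0 orbF qabs2_eq0. Qed.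

Lemma qabs0 : qabs (0 : quat R) = 0. Proof. by apply/eqP; rewrite qabs_eq0. Qed.

Lemma qabs1 : qabs (1 : quat R) = 1.
Proof. by rewrite /qabs /qabs2 !qoneEs !expr0n !addr0 expr1n sqrtr1. Qed.

Lemma qabsZ (a : R) q : qabs (a *: q) = `|a| * qabs q.
Proof.
have -> : qabs (a *: q) = Num.sqrt (a ^+ 2 * qabs2 q).
  by congr Num.sqrt; rewrite /qabs2 !quatE; ring.
by rewrite sqrtrM ?sqr_ge0// sqrtr_sqr.
Qed.

Lemma qabsN q : qabs (- q) = qabs q.
Proof. by rewrite -scaleN1r qabsZ normrN1 mul1r. Qed.

Lemma qabsX q n : qabs (q ^+ n) = qabs q ^+ n.
Proof. by elim: n => [|n ih]; rewrite ?expr0 ?qabs1// !exprS qabsM ih. Qed.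

Lemma qre_le_qabs q : `|qre q| <= qabs q.
Proof.
by rewrite -(sqrtr_sqr (qre q)) /qabs ler_wsqrtr// /qabs2 -!addrA lerDl !addr_ge0// sqr_ge0.
Qed.
Lemma qi_le_qabs q : `|qi q| <= qabs q.
Proof.
rewrite -(sqrtr_sqr (qi q)) /qabs ler_wsqrtr// /qabs2.
by have := sqr_ge0 (qre q); have := sqr_ge0 (qj q); have := sqr_ge0 (qk q); lra.
Qed.
Lemma qj_le_qabs q : `|qj q| <= qabs q.
Proof.
rewrite -(sqrtr_sqr (qj q)) /qabs ler_wsqrtr// /qabs2.
by have := sqr_ge0 (qre q); have := sqr_ge0 (qi q); have := sqr_ge0 (qk q); lra.
Qed.
Lemma qk_le_qabs q : `|qk q| <= qabs q.
Proof.
rewrite -(sqrtr_sqr (qk q)) /qabs ler_wsqrtr// /qabs2.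
by have := sqr_ge0 (qre q); have := sqr_ge0 (qi q); have := sqr_ge0 (qj q); lra.
Qed.

Lemma coord_quat q (i : 'I_4) :
  [\/ q ord0 i = qre q, q ord0 i = qi q, q ord0 i = qj q | q ord0 i = qk q].
Proof.
rewrite -(inord_val i); case: i => [[|[|[|[|//]]]] ?] /=.
- exact: Or41. - exact: Or42. - exact: Or43. - exact: Or44.
Qed.

(** Limits and differentiability are taken in the sup norm, while products are estimated with the
    multiplicative modulus [qabs]; this bound and [qabs_le_norm] pass between the two. *)
Lemma norm_le_qabs q : `|q| <= qabs q.
Proof.
have : mx_norm (q : 'rV[R]_4) <= qabs q.
  rewrite mx_normrE; apply/bigmax_leP; split; first exact: qabs_ge0.
  move=> [i j] _ /=; rewrite (ord1 i).
  by case: (coord_quat q j) => ->; rewrite ?qre_le_qabs ?qi_le_qabs ?qj_le_qabs ?qk_le_qabs.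
exact.
Qed.

Lemma coord_le_norm q i : `|q ord0 i| <= `|q|.
Proof.
suff : `|q ord0 i| <= mx_norm (q : 'rV[R]_4) by [].
by rewrite mx_normrE; exact: (le_bigmax _ (fun ij : 'I_1 * 'I_4 => `|q ij.1 ij.2|) (ord0, i)).
Qed.

(** Each of the four squared coordinates is at most the square of the sup norm, whence the factor 2,
    the square root of 4. *)
Lemma qabs_le_norm q : qabs q <= 2 * `|q|.
Proof.
rewrite -(@ler_sqr _ (qabs q)) ?nnegrE ?qabs_ge0 ?mulr_ge0// qabs_sqr.
have H i : q ord0 i ^+ 2 <= `|q| ^+ 2.
  by rewrite -(real_normK (num_real (q ord0 i))) lerXn2r ?nnegrE// coord_le_norm.
rewrite /qabs2 exprMn.
have := H (inord 0); have := H (inord 1); have := H (inord 2); have := H (inord 3).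
rewrite -/(qre q) -/(qi q) -/(qj q) -/(qk q); lra.
Qed.

Lemma qre_conjM p q : qre (qconj p * q) = qre p * qre q + qi p * qi q + qj p * qj q + qk p * qk q.
Proof. by rewrite qmul_components /qconj !quatE; ring. Qed.

Lemma qabs2_conj q : qabs2 (qconj q) = qabs2 q.
Proof. by rewrite /qabs2 /qconj !quatE; ring. Qed.

Lemma qabs_conj q : qabs (qconj q) = qabs q.
Proof. by rewrite /qabs qabs2_conj. Qed.

Lemma qconjM p q : qconj (p * q) = qconj q * qconj p.
Proof. by rewrite !qmul_components; apply: quat_eq; rewrite /qconj !quatE; ring. Qed.

Lemma qconjD p q : qconj (p + q) = qconj p + qconj q.
Proof. by apply: quat_eq; rewrite /qconj !quatE; ring. Qed.

Lemma qconjZ (a : R) q : qconj (a *: q) = a *: qconj q.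
Proof. by apply: quat_eq; rewrite /qconj !quatE; ring. Qed.

Lemma qconj0 : qconj (0 : quat R) = 0.
Proof. by apply: quat_eq; rewrite /qconj !quatE ?oppr0. Qed.

Lemma qconjK q : qconj (qconj q) = q.
Proof. by apply: quat_eq; rewrite /qconj !quatE ?opprK. Qed.

Lemma qconjMq q : qconj q * q = qabs2 q *: 1.
Proof. by rewrite !qmul_components /qconj; apply: quat_eq; rewrite /qabs2 !quatE ?qoneEs; ring. Qed.

Lemma qabs2D p q : qabs2 (p + q) = qabs2 p + 2 * qre (qconj p * q) + qabs2 q.
Proof. by rewrite qre_conjM /qabs2 !quatE; ring. Qed.

Lemma qabsD p q : qabs (p + q) <= qabs p + qabs q.
Proof.
rewrite -(@ler_sqr _ (qabs _)) ?nnegrE ?addr_ge0 ?qabs_ge0//.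
rewrite qabs_sqr qabs2D sqrrD !qabs_sqr lerD2r lerD2l -[leRHS]mulr_natl ler_pM2l//.
by rewrite (le_trans (ler_norm _))// (le_trans (qre_le_qabs _))// qabsM qabs_conj.
Qed.

Lemma qabs_sum (I : Type) (s : seq I) (P : pred I) (F : I -> quat R) :
  qabs (\sum_(i <- s | P i) F i) <= \sum_(i <- s | P i) qabs (F i).
Proof.
elim/big_rec2: _ => [|i x y _ h]; first by rewrite qabs0.
by rewrite (le_trans (qabsD _ _))// lerD2l.
Qed.

Lemma scale_mul1 (a : R) q : (a *: 1) * q = a *: q.
Proof. by rewrite -scalerAl mul1r. Qed.

Lemma mul_scale1 (a : R) q : q * (a *: 1) = a *: q.
Proof. by rewrite -scalerAr mulr1. Qed.

End QuatAlg.

(** * Limits of quaternion-valued functions *)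

Section QuatTop.
Variable R : realType.
Implicit Types p q : quat R.

Lemma QuatE (a b c d : R) :
  Quat a b c d = a *: 1 + b *: Quat 0 1 0 0 + c *: Quat 0 0 1 0 + d *: Quat 0 0 0 1.
Proof. by apply: quat_eq; rewrite !quatE ?qoneEs; ring. Qed.

Lemma qcoord_continuous i : continuous (fun q : quat R => q ord0 i).
Proof. exact: coord_continuous. Qed.

Context {T : Type} {F : set_system T} {FF : Filter F}.
Implicit Types f g : T -> quat R.

Lemma cvg_qcoord f q i : f x @[x --> F] --> q -> f x ord0 i @[x --> F] --> q ord0 i.
Proof.
move=> fq.
exact: (@cvg_comp _ _ _ f (fun q : quat R => q ord0 i) F (nbhs q) _ fq (@qcoord_continuous i q)).
Qed.

Lemma cvg_Quat (a b c d : T -> R) (a' b' c' d' : R) :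
  a x @[x --> F] --> a' -> b x @[x --> F] --> b' ->
  c x @[x --> F] --> c' -> d x @[x --> F] --> d' ->
  Quat (a x) (b x) (c x) (d x) @[x --> F] --> Quat a' b' c' d'.
Proof.
move=> ha hb hc hd; rewrite QuatE.
under eq_fun do rewrite QuatE.
by apply: cvgD; [apply: cvgD; [apply: cvgD|]|]; apply: cvgZr_tmp.
Qed.

Lemma cvg_qmul f g p q : f x @[x --> F] --> p -> g x @[x --> F] --> q ->
  f x * g x @[x --> F] --> p * q.
Proof.
move=> fp gq; rewrite qmul_components.
under eq_fun do rewrite qmul_components.
have Hf i := cvg_qcoord (i := i) fp.
have Hg i := cvg_qcoord (i := i) gq.
apply: cvg_Quat.
- by apply: cvgB; [apply: cvgB; [apply: cvgB|]|]; apply: cvgM; solve [exact: Hf|exact: Hg].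
- by apply: cvgB; [apply: cvgD; [apply: cvgD|]|]; apply: cvgM; solve [exact: Hf|exact: Hg].
- by apply: cvgD; [apply: cvgD; [apply: cvgB|]|]; apply: cvgM; solve [exact: Hf|exact: Hg].
- by apply: cvgD; [apply: cvgB; [apply: cvgD|]|]; apply: cvgM; solve [exact: Hf|exact: Hg].
Qed.

Lemma cvg_qabs f q : f x @[x --> F] --> q -> qabs (f x) @[x --> F] --> qabs q.
Proof.
move=> fq; have Hf i := cvg_qcoord (i := i) fq.
rewrite /qabs; apply: continuous_cvg; first exact: sqrt_continuous.
by rewrite /qabs2; apply: cvgD; [apply: cvgD; [apply: cvgD|]|];
  rewrite expr2; under eq_fun do rewrite expr2; apply: cvgM; exact: Hf.
Qed.

Lemma qcvg_le f q (e : T -> R) : e x @[x --> F] --> 0 ->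
  (\forall x \near F, qabs (f x - q) <= e x) -> f x @[x --> F] --> q.
Proof.
move=> e0 fe; apply/cvgrPdist_le => /= eps eps0.
move/cvgrPdist_le : e0 => /(_ _ eps0); apply: filterS2 fe => x fx.
rewrite sub0r normrN => ex.
rewrite distrC (le_trans (norm_le_qabs _))// (le_trans fx)// (le_trans (ler_norm _))//.
Qed.

End QuatTop.

Lemma cvg_eqfun (T U : Type) (F : set_system T) (f g : T -> U) (l : set_system U) :
  f =1 g -> g @ F --> l -> f @ F --> l.
Proof. by move=> /funext ->. Qed.

(** * Derivatives of quaternion-valued functions of a real variable *)

Section Derivatives.
Variable R : realType.
Implicit Types (g h : R -> quat R) (x y : R) (d v : quat R).

(** [derive1] is a [lim], so an equation about it does not assert existence; this records both that
    the difference quotient converges and its limit. *)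
Definition qder g x d : Prop := h^-1 *: (g (h + x) - g x) @[h --> 0^'] --> d.

Lemma derivable_qder g x : derivable g x 1 <-> exists d, qder g x d.
Proof.
rewrite /derivable /qder cvg_ex; split => -[d hd]; exists d;
  by apply: cvg_eqfun hd => h /=; rewrite scaler1.
Qed.

Lemma qder_derive1 g x d : qder g x d -> derive1 g x = d.
Proof. by move=> hd; apply: cvg_lim. Qed.

Lemma derivable_qder_derive1 g x : derivable g x 1 -> qder g x (derive1 g x).
Proof. by move=> /derivable_qder[d hd]; rewrite (qder_derive1 hd). Qed.

Lemma qder_continuous g x d : qder g x d -> g (h + x) @[h --> 0^'] --> g x.
Proof.
move=> hd.
have : h *: (h^-1 *: (g (h + x) - g x)) + g x @[h --> 0^'] --> (0 : R) *: d + g x.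
  apply: cvgD; last exact: cvg_cst.
  by apply: cvgZ => //; exact: cvg_within.
rewrite scale0r add0r; apply: cvg_trans; apply: near_eq_cvg.
near=> h; rewrite scalerA divff ?scale1r ?subrK//.
by near: h; exact: nbhs_dnbhs_neq.
Unshelve. all: end_near. Qed.

Lemma qderD g h x d d' : qder g x d -> qder h x d' -> qder (fun s => g s + h s) x (d + d').
Proof.
rewrite /qder => gd hd; apply: cvg_eqfun (cvgD gd hd) => k.
by rewrite fctE -scalerDr opprD addrACA.
Qed.

Lemma qder_mulr g x d v : qder g x d -> qder (fun s => g s * v) x (d * v).
Proof.
rewrite /qder => gd; apply: cvg_eqfun (cvg_qmul gd (cvg_cst v)) => k.
by rewrite -mulrBl scalerAl.
Qed.

Lemma qder_cst v x : qder (fun=> v) x 0.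
Proof.
rewrite /qder; under eq_fun do rewrite subrr scaler0; exact: cvg_cst.
Qed.

(** Along a coordinate line of a slice the variable q is affine in s, so this is the product rule
    for q f(q). The quotient of the product is exactly v g(h + x) plus (u + x v) times the quotient
    of g, in this order. *)
Lemma qder_affine_mul (u v : quat R) g x d : qder g x d ->
  qder (fun s => (u + s *: v) * g s) x (v * g x + (u + x *: v) * d).
Proof.
move=> gd; rewrite /qder.
have : v * g (h + x) + (u + x *: v) * (h^-1 *: (g (h + x) - g x)) @[h --> 0^']
     --> v * g x + (u + x *: v) * d.
  apply: cvgD; apply: cvg_qmul => //; try exact: cvg_cst.
  exact: qder_continuous gd.
apply: cvg_trans; apply: near_eq_cvg; near=> h.
have h0 : h != 0 by near: h; exact: nbhs_dnbhs_neq.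
apply: (@scalerI _ _ h h0); rewrite scalerDr [X in _ + X]scalerAr !scalerA divff// !scale1r.
have -> : u + (h + x) *: v = h *: v + (u + x *: v) by rewrite scalerDl addrCA.
by rewrite mulrBr [in RHS]mulrDl scalerAl addrA.
Unshelve. all: end_near. Qed.

End Derivatives.

Section DiffMul.
Variable R : realType.

Lemma differentiable_qmul (f g : quat R -> quat R) q :
  differentiable f q -> differentiable g q -> differentiable (fun p => f p * g p) q.
Proof.
move=> df dg.
have Hf i : differentiable (fun p => f p ord0 i) q.
  apply: (@differentiable_comp _ _ _ _ f (fun p : quat R => p ord0 i)) => //.
  exact: differentiable_coord.
have Hg i : differentiable (fun p => g p ord0 i) q.
  apply: (@differentiable_comp _ _ _ _ g (fun p : quat R => p ord0 i)) => //.
  exact: differentiable_coord.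
rewrite (_ : (fun p => f p * g p) = (fun p =>
    (qre (f p) * qre (g p) - qi (f p) * qi (g p) - qj (f p) * qj (g p) - qk (f p) * qk (g p)) *: 1
  + (qre (f p) * qi (g p) + qi (f p) * qre (g p) + qj (f p) * qk (g p) - qk (f p) * qj (g p)) *: Quat 0 1 0 0
  + (qre (f p) * qj (g p) - qi (f p) * qk (g p) + qj (f p) * qre (g p) + qk (f p) * qi (g p)) *: Quat 0 0 1 0
  + (qre (f p) * qk (g p) + qi (f p) * qj (g p) - qj (f p) * qi (g p) + qk (f p) * qre (g p)) *: Quat 0 0 0 1)).
  rewrite /qre /qi /qj /qk.
  by apply: differentiableD; [apply: differentiableD; [apply: differentiableD|]|];
    apply: differentiableZl;
    do 3?[apply: differentiableB|apply: differentiableD];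
    apply: differentiableM; solve [exact: Hf|exact: Hg].
by apply/funext => p; rewrite qmul_components QuatE.
Qed.

End DiffMul.

(** * Slice regular functions *)

Section SliceRegularTheory.
Variable R : realType.
Implicit Types (f g : quat R -> quat R) (I J p q a b : quat R) (x y : R).

Lemma sphereE J : sphere J -> J * J = -1.
Proof. by rewrite /sphere /= expr2. Qed.

Lemma slice_pt_cvg (T : Type) (F : set_system T) {FF : Filter F} (u v : T -> R) J x y :
  u z @[z --> F] --> x -> v z @[z --> F] --> y ->
  slice_pt J (u z) (v z) @[z --> F] --> slice_pt J x y.
Proof. by move=> ux vy; apply: cvgD; apply: cvgZr_tmp. Qed.

Lemma slice_regular_continuous f : slice_regular f -> continuous f.
Proof. by move=> [df _] q; exact: differentiable_continuous. Qed.

Lemma slice_regular_dx f J x y : slice_regular f -> sphere J ->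
  qder (fun s => f (slice_pt J s y)) x (slice_dx f J x y).
Proof.
by move=> [_ /(_ J)] + sJ => /(_ sJ)[+ _ _ _] => /(_ x y)[+ _]; exact: derivable_qder_derive1.
Qed.

Lemma slice_regular_dyE f J x y : slice_regular f -> sphere J ->
  slice_dy f J x y = J * slice_dx f J x y.
Proof.
move=> [_ /(_ J)] + sJ => /(_ sJ)[_ _ _] => /(_ x y) /eqP.
rewrite scaler_eq0 invr_eq0 pnatr_eq0/= => /eqP/(congr1 (fun q => J * q)).
by rewrite mulrDr mulr0 mulrA sphereE// mulN1r => /subr0_eq.
Qed.

Lemma slice_regular_dy f J x y : slice_regular f -> sphere J ->
  qder (fun s => f (slice_pt J x s)) y (J * slice_dx f J x y).
Proof.
move=> rf sJ; rewrite -slice_regular_dyE//; move: rf => [_ /(_ J)].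
by move=> /(_ sJ)[+ _ _ _] => /(_ x y)[_ +]; exact: derivable_qder_derive1.
Qed.

Lemma slice_regular_dx_continuous f J : slice_regular f -> sphere J ->
  continuous (fun z : R * R => slice_dx f J z.1 z.2).
Proof. by move=> [_ /(_ J)] + sJ => /(_ sJ)[]. Qed.

(** Prescribing the partial derivatives as f' and J f' builds in the Cauchy-Riemann equation,
    because J J = -1, and the continuity of f' gives that of both. *)
Lemma slice_regularI f (f' : quat R -> R -> R -> quat R) :
  (forall q, differentiable f q) ->
  (forall J x y, sphere J -> qder (fun s => f (slice_pt J s y)) x (f' J x y)) ->
  (forall J x y, sphere J -> qder (fun s => f (slice_pt J x s)) y (J * f' J x y)) ->
  (forall J, sphere J -> continuous (fun z : R * R => f' J z.1 z.2)) ->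
  slice_regular f.
Proof.
move=> df hx hy cf'; split => // J sJ.
have ex z w : slice_dx f J z w = f' J z w by apply: qder_derive1; exact: hx.
have ey z w : slice_dy f J z w = J * f' J z w by apply: qder_derive1; exact: hy.
split.
- by move=> x y; split; apply/derivable_qder; [exists (f' J x y); exact: hx
    |exists (J * f' J x y); exact: hy].
- by under eq_fun do rewrite ex; exact: cf'.
- under eq_fun do rewrite ey; move=> z; apply: cvg_qmul; first exact: cvg_cst.
  exact: cf'.
- by move=> x y; rewrite ex ey mulrA sphereE// mulN1r subrr scaler0.
Qed.

Lemma slice_regular_ext f g : f =1 g -> slice_regular f -> slice_regular g.
Proof. by move=> fg; have -> : g = f by apply: funext => q; rewrite fg. Qed.

Lemma slice_regular_cst a : slice_regular (fun=> a).
Proof.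
apply: (@slice_regularI _ (fun _ _ _ => 0)) => *.
- exact: differentiable_cst.
- exact: qder_cst.
- by rewrite mulr0; exact: qder_cst.
- by move=> ?; exact: cvg_cst.
Qed.

Lemma slice_regular_lin f g a b : slice_regular f -> slice_regular g ->
  slice_regular (fun q => f q * a + g q * b).
Proof.
move=> rf rg.
apply: (@slice_regularI _ (fun J x y => slice_dx f J x y * a + slice_dx g J x y * b)).
- move=> q; apply: differentiableD; apply: differentiable_qmul;
    solve [exact: differentiable_cst|exact: rf.1|exact: rg.1].
- by move=> J x y sJ; apply: qderD; apply: qder_mulr; exact: slice_regular_dx.
- move=> J x y sJ; rewrite mulrDr !mulrA.
  by apply: qderD; apply: qder_mulr; exact: slice_regular_dy.
- move=> J sJ z; apply: cvgD; apply: cvg_qmul.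
  + exact: (slice_regular_dx_continuous rf sJ).
  + exact: cvg_cst.
  + exact: (slice_regular_dx_continuous rg sJ).
  + exact: cvg_cst.
Qed.

Lemma slice_pt_Zx J x y : slice_pt J x y = y *: J + x *: 1.
Proof. by rewrite /slice_pt addrC. Qed.

Lemma slice_regular_mul f : slice_regular f -> slice_regular (Defs.mul_fun f).
Proof.
move=> rf.
apply: (@slice_regularI _ (fun J x y => f (slice_pt J x y) + slice_pt J x y * slice_dx f J x y)).
- move=> q; apply: differentiable_qmul; last exact: rf.1.
  exact: ex_diff.
- move=> J x y sJ.
  have := qder_affine_mul (u := y *: J) (v := 1) (slice_regular_dx (x := x) (y := y) rf sJ).
  by rewrite mul1r -slice_pt_Zx /Defs.mul_fun; under eq_fun do rewrite -slice_pt_Zx.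
- move=> J x y sJ.
  have := qder_affine_mul (u := x *: 1) (v := J) (slice_regular_dy (x := x) (y := y) rf sJ).
  (* J commutes with the points of its own slice, so J q f_x can be rewritten as q J f_x. *)
  rewrite mulrDr (_ : J * (slice_pt J x y * _) = slice_pt J x y * (J * slice_dx f J x y))//.
  rewrite !mulrA; congr (_ * _).
  by rewrite /slice_pt mulrDl mulrDr mul_scale1 scale_mul1 -scalerAl -scalerAr.
- move=> J sJ z.
  have cp : slice_pt J w.1 w.2 @[w --> z] --> slice_pt J z.1 z.2.
    by apply: slice_pt_cvg; [exact: cvg_fst|exact: cvg_snd].
  apply: cvgD; last by apply: cvg_qmul => //; exact: (slice_regular_dx_continuous rf sJ).
  have cf : f p @[p --> slice_pt J z.1 z.2] --> f (slice_pt J z.1 z.2).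
    exact: slice_regular_continuous.
  exact: (@cvg_comp _ _ _ (fun w : R * R => slice_pt J w.1 w.2) f _ _ _ cp cf).
Qed.

(** The imaginary coordinates of J J = -1 say that twice the real part times each imaginary
    coordinate is 0. A nonzero real part would kill the imaginary part and leave a real square equal
    to -1. *)
Lemma sphere_qabs2 J : sphere J -> qre J = 0 /\ qabs2 J = 1.
Proof.
move=> /sphereE; rewrite qmul_components qoneE => e.
have e0 := congr1 (@qre R) e; have e1 := congr1 (@qi R) e.
have e2 := congr1 (@qj R) e; have e3 := congr1 (@qk R) e.
move: e0 e1 e2 e3; rewrite !quatE oppr0 => e0 e1 e2 e3.
have r0 : qre J = 0.
  have [//|r0] := eqVneq (qre J) 0.
  have i0 : qi J = 0.
    have : qre J * qi J = 0 by lra.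
    by move/eqP; rewrite mulf_eq0 (negPf r0)/= => /eqP.
  have j0 : qj J = 0.
    have : qre J * qj J = 0 by lra.
    by move/eqP; rewrite mulf_eq0 (negPf r0)/= => /eqP.
  have k0 : qk J = 0.
    have : qre J * qk J = 0 by lra.
    by move/eqP; rewrite mulf_eq0 (negPf r0)/= => /eqP.
  have := sqr_ge0 (qre J); move: e0; rewrite i0 j0 k0 expr2; lra.
by split => //; rewrite /qabs2 !expr2; move: e0; rewrite r0; lra.
Qed.

Lemma sphereP J : qre J = 0 -> qabs2 J = 1 -> sphere J.
Proof.
rewrite /qabs2 !expr2 => r0 e; rewrite /sphere/= expr2 qmul_components qoneE.
by apply: quat_eq; rewrite !quatE r0 ?oppr0; move: e; rewrite r0; lra.
Qed.

Lemma qabs_slice_pt J x y : sphere J -> qabs2 (slice_pt J x y) = x ^+ 2 + y ^+ 2.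
Proof.
move=> /sphere_qabs2[r0]; rewrite /qabs2 /slice_pt !quatE ?qoneEs r0 => e.
transitivity (x ^+ 2 + y ^+ 2 * (0 ^+ 2 + qi J ^+ 2 + qj J ^+ 2 + qk J ^+ 2)); first ring.
by rewrite e mulr1.
Qed.

Lemma slice_decomposition q : qabs (qim q) != 0 ->
  let y := qabs (qim q) in let J := y^-1 *: qim q in
  sphere J /\ q = slice_pt J (qre q) y.
Proof.
move=> y0 y J; have rim : qre (qim q) = 0 by rewrite /qim !quatE ?qre_one; ring.
split.
  apply: sphereP; first by rewrite /J quatE rim mulr0.
  rewrite -qabs_sqr /J qabsZ normfV ger0_norm ?qabs_ge0//.
  by rewrite -/y mulVf// expr1n.
by rewrite /slice_pt /J scalerA divff// scale1r /qim addrC subrK.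
Qed.

Lemma slice_decomposition0 q J : qabs (qim q) == 0 -> q = slice_pt J (qre q) 0.
Proof.
by rewrite qabs_eq0 /qim subr_eq0 => /eqP e; rewrite /slice_pt scale0r addr0 -e.
Qed.

(** Hides the two cases of [slice_derive]. Off the real axis f_y = J f_x, so half of f_x - J f_y is
    f_x; on the real axis the derivative along the line is f_x in any slice, and I is taken. *)
Lemma slice_deriveP f q I : slice_regular f -> sphere I ->
  exists J x y, [/\ sphere J, q = slice_pt J x y & slice_derive f q = slice_dx f J x y].
Proof.
move=> rf sI; rewrite /slice_derive; case: ifPn => [y0|y0].
  exists I, (qre q), 0; split; [exact: sI|exact: slice_decomposition0|].
  rewrite /slice_dx (_ : (fun s => f (slice_pt I s 0)) = (fun s => f (s *: 1)))//.
  by apply: funext => s; rewrite /slice_pt scale0r addr0.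
have [sJ e] := slice_decomposition y0.
eexists _, (qre q), _; split; [exact: sJ|exact: e|].
rewrite slice_regular_dyE// mulrA sphereE// mulN1r opprK.
set X := slice_dx _ _ _ _; have -> : X + X = 2 *: X by rewrite scaler_nat mulr2n.
by rewrite scalerA mulVf ?pnatr_eq0// scale1r.
Qed.

Lemma slice_decompositionP q I : sphere I -> exists J x y, sphere J /\ q = slice_pt J x y.
Proof.
move=> sI; have [y0|y0] := boolP (qabs (qim q) == 0).
  by exists I, (qre q), 0; split; [exact: sI|exact: slice_decomposition0].
by have [sJ e] := slice_decomposition y0; eexists _, (qre q), _; split; [exact: sJ|exact: e].
Qed.

End SliceRegularTheory.

(** * Power series *)

Section PowerSeries.
Variable R : realType.

Lemma half_double (q : quat R) : 2^-1 *: (q + q) = q.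
Proof.
have -> : q + q = 2 *: q by rewrite scaler_nat mulr2n.
by rewrite scalerA mulVf ?pnatr_eq0// scale1r.
Qed.

Lemma exprN_scale (q : quat R) n : (- q) ^+ n = (-1) ^+ n *: q ^+ n.
Proof.
elim: n => [|n ih]; first by rewrite !expr0 scale1r.
by rewrite [(-1) ^+ n.+1]exprS mulN1r scaleNr [(- q) ^+ n.+1]exprS ih mulNr [q ^+ n.+1]exprS scalerAr.
Qed.

Implicit Types (f g : quat R -> quat R) (a b : nat -> quat R) (p q : quat R).

Definition psum a N q : quat R := \sum_(n < N) q ^+ n * a n.

Definition has_series f a := forall q, psum a N q @[N --> \oo] --> f q.

Lemma cvg_shiftSW (u : nat -> quat R) (l : quat R) :
  u n.+1 @[n --> \oo] --> l -> u n @[n --> \oo] --> l.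
Proof. by move=> h; rewrite -(cvg_shiftS u). Qed.

Lemma psum0 a q : psum a 0 q = 0. Proof. by rewrite /psum big_ord0. Qed.

Lemma psumS a N q : psum a N.+1 q = psum a N q + q ^+ N * a N.
Proof. by rewrite /psum big_ord_recr. Qed.

Lemma psum_recl a N q : psum a N.+1 q = a 0%N + q * psum (fun n => a n.+1) N q.
Proof.
rewrite /psum big_ord_recl expr0 mul1r; congr (_ + _); rewrite mulr_sumr.
by apply: eq_bigr => i _; rewrite exprS mulrA.
Qed.

Lemma has_series_fun_unique f g a : has_series f a -> has_series g a -> f = g.
Proof. by move=> fa ga; apply: funext => q; exact: (cvg_unique _ (fa q) (ga q)). Qed.

Definition geo_bounded a (r C : R) := forall n, qabs (a n) * r ^+ n <= C.

(** A term is the difference of two consecutive partial sums, and a convergent sequence is bounded.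
    At a real point r this bounds |a_n| r^n, so pointwise convergence already controls the growth of
    the coefficients. *)
Lemma psum_cvg_bounded a q (l : quat R) : psum a N q @[N --> \oo] --> l ->
  exists2 C, 0 <= C & geo_bounded a (qabs q) C.
Proof.
move=> h; have /cvg_seq_bounded[M [Mr hM]] : cvgn (psum a ^~ q) by apply/cvg_ex; exists l.
have {}hM n : qabs (psum a n q) <= 2 * (`|M| + 1).
  apply: (le_trans (qabs_le_norm _)); rewrite ler_pM2l//.
  by apply: (hM (`|M| + 1)) => //; rewrite (le_lt_trans (ler_norm _))// ltrDl.
exists (2 * (2 * (`|M| + 1))); first by rewrite !mulr_ge0// addr_ge0.
move=> n; rewrite mulrC -qabsX -qabsM.
have -> : q ^+ n * a n = psum a n.+1 q + - psum a n q by rewrite psumS addrAC subrr add0r.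
by rewrite (le_trans (qabsD _ _))// qabsN; have := hM n; have := hM n.+1; lra.
Qed.

Lemma has_series_bounded f a (r : R) : has_series f a -> 0 <= r ->
  exists2 C, 0 <= C & geo_bounded a r C.
Proof.
move=> /(_ (r *: 1))/psum_cvg_bounded + r0.
by rewrite qabsZ qabs1 mulr1 ger0_norm.
Qed.

Lemma qabs_psumB a (N M : nat) q : (N <= M)%N ->
  qabs (psum a M q - psum a N q) <= \sum_(N <= n < M) qabs q ^+ n * qabs (a n).
Proof.
move=> NM; rewrite /psum -!(big_mkord xpredT (fun n => q ^+ n * a n)).
rewrite (big_cat_nat (leq0n N) NM)/= addrAC subrr add0r.
rewrite (le_trans (qabs_sum _ _ _))//.
by apply: ler_sum => i _; rewrite qabsM qabsX.
Qed.

Lemma sum_half (N M : nat) : \sum_(N <= n < M) (2^-1 : R) ^+ n <= 2 * 2^-1 ^+ N.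
Proof.
have [NM|MN] := leqP N M; last first.
  by rewrite big_geq ?(ltnW MN)// mulr_ge0// exprn_ge0// invr_ge0.
suff : \sum_(N <= n < M) (2^-1 : R) ^+ n = 2 * 2^-1 ^+ N - 2 * 2^-1 ^+ M.
  by move=> ->; rewrite gerBl mulr_ge0// exprn_ge0// invr_ge0.
rewrite -(subnKC NM); elim: (M - N)%N => [|k ih].
  by rewrite addn0 big_geq// subrr.
rewrite addnS big_nat_recr ?leq_addr//= ih exprS.
by field.
Qed.

(** Comparison with a geometric series of ratio t = |q| / r <= 1/2. The factor t^N is kept instead
    of 2^-N because the order of the remainder in |q| is what identifies lowest coefficients and
    limits at 0. *)
Lemma psum_tail a (r C : R) (N M : nat) q : 0 < r -> geo_bounded a r C ->
  2 * qabs q <= r -> (N <= M)%N ->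
  qabs (psum a M q - psum a N q) <= C * (2 * (qabs q / r) ^+ N).
Proof.
move=> r0 hC qr NM; apply: (le_trans (qabs_psumB a q NM)).
set t := qabs q / r.
have t0 : 0 <= t by rewrite divr_ge0 ?qabs_ge0// ltW.
have t2 : t <= 2^-1 by rewrite /t ler_pdivrMr// mulrC ler_pdivlMr// mulrC.
have C0 : 0 <= C by apply: le_trans (hC 0%N); rewrite mulr_ge0 ?qabs_ge0// exprn_ge0// ltW.
have term n : qabs q ^+ n * qabs (a n) <= C * t ^+ n.
  have -> : qabs q = t * r by rewrite /t divfK// gt_eqF.
  rewrite (_ : (t * r) ^+ n * _ = qabs (a n) * r ^+ n * t ^+ n); last by rewrite exprMn; ring.
  by rewrite ler_wpM2r ?exprn_ge0//; exact: hC.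
apply: (le_trans (ler_sum _ (fun n _ => term n))).
rewrite -mulr_sumr ler_wpM2l//.
have : \sum_(N <= n < M) t ^+ n <= \sum_(N <= n < M) (t ^+ N * 2 ^+ N) * (2^-1) ^+ n.
  rewrite big_nat_cond [leRHS]big_nat_cond; apply: ler_sum => n; rewrite andbT => /andP[Nn nM].
  rewrite -{1}(subnKC Nn) exprD -mulrA ler_wpM2l ?exprn_ge0//.
  rewrite -{2}(subnKC Nn) exprD mulrA -exprMn divff// expr1n mul1r.
  by rewrite lerXn2r// nnegrE// invr_ge0.
move=> /le_trans; apply; rewrite -mulr_sumr.
apply: (le_trans (ler_wpM2l _ (sum_half N M))); first by rewrite mulr_ge0// exprn_ge0.
by rewrite mulrCA -mulrA -exprMn divff// expr1n mulr1.
Qed.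

Lemma cvg_qabs_le (u : nat -> quat R) (l c : quat R) (e : R) (N : nat) : u n @[n --> \oo] --> l ->
  (forall n, (N <= n)%N -> qabs (u n - c) <= e) -> qabs (l - c) <= e.
Proof.
move=> ul h; apply: (@cvgr_to_le _ \oo _ _ (fun n => qabs (u n - c))).
  by apply: cvg_qabs; apply: cvgB => //; exact: cvg_cst.
by near=> n; apply: h; near: n; exact: nbhs_infty_ge.
Unshelve. all: end_near. Qed.

Lemma psum_lim_tail a (r C : R) (N : nat) q (l : quat R) : 0 < r -> geo_bounded a r C ->
  2 * qabs q <= r -> psum a n q @[n --> \oo] --> l ->
  qabs (l - psum a N q) <= C * (2 * (qabs q / r) ^+ N).
Proof.
by move=> r0 hC qr hl; apply: (cvg_qabs_le hl (N := N)) => n Nn; exact: psum_tail.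
Qed.

(* A series vanishing near 0 on the positive reals: dividing by the lowest
   nonzero term x^n leaves a remainder O(x). *)
Lemma psum_eq0 a (d : R) : 0 < d ->
  (forall x : R, 0 < x < d -> psum a N (x *: 1) @[N --> \oo] --> (0 : quat R)) ->
  forall n, a n = 0.
Proof.
move=> d0 h.
have hd : 0 < d / 2 < d by rewrite divr_gt0//= ltr_pdivrMr// ltr_pMr// ltr1n.
have [C C0] := psum_cvg_bounded (h _ hd).
rewrite qabsZ qabs1 mulr1; set r := `|d / 2| => hC.
have r0 : 0 < r by rewrite normr_gt0 gt_eqF// divr_gt0.
have rE : r = d / 2 by rewrite /r gtr0_norm// divr_gt0.
elim/ltn_ind => n ih; apply/eqP; rewrite -qabs_eq0; apply/eqP/le_anti; rewrite qabs_ge0 andbT.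
have key x : 0 < x -> 2 * x <= r -> qabs (a n) <= (C * 2 / r ^+ n.+1) * x.
  move=> x0 xr.
  have xd : 0 < x < d by rewrite x0/=; move: xr d0; rewrite rE; lra.
  have qx : qabs (x *: 1 : quat R) = x by rewrite qabsZ qabs1 mulr1 gtr0_norm.
  have := psum_lim_tail n.+1 r0 hC _ (h x xd); rewrite qx => /(_ xr).
  have -> : psum a n.+1 (x *: 1) = (x *: 1) ^+ n * a n.
    rewrite psumS /psum big1 ?add0r// => i _; rewrite ih// mulr0 //.
  rewrite sub0r qabsN qabsM qabsX qx expr_div_n exprS => H.
  rewrite -(ler_pM2l (exprn_gt0 n x0)); apply: (le_trans H).
  by rewrite le_eqVlt; apply/orP; left; apply/eqP; ring.
apply/ler_addgt0Pl => e e0; rewrite addr0.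
set K := C * 2 / r ^+ n.+1 in key.
have K0 : 0 <= K by rewrite /K divr_ge0 ?mulr_ge0// exprn_ge0// ltW.
(* The first bound puts x in the range of [key], the second makes K x <= e; K may be 0, hence K +
   1. *)
pose x := Num.min (r / 2) (e / (K + 1)).
have x0 : 0 < x by rewrite lt_min !divr_gt0// ltr_wpDl.
apply: (le_trans (key x x0 _)).
  by rewrite mulrC -ler_pdivlMr// ge_min lexx.
apply: (@le_trans _ _ (K * (e / (K + 1)))).
  by rewrite ler_wpM2l// ge_min lexx orbT.
by rewrite mulrA ler_pdivrMr ?ltr_wpDl// mulrC ler_pM2l// lerDl.
Qed.

Lemma psumB a b N q : psum (fun n => a n - b n) N q = psum a N q - psum b N q.
Proof. by rewrite /psum -sumrB; apply: eq_bigr => i _; rewrite mulrBr. Qed.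

(** Only small positive reals enter because they belong to every slice, which makes expansions found
    on different slices comparable. *)
Lemma psum_coef_unique a b (f : quat R -> quat R) (d : R) : 0 < d ->
  (forall x : R, 0 < x < d -> psum a N (x *: 1) @[N --> \oo] --> f (x *: 1)) ->
  (forall x : R, 0 < x < d -> psum b N (x *: 1) @[N --> \oo] --> f (x *: 1)) ->
  a = b.
Proof.
move=> d0 ha hb; apply/funext => n; apply: subr0_eq.
apply: (psum_eq0 (a := fun n => a n - b n) d0) => x xd.
under eq_fun do rewrite psumB.
by rewrite -(subrr (f (x *: 1))); apply: cvgB; [exact: ha|exact: hb].
Qed.

Lemma has_series_cst c : has_series (fun=> c) (fun n => if n == 0%N then c else 0).
Proof.
move=> q; apply: cvg_shiftSW.
apply: cvg_eqfun (cvg_cst c) => N /=.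
by rewrite psum_recl/= /psum big1 ?mulr0 ?addr0// => i _; rewrite mulr0.
Qed.

Lemma has_series_mul f a : has_series f a ->
  has_series (Defs.mul_fun f) (fun n => if n is m.+1 then a m else 0).
Proof.
move=> fa q; apply: cvg_shiftSW.
apply: cvg_eqfun (cvg_qmul (cvg_cst q) (fa q)) => N /=.
by rewrite psum_recl/= add0r.
Qed.

Lemma has_series_lin f g a b u v : has_series f a -> has_series g b ->
  has_series (fun q => f q * u + g q * v) (fun n => a n * u + b n * v).
Proof.
move=> fa gb q.
apply: cvg_eqfun (cvgD (cvg_qmul (fa q) (cvg_cst u)) (cvg_qmul (gb q) (cvg_cst v))) => N.
by rewrite fctE /psum !mulr_suml -big_split/=; apply: eq_bigr => i _; rewrite mulrDr !mulrA.
Qed.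

Lemma has_series_scale f a (c : R) : has_series f a ->
  has_series (fun q => c *: f q) (fun n => c *: a n).
Proof.
move=> fa q; apply: cvg_eqfun (cvgZ (cvg_cst c) (fa q)) => N.
by rewrite /psum scaler_sumr; apply: eq_bigr => i _; rewrite scalerAr.
Qed.

Lemma has_series_add f g a b : has_series f a -> has_series g b ->
  has_series (fun q => f q + g q) (fun n => a n + b n).
Proof.
move=> fa gb q; apply: cvg_eqfun (cvgD (fa q) (gb q)) => N.
by rewrite fctE /psum -big_split/=; apply: eq_bigr => i _; rewrite mulrDr.
Qed.

Lemma has_series_reflect f a : has_series f a ->
  has_series (reflect_fun f) (fun n => (-1) ^+ n *: a n).
Proof.
move=> fa q; apply: cvg_eqfun (fa (- q)) => N.
by rewrite /psum; apply: eq_bigr => i _; rewrite exprN_scale -scalerAr scalerAl.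
Qed.

Definition even_coef a n : quat R := if odd n then 0 else a n.
Definition odd_coef a n : quat R := if odd n then a n else 0.

Lemma has_series_even f a : has_series f a -> has_series (even_part f) (even_coef a).
Proof.
move=> fa; have := has_series_scale (c := 2^-1) (has_series_add fa (has_series_reflect fa)).
congr has_series; apply/funext => n; rewrite /even_coef -signr_odd.
case: (odd n); rewrite ?expr1 ?scaleN1r ?subrr ?scaler0// expr0 scale1r.
exact: half_double.
Qed.

Lemma has_series_odd f a : has_series f a -> has_series (odd_part f) (odd_coef a).
Proof.
move=> fa; have := has_series_scale (c := 2^-1)
  (has_series_add fa (has_series_scale (c := -1) (has_series_reflect fa))).
rewrite (_ : (fun q => _) = odd_part f); last first.
  by apply: funext => q; rewrite scaleN1r.
congr has_series; apply/funext => n; rewrite /odd_coef -signr_odd.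
case: (odd n); rewrite ?expr1 ?expr0 ?scale1r ?scaleN1r ?opprK ?subrr ?scaler0//.
exact: half_double.
Qed.

Definition poly_fun a N : quat R -> quat R := fun q => psum a N q.

Lemma has_series_poly a N : has_series (poly_fun a N) (fun n => if (n < N)%N then a n else 0).
Proof.
move=> q; apply: cvg_near_cst; near=> M; rewrite /poly_fun /psum.
have NM : (N <= M)%N by near: M; exact: nbhs_infty_ge.
rewrite (big_ord_widen M (fun n => q ^+ n * a n) NM) [RHS]big_mkcond/=.
by apply: eq_bigr => i _; case: ifP => //; rewrite mulr0.
Unshelve. all: end_near. Qed.

Lemma slice_regular_poly a N : slice_regular (poly_fun a N).
Proof.
elim: N a => [|N ih] a.
  apply: (slice_regular_ext (f := fun=> 0)) (slice_regular_cst 0) => q.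
  by rewrite /poly_fun psum0.
apply: (slice_regular_ext (f := fun q => (fun=> a 0%N) q * 1 +
    Defs.mul_fun (poly_fun (fun n => a n.+1) N) q * 1)).
  by move=> q; rewrite /poly_fun psum_recl !mulr1.
by apply: slice_regular_lin; [exact: slice_regular_cst|apply: slice_regular_mul; exact: ih].
Qed.

End PowerSeries.

(** * Termwise differentiation and the coefficients of the Dunkl operator *)

Section TermwiseDerivative.
Variable R : realType.

(** Makes the limit in [inv_odd_part] at 0 unique: every punctured neighbourhood of 0 contains small
    nonzero reals. *)
Lemma proper_dnbhs0_quat : ProperFilter ((0 : quat R)^').
Proof.
apply: Build_ProperFilter_ex => A hA.
have h1 : t *: (1 : quat R) @[t --> (0 : R)] --> (0 : quat R).
  by rewrite -[X in _ --> X](scale0r (1 : quat R)); apply: cvgZr_tmp; exact: cvg_id.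
have : \forall t \near (0 : R)^', A (t *: (1 : quat R)).
  near=> t.
  have t0 : t *: (1 : quat R) != 0.
    by rewrite scaler_eq0 oner_eq0 orbF; near: t; exact: nbhs_dnbhs_neq.
  move: t0; near: t; apply: nbhs_dnbhs; exact: (h1 _ hA).
by move=> /filter_ex[t At]; exists (t *: 1).
Unshelve. all: end_near. Qed.

Implicit Types (f g : quat R -> quat R) (a b : nat -> quat R) (p q : quat R).

Lemma qcvg_near (T : Type) (F : set_system T) {FF : Filter F} (u : T -> quat R) (l : quat R) (e : R) :
  u x @[x --> F] --> l -> 0 < e -> \forall x \near F, qabs (u x - l) <= e.
Proof.
move=> ul e0; have : qabs (u x - l) @[x --> F] --> (0 : R).
  rewrite -(@qabs0 R) -(subrr l); apply: cvg_qabs; apply: cvgB => //; exact: cvg_cst.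
move=> /cvgrPdist_le/(_ _ e0); apply: filterS => x.
by rewrite sub0r normrN ger0_norm// qabs_ge0.
Qed.

(** The derivative of p^n along a real increment, which commutes with p. At n = 0 the truncated
    exponent is harmless, as the factor n is 0. *)
Definition pow_deriv p n : quat R := n%:R *: p ^+ n.-1.

Lemma mul_pow_deriv p n : p * pow_deriv p n = n%:R *: p ^+ n.
Proof.
by case: n => [|n]; rewrite /pow_deriv -scalerAr ?scale0r// -exprS.
Qed.

Lemma pow_derivS p n : pow_deriv p n.+1 = p ^+ n + p * pow_deriv p n.
Proof. by rewrite mul_pow_deriv /pow_deriv -natr1 scalerDl scale1r addrC. Qed.

Lemma qabs_pow_deriv p n (r : R) : 1 <= r -> qabs p <= r -> qabs (pow_deriv p n) <= n%:R * r ^+ n.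
Proof.
move=> r1 pr; rewrite qabsZ ger0_norm// ler_wpM2l// qabsX.
apply: (@le_trans _ _ (r ^+ n.-1)).
  by rewrite lerXn2r// nnegrE ?qabs_ge0// (le_trans ler01).
by rewrite ler_weXn2l// leq_pred.
Qed.

Lemma taylor_rearrange (X Y Z W V : quat R) (h : R) :
  X + (Y + h *: Z + (h *: W + V)) - Y - h *: (W + Z) = X + V.
Proof. by apply/rowP => i; rewrite !mxE; ring. Qed.

(** The remainders satisfy E_(n+1) = (p + h) E_n + h^2 n p^(n-1). Since r >= 1, every power may be
    raised to r^(n+1), and the induction closes with n^2 + n <= (n + 1)^2. *)
Lemma pow_taylor_le p (h r : R) n : 1 <= r -> qabs p + `|h| <= r ->
  qabs ((p + h *: 1) ^+ n - p ^+ n - h *: pow_deriv p n) <= n%:R ^+ 2 * h ^+ 2 * r ^+ n.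
Proof.
move=> r1 pr.
have pr' : qabs p <= r by rewrite (le_trans _ pr)// lerDl.
have r0 : 0 <= r by rewrite (le_trans ler01).
elim: n => [|n ih].
  by rewrite /pow_deriv scale0r scaler0 subr0 !expr0 subrr qabs0 expr0n mul0r mul0r.
have -> : (p + h *: 1) ^+ n.+1 - p ^+ n.+1 - h *: pow_deriv p n.+1 =
   (p + h *: 1) * ((p + h *: 1) ^+ n - p ^+ n - h *: pow_deriv p n) + h ^+ 2 *: pow_deriv p n.
  rewrite pow_derivS [(p + _) ^+ n.+1]exprS [p ^+ n.+1]exprS.
  set E := _ - h *: pow_deriv p n.
  have -> : (p + h *: 1) ^+ n = E + (p ^+ n + h *: pow_deriv p n) by rewrite /E addrACA subrK addNr addr0.
  move: E => E.
  rewrite mulrDr [(p + h *: 1) * (p ^+ n + _)]mulrDl !mulrDr !scale_mul1 scalerA -expr2 -scalerAr.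
  exact: taylor_rearrange.
apply: (le_trans (qabsD _ _)); rewrite qabsM qabsZ.
have ph : qabs (p + h *: 1) <= r.
  by rewrite (le_trans (qabsD _ _))// qabsZ qabs1 mulr1.
have e1 := ler_pM (qabs_ge0 _) (qabs_ge0 _) ph ih.
have e2 : `|h ^+ 2| * qabs (pow_deriv p n) <= h ^+ 2 * (n%:R * r ^+ n).
  by rewrite ger0_norm ?sqr_ge0// ler_wpM2l ?sqr_ge0// qabs_pow_deriv.
apply: (le_trans (lerD e1 e2)).
have rr : r ^+ n <= r ^+ n.+1 by rewrite ler_weXn2l.
have h2 : 0 <= h ^+ 2 := sqr_ge0 _.
have e3 : h ^+ 2 * (n%:R * r ^+ n) <= h ^+ 2 * (n%:R * r ^+ n.+1) by rewrite ler_wpM2l// ler_wpM2l.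
apply: (le_trans (lerD (lexx _) e3)).
have -> : r * (n%:R ^+ 2 * h ^+ 2 * r ^+ n) + h ^+ 2 * (n%:R * r ^+ n.+1)
   = (n%:R ^+ 2 + n%:R) * (h ^+ 2 * r ^+ n.+1) by rewrite [r ^+ n.+1]exprS; ring.
rewrite -mulrA; apply: ler_wpM2r; first by rewrite mulr_ge0// exprn_ge0.
rewrite -natr1; have : 0 <= n%:R :> R by []; set m : R := n%:R; nra.
Qed.

Definition deriv_coef a n := n.+1%:R *: a n.+1.

Lemma psum_pow_deriv a N p : \sum_(n < N.+1) pow_deriv p n * a n = psum (deriv_coef a) N p.
Proof.
rewrite big_ord_recl /pow_deriv scale0r mul0r add0r; apply: eq_bigr => i _.
by rewrite /deriv_coef -scalerAl -scalerAr.
Qed.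

(** The bound is uniform in N, which lets the limits in N and in h be interchanged. The 8 is 4 times
    2: 4^n absorbs the n^2 of [pow_taylor_le], and the remaining 2^-n sums to at most 2. *)
Lemma psum_taylor_le a (C h r : R) N p : 1 <= r -> qabs p + `|h| <= r -> geo_bounded a (8 * r) C ->
  qabs (psum a N.+1 (p + h *: 1) - psum a N.+1 p - h *: psum (deriv_coef a) N p) <= 2 * C * h ^+ 2.
Proof.
move=> r1 pr hC; rewrite -psum_pow_deriv /psum scaler_sumr -!sumrB.
have C0 : 0 <= C.
  by apply: le_trans (hC 0%N); rewrite mulr_ge0 ?qabs_ge0// exprn_ge0// mulr_ge0// (le_trans ler01).
apply: (le_trans (qabs_sum _ _ _)).
apply: (@le_trans _ _ (\sum_(n < N.+1) (C * h ^+ 2) * 2^-1 ^+ n)); last first.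
  rewrite -mulr_sumr -(big_mkord xpredT (fun n => (2^-1 : R) ^+ n)).
  have := sum_half R 0 N.+1; rewrite expr0 mulr1 => H.
  have := ler_wpM2l (mulr_ge0 C0 (sqr_ge0 h)) H; lra.
apply: ler_sum => n _.
have -> : (p + h *: 1) ^+ n * a n - p ^+ n * a n - h *: (pow_deriv p n * a n)
   = ((p + h *: 1) ^+ n - p ^+ n - h *: pow_deriv p n) * a n.
  by rewrite !mulrBl scalerAl.
rewrite qabsM; apply: (le_trans (ler_wpM2r (qabs_ge0 _) (pow_taylor_le n r1 pr))).
have n2 : n%:R ^+ 2 <= 4 ^+ n :> R.
  have -> : (4 : R) ^+ n = (2 ^ n)%N%:R ^+ 2.
    by rewrite natrX -exprM mulnC exprM; congr (_ ^+ n); rewrite expr2; lra.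
  by apply: lerXn2r; rewrite ?nnegrE// ler_nat ltnW// ltn_expl.
have e : 4 ^+ n * r ^+ n * qabs (a n) <= C * 2^-1 ^+ n.
  have -> : 4 ^+ n * r ^+ n * qabs (a n) = (qabs (a n) * (8 * r) ^+ n) * 2^-1 ^+ n.
    have -> : (4 : R) = 8 / 2 by lra.
    by rewrite !exprMn; ring.
  by rewrite ler_wpM2r// exprn_ge0// invr_ge0.
have h2 := sqr_ge0 h.
have rn : 0 <= r ^+ n by rewrite exprn_ge0// (le_trans ler01).
have -> : n%:R ^+ 2 * h ^+ 2 * r ^+ n * qabs (a n) = h ^+ 2 * (n%:R ^+ 2 * (r ^+ n * qabs (a n))) by ring.
have -> : C * h ^+ 2 * 2^-1 ^+ n = h ^+ 2 * (C * 2^-1 ^+ n) by ring.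
rewrite ler_wpM2l//; apply: le_trans e; rewrite -mulrA; apply: ler_wpM2r n2.
by apply: mulr_ge0 => //; exact: qabs_ge0.
Qed.

(** The limit L is given, so h can be fixed first, with difference quotient within e/4 of L and
    Taylor error 2C|h| <= e/4. For this h, N is taken so large that the increments of the partial
    sums are close to those of f. *)
Lemma psum_deriv_cvg f a p (L : quat R) : has_series f a ->
  h^-1 *: (f (p + h *: 1) - f p) @[h --> (0 : R)^'] --> L ->
  psum (deriv_coef a) N p @[N --> \oo] --> L.
Proof.
move=> fa hL.
(* The radius leaves room for |h| <= 1 and is at least 1, as [psum_taylor_le] requires. *)
pose r := qabs p + 1; have r1 : 1 <= r by rewrite lerDr qabs_ge0.
have [C C0 hC] := has_series_bounded fa (mulr_ge0 (ler0n R 8) (le_trans ler01 r1)).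
apply/cvgrPdist_le => e e0.
have e4 : 0 < e / 4 by rewrite divr_gt0.
have [h [h0 h1 hLe hCe]] : exists h : R, [/\ h != 0, `|h| <= 1,
    qabs (h^-1 *: (f (p + h *: 1) - f p) - L) <= e / 4 & 2 * C * `|h| <= e / 4].
  near ((0 : R)^') => h; exists h; split.
  - by near: h; exact: nbhs_dnbhs_neq.
  - by near: h; apply: dnbhs0_le.
  - by near: h; apply: qcvg_near.
  - have hh : `|h| <= e / 4 / (2 * C + 1).
      by near: h; apply: dnbhs0_le; rewrite divr_gt0// ltr_wpDl// mulr_ge0.
    apply: (le_trans (ler_wpM2l _ hh)); first by rewrite mulr_ge0.
    rewrite mulrA ler_pdivrMr ?ltr_wpDl ?mulr_ge0// mulrC ler_wpM2l ?(ltW e4)// lerDl//.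
have pr : qabs p + `|h| <= r by rewrite lerD2l.
have cv : psum a N.+1 (p + h *: 1) - psum a N.+1 p @[N --> \oo] --> f (p + h *: 1) - f p.
  by apply: cvgB; rewrite (cvg_shiftS (psum a ^~ _)); exact: fa.
have e4h : 0 < e / 4 * `|h| by rewrite mulr_gt0// normr_gt0.
have hne := qcvg_near cv e4h.
near=> N.
rewrite distrC (le_trans (norm_le_qabs _))//.
set S := psum _ N p.
have -> : S - L = - (h^-1 *: (psum a N.+1 (p + h *: 1) - psum a N.+1 p - h *: S))
   + h^-1 *: ((psum a N.+1 (p + h *: 1) - psum a N.+1 p) - (f (p + h *: 1) - f p))
   + (h^-1 *: (f (p + h *: 1) - f p) - L).
  rewrite [h^-1 *: (_ - h *: S)]scalerBr [h^-1 *: (h *: S)]scalerA mulVf// scale1r opprB.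
  rewrite [h^-1 *: (_ - (f _ - _))]scalerBr.
  set X := h^-1 *: (psum _ _ _ - _); set Y := h^-1 *: (f _ - _).
  by rewrite [S - X + (X - Y)]addrA subrK addrA subrK.
apply: (le_trans (qabsD _ _)); have -> : e = e / 4 + e / 4 + e / 4 + e / 4 by lra.
rewrite -[leRHS]addrA; apply: lerD; last by rewrite (le_trans hLe)// lerDl ltW.
apply: (le_trans (qabsD _ _)); rewrite qabsN !qabsZ normfV.
apply: lerD.
  rewrite mulrC ler_pdivrMr ?normr_gt0//.
  apply: (le_trans (psum_taylor_le N r1 pr hC)).
  by rewrite -(real_normK (num_real h)) expr2 mulrA ler_wpM2r.
rewrite mulrC ler_pdivrMr ?normr_gt0//.
by near: N; exact: hne.
Unshelve. all: end_near. Qed.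

Definition gam (alpha : R) n : R := n%:R + (2 * alpha + 1) * (odd n)%:R.

Lemma has_series_slice_derive (I : quat R) f a : sphere I -> slice_regular f -> has_series f a ->
  has_series (slice_derive f) (deriv_coef a).
Proof.
move=> sI rf fa q; have [J [x [y [sJ -> ->]]]] := slice_deriveP q rf sI.
apply: (psum_deriv_cvg fa); apply: cvg_eqfun (slice_regular_dx (x := x) (y := y) rf sJ) => h.
have -> : slice_pt J (h + x) y = slice_pt J x y + h *: 1 by rewrite /slice_pt scalerDl -addrA addrC.
by [].
Qed.

Lemma psum_at0 a N : psum a N.+1 0 = a 0%N.
Proof. by rewrite psum_recl mul0r addr0. Qed.

Lemma has_series_inv_odd_part f a : has_series f a ->
  has_series (inv_odd_part f) (fun n => odd_coef a n.+1).
Proof.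
move=> /has_series_odd fo q; rewrite /inv_odd_part; case: eqP => [->|/eqP q0].
  have [C C0 hC] := has_series_bounded fo ler01.
  rewrite (_ : lim _ = odd_coef a 1); last first.
    have ? := proper_dnbhs0_quat; apply: cvg_lim => //.
    apply: (@qcvg_le _ _ _ _ _ _ (fun p => C * (2 * qabs p))).
      rewrite -(mulr0 C) -[in X in _ * X](mulr0 2) -[in X in 2 * X](@qabs0 R).
      apply: cvgM; [exact: cvg_cst|apply: cvgM; [exact: cvg_cst|]].
      by apply: cvg_qabs; exact: cvg_within.
    near=> p.
    have p0 : p != 0 by near: p; exact: nbhs_dnbhs_neq.
    have p2 : 2 * qabs p <= 1.
      have : `|p| <= 4^-1 by near: p; apply: dnbhs0_le.
      by have := qabs_le_norm p; lra.
    (* After two terms, of which the constant one is 0, the remainder is quadratic in |p|; divided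
       by |p| it still tends to 0. *)
    have := psum_lim_tail 2 ltr01 hC p2 (fo p).
    rewrite !psumS psum0 add0r expr0 mul1r expr1 {1}/odd_coef/= add0r divr1.
    have -> : odd_part f p - p * odd_coef a 1 = p * (p^-1 * odd_part f p - odd_coef a 1).
      by rewrite mulrBr mulrA divrr ?mul1r.
    have qp : 0 < qabs p by rewrite lt_neqAle eq_sym qabs_eq0 p0 qabs_ge0.
    rewrite qabsM expr2 (_ : C * (2 * (qabs p * qabs p)) = qabs p * (C * (2 * qabs p))); last by ring.
    by rewrite ler_pM2l.
  apply: cvg_shiftSW; under eq_fun do rewrite psum_at0; exact: cvg_cst.
have H : q^-1 * psum (odd_coef a) N.+1 q @[N --> \oo] --> q^-1 * odd_part f q.
  rewrite (cvg_shiftS (fun N => q^-1 * psum (odd_coef a) N q)).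
  by apply: cvg_qmul; [exact: cvg_cst|exact: fo].
by apply: cvg_eqfun H => N; rewrite psum_recl {2}/odd_coef/= add0r mulrA mulVr ?mul1r.
Unshelve. all: end_near. Qed.

Lemma has_series_dunkl (alpha : R) (I : quat R) f a : sphere I -> slice_regular f -> has_series f a ->
  has_series (dunkl_fun alpha f) (fun n => gam alpha n.+1 *: a n.+1).
Proof.
move=> sI rf fa.
have := has_series_add (has_series_slice_derive sI rf fa)
  (has_series_scale (c := 2 * alpha + 1) (has_series_inv_odd_part fa)).
congr has_series; apply: funext => n; rewrite /deriv_coef /odd_coef /gam [RHS]scalerDl; congr (_ + _).
by case: (odd n.+1); rewrite ?mulr1 ?mulr0 ?scaler0 ?scale0r.
Qed.

End TermwiseDerivative.

(** * Cauchy's formula on a slice *)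

Section ProductMeasurability.
Variable R : realType.
Local Notation mR := (measurableTypeR R).

(** The plane carries the product sigma-algebra, so openness has to be reduced to rectangles: U is a
    countable union of squares with rational centre and size. *)
Lemma open_measurable2 (U : set (R * R)) : open U -> measurable (U : set (mR * mR)).
Proof.
move=> oU.
pose box (a b r : rat) : set (R * R) :=
  (ball (ratr a : R) (ratr r : R) `*` ball (ratr b : R) (ratr r : R)).
(* Squares that leave U are replaced by the empty set, which keeps the union indexed by all
   rationals. *)
pose F (a b r : rat) : set (mR * mR) := if pselect (box a b r `<=` U) then box a b r else set0.
have -> : U = \bigcup_a \bigcup_b \bigcup_r F a b r.
  apply/seteqP; split => [[x y] Uxy|[x y] [a _ [b _ [r _]]]]; last first.
    by rewrite /F; case: pselect => // h /h.
  have /nbhs_ballP[e /= e0 he] : nbhs (x, y) U by exact: open_nbhs_nbhs.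
  have e20 : 0 < e / 2 by rewrite divr_gt0.
  have [r] := rat_in_itvoo e20; rewrite in_itv/= => /andP[r0 re].
  have [a] := @rat_in_itvoo R (x - ratr r) (x + ratr r) ltac:(lra).
  have [b] := @rat_in_itvoo R (y - ratr r) (y + ratr r) ltac:(lra).
  rewrite !in_itv/= => /andP[b1 b2] /andP[a1 a2].
  exists a => //; exists b => //; exists r => //; rewrite /F; case: pselect => [hb|hb].
    by split; rewrite /ball/= ltr_distlC; lra.
  exfalso; apply: hb => -[u v] [/=]; rewrite /ball/= => hu hv; apply: he; split;
    rewrite /ball/=; move: hu hv; rewrite !ltr_distl; lra.
apply: bigcupT_measurable_rat => a; apply: bigcupT_measurable_rat => b.
apply: bigcupT_measurable_rat => r; rewrite /F; case: pselect => hb /=; last exact: measurable0.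
by apply: measurableX; apply: open_measurable; exact: ball_open.
Qed.

Lemma continuous_measurable_fun2 (f : R * R -> R) :
  continuous f -> measurable_fun [set: mR * mR] (f : mR * mR -> R).
Proof.
move=> /continuousP cf; apply: (measurability _ (RGenOpens.measurableE R)).
move=> _ [_ [a [b ->] <-]]; rewrite setTI; apply: open_measurable2.
exact/cf/interval_open.
Qed.

Local Notation mu := (@lebesgue_measure R).

Lemma continuous_rectangle_integrable (g : R * R -> R) (a b c d : R) : continuous g ->
  (mu \x mu)%E.-integrable (`[a, b]%classic `*` `[c, d]%classic : set (mR * mR)) (EFin \o (g : mR * mR -> R)).
Proof.
move=> cg; apply: measurable_bounded_integrable.
- exact: measurableX.
- rewrite [ltLHS]product_measure1E//= !lebesgue_measure_itv/= !lte_fin.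
  by case: ifPn => _; case: ifPn => _; rewrite ?mule0 ?mul0e -?EFinB -?EFinM ltry.
- by apply: measurable_funTS; exact: continuous_measurable_fun2.
- have : compact (g @` (`[a, b]%classic `*` `[c, d]%classic)).
    apply: continuous_compact; first exact: continuous_subspaceT.
    by apply: compact_setX; exact: segment_compact.
  move=> /compact_bounded[M [Mr hM]]; exists M; split => // N MN z Az.
  by apply: (hM _ MN); exists z.
Qed.

Lemma continuous_section1 (g : R * R -> R) x : continuous g -> continuous (fun y => g (x, y)).
Proof.
move=> cg y; apply: (@cvg_comp _ _ _ (fun y => (x, y)) g); last exact: cg.
by apply: (cvg_pair (F := nbhs y) (G := nbhs x) (H := nbhs y)); [exact: cvg_cst|exact: cvg_id].
Qed.

Lemma continuous_section2 (g : R * R -> R) y : continuous g -> continuous (fun x => g (x, y)).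
Proof.
move=> cg x; apply: (@cvg_comp _ _ _ (fun x => (x, y)) g); last exact: cg.
by apply: (cvg_pair (F := nbhs x) (G := nbhs x) (H := nbhs y)); [exact: cvg_id|exact: cvg_cst].
Qed.

Lemma continuous_itv_integrable (f : R -> R) a b : continuous f ->
  mu.-integrable `[a, b] (EFin \o f).
Proof.
by move=> cf; apply: continuous_compact_integrable;
  [exact: segment_compact|exact: continuous_subspaceT].
Qed.

(** Fubini for g extended by zero outside the rectangle. The inner integrals are finite, being those
    of continuous functions on segments, so real and extended integrals agree. *)
Lemma Rintegral_rectangle_swap (g : R * R -> R) (a b c d : R) : continuous g ->
  \int[mu]_(x in `[a, b]) (\int[mu]_(y in `[c, d]) g (x, y)) =
  \int[mu]_(y in `[c, d]) (\int[mu]_(x in `[a, b]) g (x, y)).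
Proof.
move=> cg; set A : set (mR * mR) := `[a, b]%classic `*` `[c, d]%classic.
pose G : mR * mR -> \bar R := (EFin \o g) \_ A.
have iG : (mu \x mu)%E.-integrable [set: mR * mR] G.
  have mA : measurable A by exact: measurableX.
  exact: (integrable_mkcond _ mA).1 (continuous_rectangle_integrable a b c d cg).
have GE x y : G (x, y) = if (x \in `[a, b]%classic) && (y \in `[c, d]%classic)
    then (g (x, y))%:E else 0%E.
  by rewrite /G /patch /A in_setX.
have E1 x : (\int[mu]_y G (x, y) =
    ((EFin \o (fun x => (\int[mu]_(y in `[c, d]) g (x, y))%R)) \_ `[a, b]) x)%E.
  rewrite /patch; case: ifPn => xab; last first.
    by apply: integral0_eq => y _; rewrite GE (negPf xab).
  rewrite /= /Rintegral fineK; last first.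
    by apply: integrable_fin_num => //; apply: continuous_itv_integrable; exact: continuous_section1.
  by rewrite [RHS]integral_mkcond; apply: eq_integral => y _; rewrite GE xab/= /patch.
have E2 y : (\int[mu]_x G (x, y) =
    ((EFin \o (fun y => (\int[mu]_(x in `[a, b]) g (x, y))%R)) \_ `[c, d]) y)%E.
  rewrite /patch; case: ifPn => ycd; last first.
    by apply: integral0_eq => x _; rewrite GE (negPf ycd) andbF.
  rewrite /= /Rintegral fineK; last first.
    by apply: integrable_fin_num => //; apply: continuous_itv_integrable; exact: continuous_section2.
  by rewrite [RHS]integral_mkcond; apply: eq_integral => x _; rewrite GE ycd andbT /patch.
have := Fubini iG.
under eq_integral do rewrite E1; under [in RHS]eq_integral do rewrite E2.
by rewrite -!integral_mkcond => h; rewrite [LHS]/Rintegral [RHS]/Rintegral; congr fine.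
Qed.

End ProductMeasurability.

Lemma continuous_comp2 (R : realType) (T U : topologicalType) (F : R * R -> U) (u v : T -> R) :
  continuous F -> continuous u -> continuous v -> continuous (fun z => F (u z, v z)).
Proof.
move=> cF cu cv z; apply: (@cvg_comp _ _ _ (fun z => (u z, v z)) F _ (nbhs (u z, v z))); last exact: cF.
by apply: (cvg_pair (F := nbhs z) (G := nbhs (u z)) (H := nbhs (v z))); [exact: cu|exact: cv].
Qed.

(** * Integrals of quaternion-valued functions over segments *)

Section QuatIntegral.
Variable R : realType.
Local Notation mu := (@lebesgue_measure R).
Implicit Types (h : R -> quat R) (a b : R).

Definition qint a b h : quat R := \row_i \int[mu]_(t in `[a, b]) h t ord0 i.

Lemma qintE a b h i : qint a b h ord0 i = \int[mu]_(t in `[a, b]) h t ord0 i.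
Proof. by rewrite mxE. Qed.

Lemma qcoord_continuous_comp (T : topologicalType) (h : T -> quat R) i :
  continuous h -> continuous (fun t => h t ord0 i).
Proof. by move=> ch t; exact: (cvg_qcoord (i := i) (ch t)). Qed.

Lemma qcoord_integrable h i a b : continuous h ->
  mu.-integrable `[a, b] (EFin \o (fun t => h t ord0 i)).
Proof. by move=> ch; apply: continuous_itv_integrable; exact: qcoord_continuous_comp. Qed.

Lemma qintD h h' a b : continuous h -> continuous h' ->
  qint a b (fun t => h t + h' t) = qint a b h + qint a b h'.
Proof.
move=> ch ch'; apply/rowP => i; rewrite qintE mxE !qintE -RintegralD//; last 2 first.
  exact: qcoord_integrable. exact: qcoord_integrable.
by apply: eq_Rintegral => t _; rewrite mxE.
Qed.

Lemma qcoord_mul (c q : quat R) i :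
  (c * q) ord0 i = \sum_j (c * (delta_mx ord0 j : quat R)) ord0 i * q ord0 j.
Proof.
rewrite {1}(row_sum_delta (q : 'rV[R]_4)) mulr_sumr summxE; apply: eq_bigr => j _.
by rewrite -scalerAr mxE mulrC.
Qed.

Lemma continuous_sumf (I : Type) (s : seq I) (F : I -> R -> R) :
  (forall i, continuous (F i)) -> continuous (fun t => \sum_(i <- s) F i t).
Proof.
move=> cF; elim: s => [|i s ih] t.
  by rewrite /continuous_at big_nil; under eq_fun do rewrite big_nil; exact: cvg_cst.
by rewrite /continuous_at big_cons; under eq_fun do rewrite big_cons; apply: cvgD; [exact: cF|exact: ih].
Qed.

Lemma Rintegral_sum (I : Type) (s : seq I) (F : I -> R -> R) a b :
  (forall i, continuous (F i)) ->
  \int[mu]_(t in `[a, b]) (\sum_(i <- s) F i t) = \sum_(i <- s) \int[mu]_(t in `[a, b]) F i t.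
Proof.
move=> cF; elim: s => [|i s ih].
  rewrite big_nil; under eq_Rintegral do rewrite big_nil.
  by rewrite Rintegral_cst// mul0r.
rewrite big_cons -ih; under eq_Rintegral do rewrite big_cons.
rewrite RintegralD//; first exact: continuous_itv_integrable.
by apply: continuous_itv_integrable; exact: continuous_sumf.
Qed.

(** Left multiplication by c is a real linear map, whose matrix [qcoord_mul] displays, and each
    coordinate is a finite real combination of integrals. *)
Lemma qint_mull (c : quat R) h a b : continuous h ->
  qint a b (fun t => c * h t) = c * qint a b h.
Proof.
move=> ch; apply/rowP => i; rewrite qcoord_mul qintE.
under eq_Rintegral do rewrite qcoord_mul.
rewrite Rintegral_sum; last first.
  by move=> j t; apply: cvgM; [exact: cvg_cst|exact: qcoord_continuous_comp].
apply: eq_bigr => j _; rewrite RintegralZl//; last exact: qcoord_integrable.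
by rewrite qintE.
Qed.

Lemma qint0 a b : qint a b (fun=> 0) = 0.
Proof.
apply/rowP => i; rewrite qintE; under eq_Rintegral do rewrite mxE.
by rewrite Rintegral_cst// mul0r mxE.
Qed.

Lemma continuous_qmul (T : topologicalType) (h h' : T -> quat R) :
  continuous h -> continuous h' -> continuous (fun t => h t * h' t).
Proof. by move=> ch ch' t; apply: cvg_qmul; [exact: ch|exact: ch']. Qed.

Lemma continuous_qadd (T : topologicalType) (h h' : T -> quat R) :
  continuous h -> continuous h' -> continuous (fun t => h t + h' t).
Proof. by move=> ch ch' t; apply: cvgD; [exact: ch|exact: ch']. Qed.

Lemma continuous_qcst (T : topologicalType) (c : quat R) : continuous (fun _ : T => c).
Proof. by move=> t; exact: cvg_cst. Qed.

Lemma continuous_qsum (I : Type) (s : seq I) (F : I -> R -> quat R) :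
  (forall i, continuous (F i)) -> continuous (fun t => \sum_(i <- s) F i t).
Proof.
move=> cF; elim: s => [|i s ih] t.
  by rewrite /continuous_at big_nil; under eq_fun do rewrite big_nil; exact: cvg_cst.
by rewrite /continuous_at big_cons; under eq_fun do rewrite big_cons; apply: cvgD; [exact: cF|exact: ih].
Qed.

Lemma qint_sum (I : Type) (s : seq I) (F : I -> R -> quat R) a b :
  (forall i, continuous (F i)) ->
  qint a b (fun t => \sum_(i <- s) F i t) = \sum_(i <- s) qint a b (F i).
Proof.
move=> cF; elim: s => [|i s ih].
  by rewrite big_nil; under [X in qint _ _ X]eq_fun do rewrite big_nil; exact: qint0.
rewrite big_cons -ih; under [X in qint _ _ X]eq_fun do rewrite big_cons.
by rewrite qintD//; exact: continuous_qsum.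
Qed.

Lemma qabs_qint_le h a b (K : R) : a <= b -> continuous h ->
  (forall t, a <= t <= b -> qabs (h t) <= K) -> qabs (qint a b h) <= 2 * (K * (b - a)).
Proof.
move=> ab ch hK; have K0 : 0 <= K by apply: le_trans (hK a _); rewrite ?qabs_ge0// lexx.
apply: (le_trans (qabs_le_norm _)); rewrite ler_pM2l//.
suff : mx_norm (qint a b h : 'rV[R]_4) <= K * (b - a) by [].
rewrite mx_normrE; apply/bigmax_leP; split; first by rewrite mulr_ge0// subr_ge0.
move=> [i j] _ /=; rewrite (ord1 i) qintE.
apply: (le_trans (le_normr_Rintegral _ _)) => //; first exact: qcoord_integrable.
have mab : fine (mu `[a, b]) = b - a.
  rewrite lebesgue_measure_itv/= lte_fin; case: ltP => //= ba.
  by apply/esym/eqP; rewrite subr_eq0 eq_le ba ab.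
rewrite -mab -Rintegral_cst//; apply: le_Rintegral => //.
- apply: continuous_itv_integrable => t; apply: continuous_comp; last exact: norm_continuous.
  exact: qcoord_continuous_comp.
- by apply: continuous_itv_integrable => t; exact: cvg_cst.
- move=> t; rewrite /= in_itv/= => tab.
  by apply: (le_trans (coord_le_norm _ _)); apply: (le_trans (norm_le_qabs _)); exact: hK.
Qed.

Lemma qint_FTC h (H : R -> quat R) a b : a < b -> continuous h ->
  (forall t, qder H t (h t)) -> qint a b h = H b - H a.
Proof.
move=> ab ch dH; apply/rowP => i; rewrite qintE !mxE.
have dHi t : (fun k : R => k^-1 *: (H (k + t) ord0 i - H t ord0 i)) k @[k --> 0^'] --> h t ord0 i.
  apply: cvg_eqfun (cvg_qcoord (i := i) (dH t)) => k.
  by rewrite !mxE.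
have dv t : derivable (fun t => H t ord0 i) t 1.
  apply/cvg_ex; exists (h t ord0 i).
  by apply: cvg_eqfun (dHi t) => k /=; rewrite [k%:A]mulr1.
have d1 t : derive1 (fun t => H t ord0 i) t = h t ord0 i.
  by apply: cvg_lim => //; exact: dHi.
have cH : continuous (fun t => H t ord0 i).
  by move=> t; apply: differentiable_continuous; exact/derivable1_diffP.
rewrite /Rintegral (continuous_FTC2 (F := fun t => H t ord0 i) ab)//.
- by apply: continuous_subspaceT; exact: qcoord_continuous_comp.
- by split => //; [exact: cvg_at_right_filter (cH a)|exact: cvg_at_left_filter (cH b)].
Qed.

Lemma qint_swap (g : R * R -> quat R) a b c d : continuous g ->
  qint a b (fun s => qint c d (fun t => g (s, t))) = qint c d (fun t => qint a b (fun s => g (s, t))).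
Proof.
move=> cg; apply/rowP => i; rewrite !qintE.
under eq_Rintegral do rewrite qintE; under [in RHS]eq_Rintegral do rewrite qintE.
by apply: (Rintegral_rectangle_swap (g := fun z => g z ord0 i)); exact: qcoord_continuous_comp.
Qed.

End QuatIntegral.

Lemma cvg_qinv (R : realType) (T : Type) (F : set_system T) {FF : Filter F} (h : T -> quat R) (q : quat R) :
  q != 0 -> h x @[x --> F] --> q -> (h x)^-1 @[x --> F] --> q^-1.
Proof.
move=> q0 hq; rewrite qinvE /qinv.
have Hf i := cvg_qcoord (i := i) hq.
apply: cvgZ.
  apply: cvgV; first by rewrite qabs2_eq0.
  rewrite -(qabs_sqr q) expr2; apply: cvg_eqfun (cvgM (cvg_qabs hq) (cvg_qabs hq)) => x.
  by rewrite /= -expr2 qabs_sqr.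
rewrite /qconj; apply: cvg_Quat; try apply: cvgN; exact: Hf.
Qed.

(** * Cauchy's formula by contraction of a circle to a point, and the expansion it gives *)

Section CauchySeries.
Variable R : realType.
Variables (f : quat R -> quat R) (J : quat R).
Hypotheses (rf : slice_regular f) (sJ : sphere J).
Local Notation pt := (slice_pt J).
Local Notation fx := (fun z : R * R => slice_dx f J z.1 z.2).

Definition qcis (t : R) : quat R := pt (cos t) (sin t).

Lemma slice_ptM (x y u v : R) : pt x y * pt u v = pt (x * u - y * v) (x * v + y * u).
Proof.
rewrite /slice_pt mulrDl !mulrDr -!scalerAl -!scalerAr !mul1r ?mulr1 (sphereE sJ) !scalerA.
by rewrite scalerN scalerBl scalerDl; move: (1 : quat R) J => e j; apply/rowP => i; rewrite !mxE; ring.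
Qed.

Lemma slice_ptD (x y u v : R) : pt x y + pt u v = pt (x + u) (y + v).
Proof. by rewrite /slice_pt !scalerDl addrACA. Qed.

Lemma slice_ptZ (c x y : R) : c *: pt x y = pt (c * x) (c * y).
Proof. by rewrite /slice_pt scalerDr !scalerA. Qed.

Lemma slice_pt_comm (x y u v : R) : pt x y * pt u v = pt u v * pt x y.
Proof. by rewrite !slice_ptM; congr slice_pt; ring. Qed.

Lemma slice_pt_J : pt 0 1 = J.
Proof. by rewrite /slice_pt scale0r add0r scale1r. Qed.

Lemma slice_pt_1 : pt 1 0 = 1.
Proof. by rewrite /slice_pt scale0r addr0 scale1r. Qed.

Lemma qabs_qcis t : qabs (qcis t) = 1.
Proof. by rewrite /qabs /qcis qabs_slice_pt// cos2Dsin2 sqrtr1. Qed.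

Lemma qcisD s t : qcis (s + t) = qcis s * qcis t.
Proof. by rewrite /qcis slice_ptM cosD sinD; congr slice_pt; ring. Qed.

Lemma qcis0 : qcis 0 = 1. Proof. by rewrite /qcis cos0 sin0 slice_pt_1. Qed.

Lemma qcisX t n : qcis t ^+ n = qcis (t *+ n).
Proof. by elim: n => [|n ih]; rewrite ?expr0 ?mulr0n ?qcis0// exprS ih mulrS qcisD. Qed.

Lemma qcis_2pi : qcis (pi *+ 2) = 1.
Proof. by rewrite /qcis cos2pi sin2pi slice_pt_1. Qed.

Lemma qcis_pi : qcis pi = -1.
Proof. by rewrite /qcis cospi sinpi /slice_pt scale0r addr0 scaleN1r. Qed.

Lemma qcis_continuous : continuous qcis.
Proof.
by move=> t; apply: slice_pt_cvg; [exact: continuous_cos|exact: continuous_sin].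
Qed.

Lemma qder_slice_pt (u v : R -> R) (t du dv : R) :
  is_derive t 1 u du -> is_derive t 1 v dv ->
  qder (fun s => pt (u s) (v s)) t (pt du dv).
Proof.
move=> hu hv; have [du' eu] := hu; have [dv' ev] := hv.
have Hu : h^-1 * (u (h + t) - u t) @[h --> 0^'] --> du.
  by rewrite -eu; apply: cvg_eqfun du' => h /=; rewrite [h%:A]mulr1.
have Hv : h^-1 * (v (h + t) - v t) @[h --> 0^'] --> dv.
  by rewrite -ev; apply: cvg_eqfun dv' => h /=; rewrite [h%:A]mulr1.
have H : slice_pt J (h^-1 * (u (h + t) - u t)) (h^-1 * (v (h + t) - v t)) @[h --> 0^'] --> pt du dv.
  exact: slice_pt_cvg.
apply: cvg_eqfun H => h.
rewrite /slice_pt opprD addrACA -!scalerBl scalerDr !scalerA //.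
Qed.

(* Chain rule along a curve z of the slice: the differential of f sends 1 to f_x and J to f_y = J f_x. *)
Lemma qder_slice_comp (u v : R -> R) (t du dv : R) :
  is_derive t 1 u du -> is_derive t 1 v dv ->
  qder (fun s => f (pt (u s) (v s))) t (pt du dv * slice_dx f J (u t) (v t)).
Proof.
move=> hu hv.
set z := fun s => pt (u s) (v s).
have dz : qder z t (pt du dv) by exact: qder_slice_pt.
have dfz : differentiable f (z t) by exact: rf.1.
have diffz : differentiable z t.
  by apply/derivable1_diffP/derivable_qder; exists (pt du dv).
have D (w : quat R) (g : R -> quat R) (d : quat R) : g 0 = z t ->
    (forall s, g s = z t + s *: w) -> qder (fun s => f (g s)) 0 d -> 'd f (z t) w = d.
  move=> g0 gE hd; rewrite -deriveE//; apply: cvg_lim => //.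
  by apply: cvg_eqfun hd => s /=; rewrite addr0 g0 gE [s *: w + _]addrC.
have dx : 'd f (z t) 1 = slice_dx f J (u t) (v t).
  apply: (D 1 (fun s => pt (s + u t) (v t))); rewrite ?add0r//.
    by move=> s; rewrite /z /slice_pt scalerDl -addrA addrC.
  have := slice_regular_dx (x := u t) (y := v t) rf sJ.
  by rewrite /qder; apply: cvg_trans; apply: near_eq_cvg; near=> h; rewrite /= addr0 add0r.
have dy : 'd f (z t) J = J * slice_dx f J (u t) (v t).
  apply: (D J (fun s => pt (u t) (s + v t))); rewrite ?add0r//.
    by move=> s; rewrite /z /slice_pt scalerDl addrA addrAC.
  have := slice_regular_dy (x := u t) (y := v t) rf sJ.
  by rewrite /qder; apply: cvg_trans; apply: near_eq_cvg; near=> h; rewrite /= addr0 add0r.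
have : derivable (f \o z) t 1 by apply/derivable1_diffP; exact: differentiable_comp.
move=> /derivable_qder_derive1; rewrite derive1E deriveE; last exact: differentiable_comp.
have e2 : 'd z t 1 = pt du dv by rewrite -deriveE// -(derive1E z); exact: qder_derive1.
have -> : 'd (f \o z) t 1 = 'd f (z t) (pt du dv).
  have e3 := congr1 (fun L => L 1) (diff_comp diffz dfz).
  rewrite -e2; exact: e3.
by rewrite {2}/slice_pt linearD !linearZ /= dx dy /slice_pt mulrDl -!scalerAl mul1r.
Unshelve. all: end_near. Qed.

Variables (x0 y0 rho : R).
Local Notation p := (pt x0 y0).
Hypothesis rho_gt : qabs p < rho.

Let zx (s t : R) := (1 - s) * x0 + s * (rho * cos t).
Let zy (s t : R) := (1 - s) * y0 + s * (rho * sin t).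
Let w t : quat R := rho *: qcis t.
(** On the segments z = (1 - s) p + s w(t) from p to the circle, the chain rule gives the
    t-derivative s J g and the s-derivative (w - p) f_x = (w - p) w^-1 g of f(z). Hence g integrates
    to 0 in t, the curves being closed, and to w (w - p)^-1 (f(w) - f(p)) in s; exchanging the two
    integrals is Cauchy's formula. *)
Let g (z : R * R) : quat R := w z.2 * slice_dx f J (zx z.1 z.2) (zy z.1 z.2).

Let rho0 : 0 < rho. Proof. by rewrite (le_lt_trans _ rho_gt)// qabs_ge0. Qed.

Let wE t : w t = pt (rho * cos t) (rho * sin t). Proof. by rewrite /w /qcis slice_ptZ. Qed.

Let qabs_w t : qabs (w t) = rho.
Proof. by rewrite /w qabsZ qabs_qcis mulr1 gtr0_norm. Qed.

Let w_neq0 t : w t != 0. Proof. by rewrite -qabs_eq0 qabs_w gt_eqF. Qed.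

Let wp_neq0 t : w t - p != 0.
Proof.
rewrite subr_eq0; apply/eqP => e; have := rho_gt.
by rewrite -e qabs_w ltxx.
Qed.

Let w_unit t : w t \is a GRing.unit. Proof. exact: w_neq0. Qed.

Let wp_unit t : w t - p \is a GRing.unit. Proof. exact: wp_neq0. Qed.

Let z_cis s t : pt (zx s t) (zy s t) = (1 - s) *: p + s *: w t.
Proof. by rewrite wE !slice_ptZ slice_ptD. Qed.

Let w_continuous : continuous w.
Proof. by move=> t; apply: cvgZ; [exact: cvg_cst|exact: qcis_continuous]. Qed.

Let g_continuous : continuous g.
Proof.
have c2 (h : R -> R) : continuous h -> continuous (fun z : R * R => h z.2).
  by move=> ch z; apply: (@cvg_comp _ _ _ (fun z : R * R => z.2) h); [exact: cvg_snd|exact: ch].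
have Z (h : R -> R) c : continuous h ->
    continuous (fun z : R * R => (1 - z.1) * c + z.1 * (rho * h z.2)).
  move=> ch z; apply: cvgD; apply: cvgM.
  - by apply: cvgB; [exact: cvg_cst|exact: cvg_fst].
  - exact: cvg_cst.
  - exact: cvg_fst.
  - by apply: cvgM; [exact: cvg_cst|exact: c2].
move=> z; apply: cvg_qmul.
  by apply: (@cvg_comp _ _ _ (fun z : R * R => z.2) w); [exact: cvg_snd|exact: w_continuous].
apply: (continuous_comp2 (F := fx) (u := fun z => zx z.1 z.2) (v := fun z => zy z.1 z.2)).
- exact: (slice_regular_dx_continuous rf sJ).
- by apply: Z; exact: continuous_cos.
- by apply: Z; exact: continuous_sin.
Qed.

Let angular s : 0 < s -> qint 0 (pi *+ 2) (fun t => g (s, t)) = 0.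
Proof.
move=> s0.
have pi2 : 0 < (pi *+ 2 : R) by rewrite mulrn_wgt0// pi_gt0.
have d t : qder (fun t => f (pt (zx s t) (zy s t))) t (s *: (J * g (s, t))).
  have := @qder_slice_comp (zx s) (zy s) t (s * (rho * - sin t)) (s * (rho * cos t)).
  have -> : pt (s * (rho * - sin t)) (s * (rho * cos t)) = s *: (J * w t).
    by rewrite wE -{2}slice_pt_J slice_ptM slice_ptZ; congr slice_pt; ring.
  rewrite -scalerAl -mulrA; apply.
    rewrite /zx; apply: is_derive_eq; rewrite ?scaler0 ?add0r; by rewrite /GRing.scale/=; ring.
  by rewrite /zy; apply: is_derive_eq; rewrite /GRing.scale/=; ring.
have cg : continuous (fun t => g (s, t)).
  move=> t; apply: (@cvg_comp _ _ _ (fun t => (s, t)) g); last exact: g_continuous.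
  by apply: (cvg_pair (F := nbhs t) (G := nbhs s) (H := nbhs t)); [exact: cvg_cst|exact: cvg_id].
have cJg : continuous (fun t => s *: (J * g (s, t))).
  by move=> t; apply: cvgZ; [exact: cvg_cst|apply: cvg_qmul; [exact: cvg_cst|exact: cg]].
have := qint_FTC pi2 cJg d.
rewrite /zx /zy cos2pi sin2pi cos0 sin0 subrr.
have -> : (fun t => s *: (J * g (s, t))) = (fun t => (s *: J) * g (s, t)).
  by apply: funext => t; rewrite scalerAl.
rewrite qint_mull// => /(congr1 (fun q => (s *: J)^-1 * q)).
rewrite mulrA mulVr ?mul1r ?mulr0//.
have [_ J1] := sphere_qabs2 sJ.
by rewrite -[_ \is a _]/(_ != 0) scaler_eq0 gt_eqF//= -qabs2_eq0 J1 oner_eq0.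
Qed.

Let radial t : qint 0 1 (fun s => g (s, t)) = w t * (w t - p)^-1 * (f (w t) - f p).
Proof.
have d s : qder (fun s => f (pt (zx s t) (zy s t))) s ((w t - p) * slice_dx f J (zx s t) (zy s t)).
  have := @qder_slice_comp (zx ^~ t) (zy ^~ t) s (rho * cos t - x0) (rho * sin t - y0).
  have -> : pt (rho * cos t - x0) (rho * sin t - y0) = w t - p.
    by rewrite wE -slice_ptD; congr (_ + _); rewrite -[in RHS]scaleN1r slice_ptZ !mulN1r.
  apply.
    by rewrite /zx; apply: is_derive_eq; rewrite /GRing.scale/=; ring.
  by rewrite /zy; apply: is_derive_eq; rewrite /GRing.scale/=; ring.
have cg : continuous (fun s => g (s, t)).
  move=> s; apply: (@cvg_comp _ _ _ (fun s => (s, t)) g); last exact: g_continuous.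
  by apply: (cvg_pair (F := nbhs s) (G := nbhs s) (H := nbhs t)); [exact: cvg_id|exact: cvg_cst].
have gE s : slice_dx f J (zx s t) (zy s t) = (w t)^-1 * g (s, t).
  by rewrite /g/= mulrA mulVr ?mul1r//; exact: w_neq0.
have dE s : (w t - p) * slice_dx f J (zx s t) (zy s t) = ((w t - p) * (w t)^-1) * g (s, t).
  by rewrite gE mulrA.
have dEf : (fun s => (w t - p) * slice_dx f J (zx s t) (zy s t)) =
    (fun s => ((w t - p) * (w t)^-1) * g (s, t)) by apply: funext.
have cd : continuous (fun s => (w t - p) * slice_dx f J (zx s t) (zy s t)).
  by rewrite dEf; apply: continuous_qmul => //; exact: continuous_qcst.
have := qint_FTC ltr01 cd d.
rewrite dEf qint_mull// !z_cis subrr subr0 !scale0r !scale1r add0r addr0 => <-.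
rewrite !mulrA -[_ * (w t - p)^-1 * (w t - p)]mulrA mulVr ?mulr1; last exact: wp_neq0.
by rewrite divrr ?mul1r//; exact: w_neq0.
Qed.

Lemma cauchy_kernel_integral :
  qint 0 (pi *+ 2) (fun t => w t * (w t - p)^-1 * (f (w t) - f p)) = 0.
Proof.
have -> : (fun t => w t * (w t - p)^-1 * (f (w t) - f p)) = (fun t => qint 0 1 (fun s => g (s, t))).
  by apply: funext => t; rewrite radial.
rewrite -(qint_swap 0 1 0 (pi *+ 2) g_continuous).
apply/rowP => i; rewrite qintE mxE.
have z0 s : s \in `]0, 1]%classic -> (qint 0 (pi *+ 2) (fun t => g (s, t))) ord0 i = 0.
  by rewrite inE/= in_itv/= => /andP[s0 _]; rewrite angular// mxE.
(* The endpoint s = 0 is dropped as a null set: [angular] divides by s J, hence holds for s > 0. *)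
rewrite -Rintegral_itv_obnd_cbnd; last first.
  apply: (eq_integrable _ (cst 0%E)) => //; last exact: integrable0.
  by move=> s s01; rewrite /= z0.
by under eq_Rintegral => s s01 do rewrite z0//; rewrite Rintegral_cst// mul0r.
Qed.

(** The mean over the circle of w^-n f(w), with w^-n = rho^-n exp(-nJt). The kernel stands to the
    left of f because the coefficients of the series stand to the right of the powers. *)
Definition cauchy_coef n : quat R :=
  (2 * pi)^-1 *: qint 0 (pi *+ 2) (fun t => (rho ^- n *: qcis (- (n%:R * t))) * f (w t)).

Let e n t := rho ^- n *: qcis (- (n%:R * t)).

Let e_continuous n : continuous (e n).
Proof.
move=> t; apply: cvgZ; first exact: cvg_cst.
apply: (@cvg_comp _ _ _ (fun t => - (n%:R * t)) qcis); last exact: qcis_continuous.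
by apply: cvgN; apply: cvgM; [exact: cvg_cst|exact: cvg_id].
Qed.

Let fw_continuous : continuous (fun t => f (w t)).
Proof.
move=> t; apply: (@cvg_comp _ _ _ w f); first exact: w_continuous.
exact: (slice_regular_continuous rf).
Qed.

Let pi2_gt0 : 0 < (pi *+ 2 : R). Proof. by rewrite mulrn_wgt0// pi_gt0. Qed.

Let pi2_neq0 : 2 * pi != 0 :> R. Proof. by rewrite mulf_neq0// gt_eqF// pi_gt0. Qed.

(** The integrand is an eigenfunction of d/dt with the invertible eigenvalue -(n + 1) J, and it is
    periodic. *)
Let qint_e_pos n (c : quat R) : qint 0 (pi *+ 2) (fun t => e n.+1 t * c) = 0.
Proof.
have d t : qder (fun t => e n.+1 t * c) t ((- n.+1%:R *: J) * (e n.+1 t * c)).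
  rewrite mulrA; apply: qder_mulr; rewrite /e -scalerAl -scalerAr.
  have -> : - n.+1%:R *: (rho ^- n.+1 *: (J * qcis (- (n.+1%:R * t)))) =
     pt (rho ^- n.+1 * (n.+1%:R * sin (- (n.+1%:R * t)))) (rho ^- n.+1 * (- n.+1%:R * cos (- (n.+1%:R * t)))).
    by rewrite -{1}slice_pt_J /qcis slice_ptM !slice_ptZ; congr slice_pt; ring.
  have eE s : rho ^- n.+1 *: qcis (- (n.+1%:R * s)) =
      pt (rho ^- n.+1 * cos (- (n.+1%:R * s))) (rho ^- n.+1 * sin (- (n.+1%:R * s))).
    by rewrite /qcis slice_ptZ.
  rewrite (_ : (fun s => _) = (fun s => pt (rho ^- n.+1 * cos (- (n.+1%:R * s)))
      (rho ^- n.+1 * sin (- (n.+1%:R * s))))); last by apply: funext.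
  by apply: qder_slice_pt; apply: is_derive_eq; rewrite /GRing.scale/=; ring.
have ce : continuous (fun t => e n.+1 t * c).
  by apply: continuous_qmul; [exact: e_continuous|exact: continuous_qcst].
have cde : continuous (fun t => (- n.+1%:R *: J) * (e n.+1 t * c)).
  by apply: continuous_qmul => //; exact: continuous_qcst.
have := qint_FTC pi2_gt0 cde d.
rewrite qint_mull//.
have -> : e n.+1 (pi *+ 2) = e n.+1 0.
  rewrite /e mulr0 oppr0 qcis0; congr (_ *: _).
  have h : qcis (- (n.+1%:R * (pi *+ 2))) * qcis (pi *+ 2) ^+ n.+1 = 1.
    by rewrite qcisX -qcisD mulr_natl addNr qcis0.
  by rewrite -h qcis_2pi expr1n mulr1.
rewrite subrr => /(congr1 (fun q => (- n.+1%:R *: J)^-1 * q)).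
rewrite mulrA mulVr ?mul1r ?mulr0//.
have [_ J1] := sphere_qabs2 sJ.
by rewrite -[_ \is a _]/(_ != 0) scaler_eq0 oppr_eq0 pnatr_eq0/= -qabs2_eq0 J1 oner_eq0.
Qed.

Let qint_cst (c : quat R) : qint 0 (pi *+ 2) (fun=> c) = (2 * pi) *: c.
Proof.
have mE : fine (@lebesgue_measure R `[0, pi *+ 2]) = pi *+ 2.
  by rewrite lebesgue_measure_itv/= lte_fin pi2_gt0/= subr0.
by apply/rowP => i; rewrite qintE mxE Rintegral_cst// mE mulrC mulr_natl.
Qed.

Let wV_comm t n : (w t)^-1 ^+ n = e n t.
Proof.
have wV : (w t)^-1 = rho^-1 *: qcis (- t).
  apply: (mulrI (x := w t)); first exact: w_neq0.
  by rewrite divrr ?w_unit// /w -scalerAl -scalerAr scalerA divff ?gt_eqF// scale1r -qcisD subrr qcis0.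
by rewrite wV exprZn /e qcisX exprVn mulNrn mulr_natl.
Qed.

(** Geometric expansion of (1 - p w^-1)^-1 with its exact remainder; [e n t] is w^-n, and it
    commutes with p inside the slice. *)
Let kernel_expand t N : w t * (w t - p)^-1 =
  \sum_(n < N) p ^+ n * e n t + p ^+ N * e N t * (w t * (w t - p)^-1).
Proof.
have K1 : w t * (w t - p)^-1 = 1 + p * e 1 t * (w t * (w t - p)^-1).
  rewrite -wV_comm expr1 -!mulrA [(w t)^-1 * _]mulrA mulVr ?w_unit// mul1r.
  by rewrite -(divrr (wp_unit t)) -mulrDl subrK.
have cpe n : e n t * p = p * e n t by rewrite /e -scalerAl -scalerAr slice_pt_comm.
elim: N => [|N ih].
  by rewrite big_ord0 add0r expr0 mul1r -wV_comm expr0 mul1r.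
rewrite big_ord_recr/= {1}ih -addrA; congr (_ + _).
rewrite {1}K1 mulrDr mulr1; congr (_ + _).
have step : p ^+ N * e N t * (p * e 1 t) = p ^+ N.+1 * e N.+1 t.
  rewrite mulrA -[p ^+ N * e N t * p]mulrA cpe mulrA -exprSr -mulrA; congr (_ * _).
  by rewrite -!wV_comm expr1 -exprSr.
by rewrite [LHS]mulrA step.
Qed.

(** The kernel expansion is inserted in [cauchy_kernel_integral]. By [qint_e_pos] the constant f(p)
    contributes at n = 0 alone, so the finite sum is 2 pi times the partial sum minus f(p). The
    remainder is O((|p| / rho)^N) because |w - p| >= rho - |p|. *)
Lemma cauchy_coef_cvg : psum cauchy_coef N p @[N --> \oo] --> f p.
Proof.
pose K t := w t * (w t - p)^-1.
pose h t := f (w t) - f p.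
have cK : continuous K.
  move=> t; apply: cvg_qmul; first exact: w_continuous.
  apply: cvg_qinv; first exact: wp_neq0.
  by apply: cvgB; [exact: w_continuous|exact: cvg_cst].
have ch : continuous h by apply: continuous_qadd => //; exact: continuous_qcst.
have cKh : continuous (fun t => K t * h t) by apply: continuous_qmul; [exact: cK|exact: ch].
have ceh n : continuous (fun t => e n t * h t)  by apply: continuous_qmul; [exact: e_continuous|exact: ch].
have crem n : continuous (fun t => p ^+ n * (e n t * (K t * h t))).
  by apply: continuous_qmul; [exact: continuous_qcst|apply: continuous_qmul; [exact: e_continuous|exact: cKh]].
have cterm n : continuous (fun t => p ^+ n * (e n t * h t)).
  by apply: continuous_qmul; [exact: continuous_qcst|exact: ceh].
have cef n : continuous (fun t => e n t * f p).
  by apply: continuous_qmul; [exact: e_continuous|exact: continuous_qcst].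
have [M M0 hM] : exists2 M : R, 0 <= M & forall t, 0 <= t <= pi *+ 2 -> qabs (h t) <= M.
  have cq : {within `[0, pi *+ 2], continuous (fun t => qabs (h t))}.
    by apply: continuous_subspaceT => t; apply: cvg_qabs; exact: ch.
  have [c _ hc] := EVT_max (ltW pi2_gt0) cq.
  by exists (qabs (h c)); rewrite ?qabs_ge0// => t tI; apply: hc; rewrite in_itv.
have Kle t : qabs (K t) <= rho / (rho - qabs p).
  have h1 : qabs (w t - p) * qabs (K t) = rho.
    rewrite -qabsM /K (_ : _ * _ = w t) ?qabs_w//.
    rewrite mulrA (_ : (w t - p) * w t = w t * (w t - p)) -?mulrA ?divrr ?mulr1 ?wp_unit//.
    by rewrite mulrBl mulrBr; congr (_ - _); rewrite wE; exact: slice_pt_comm.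
  rewrite ler_pdivlMr ?subr_gt0// -h1 mulrC ler_wpM2r ?qabs_ge0// h1.
  have := qabsD (w t - p) p; rewrite subrK qabs_w; lra.
have key N : psum cauchy_coef N.+1 p - f p =
    - ((2 * pi)^-1 *: qint 0 (pi *+ 2) (fun t => p ^+ N.+1 * (e N.+1 t * (K t * h t)))).
  have := cauchy_kernel_integral.
  rewrite (_ : (fun t => _) = fun t => \sum_(n < N.+1) p ^+ n * (e n t * h t) +
      p ^+ N.+1 * (e N.+1 t * (K t * h t))); last first.
    apply: funext => t; rewrite {1}(kernel_expand t N.+1) mulrDl mulr_suml !mulrA; congr (_ + _).
    by apply: eq_bigr => i _; rewrite !mulrA.
  rewrite qintD; [|exact: continuous_qsum|exact: crem].
  rewrite qint_sum => [H|i]; last exact: cterm.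
  have H2 : \sum_(n < N.+1) qint 0 (pi *+ 2) (fun t => p ^+ n * (e n t * h t)) =
     (2 * pi) *: (psum cauchy_coef N.+1 p - f p).
    have eh n : qint 0 (pi *+ 2) (fun t => e n t * h t) =
        (2 * pi) *: cauchy_coef n - qint 0 (pi *+ 2) (fun t => e n t * f p).
      rewrite /cauchy_coef scalerA divff ?scale1r ?pi2_neq0//.
      apply/eqP; rewrite -subr_eq opprK -qintD; [|exact: ceh|exact: cef]; apply/eqP.
      by congr qint; apply: funext => t; rewrite -mulrDr /h subrK.
    have e0 : qint 0 (pi *+ 2) (fun t => e 0 t * f p) = (2 * pi) *: f p.
      by rewrite -qint_cst; congr qint; apply: funext => t; rewrite -wV_comm expr0 mul1r.
    rewrite (eq_bigr (fun n : 'I_N.+1 => (2 * pi) *: (p ^+ n * cauchy_coef n) -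
      p ^+ n * qint 0 (pi *+ 2) (fun t => e n t * f p))); last first.
      by move=> n _; rewrite qint_mull; [rewrite eh mulrBr scalerAr|exact: ceh].
    rewrite sumrB -scaler_sumr -/(psum cauchy_coef N.+1 p) scalerBr; congr (_ - _).
    by rewrite big_ord_recl expr0 mul1r e0 big1 ?addr0// => i _; rewrite qint_e_pos mulr0.
  move: H; rewrite H2 => /eqP; rewrite addr_eq0 => /eqP H.
  apply: (scalerI pi2_neq0).
  by rewrite H scalerN scalerA divff ?scale1r// pi2_neq0.
set t0 := qabs p / rho.
have t01 : `|t0| < 1.
  by rewrite ger0_norm ?divr_ge0 ?qabs_ge0 ?(ltW rho0)// ltr_pdivrMr// mul1r.
set C := (2 * pi)^-1 * (2 * (rho / (rho - qabs p) * M * (pi *+ 2))).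
apply: cvg_shiftSW.
apply: (@qcvg_le _ _ _ _ _ _ (fun N => t0 ^+ N.+1 * C)).
  rewrite -(mul0r C); apply: cvgM; last exact: cvg_cst.
  by rewrite (cvg_shiftS (fun N => t0 ^+ N)); exact: cvg_expr.
apply: nearW => N; rewrite key qabsN qabsZ ger0_norm ?invr_ge0 ?mulr_ge0 ?pi_ge0//.
rewrite /C mulrCA ler_pM2l ?invr_gt0 ?mulr_gt0 ?pi_gt0//.
have := @qabs_qint_le R (fun t => p ^+ N.+1 * (e N.+1 t * (K t * h t))) 0 (pi *+ 2)
   (t0 ^+ N.+1 * (rho / (rho - qabs p) * M)) (ltW pi2_gt0).
rewrite subr0 (_ : 2 * _ = t0 ^+ N.+1 * (2 * (rho / (rho - qabs p) * M * (pi *+ 2)))); last by ring.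
apply; first exact: crem.
move=> t tI; rewrite qabsM qabsX qabsM [qabs (K t * h t)]qabsM.
have -> : qabs (e N.+1 t) = rho ^- N.+1.
  by rewrite /e qabsZ qabs_qcis mulr1 ger0_norm// invr_ge0 exprn_ge0// ltW.
have -> : t0 ^+ N.+1 * (rho / (rho - qabs p) * M) =
    qabs p ^+ N.+1 * (rho ^- N.+1 * (rho / (rho - qabs p) * M)) by rewrite /t0 expr_div_n -[LHS]mulrA.
apply: ler_wpM2l; first by rewrite exprn_ge0// qabs_ge0.
rewrite ler_wpM2l ?invr_ge0 ?exprn_ge0 ?(ltW rho0)//.
by apply: ler_pM; rewrite ?qabs_ge0//; exact: hM.
Qed.

End CauchySeries.

(** * One power series for all slices *)

Section EntireSeries.
Variable R : realType.

(** The coefficients are those of the unit circle of the given slice. A point q lies in some slice,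
    within the disc of radius |q| + 1; this radius is at least 1, so both expansions hold on the
    reals of ]0, 1[ and their coefficients agree. *)
Lemma slice_regular_has_series (I : quat R) (f : quat R -> quat R) : sphere I -> slice_regular f ->
  exists a, has_series f a.
Proof.
move=> sI rf.
have real_pt J (x : R) : slice_pt J x 0 = x *: 1 by rewrite /slice_pt scale0r addr0.
have disc J rho : sphere J -> 0 < rho -> exists a : nat -> quat R,
   forall x y, qabs (slice_pt J x y) < rho -> psum a N (slice_pt J x y) @[N --> \oo] --> f (slice_pt J x y).
  by move=> sJ r0; exists (cauchy_coef f J rho) => x y; exact: cauchy_coef_cvg.
have [a ha] := disc I 1 sI ltr01.
exists a => q; have [J [x [y [sJ ->]]]] := slice_decompositionP q sI.
have r1 : 1 <= qabs (slice_pt J x y) + 1 by rewrite lerDr qabs_ge0.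
have [b hb] := disc J (qabs (slice_pt J x y) + 1) sJ (lt_le_trans ltr01 r1).
have qx (z : R) : 0 < z < 1 -> qabs (z *: 1 : quat R) < 1.
  by move=> /andP[z0 z1]; rewrite qabsZ qabs1 mulr1 gtr0_norm.
suff -> : a = b by apply: hb; rewrite ltrDl.
apply: (psum_coef_unique (f := f) ltr01) => z z01.
  by rewrite -(real_pt I); apply: ha; rewrite real_pt; exact: qx.
rewrite -(real_pt J); apply: hb; rewrite real_pt; apply: lt_le_trans r1; exact: qx.
Qed.

End EntireSeries.

(** * Rotations and polar coordinates in the plane *)

Section LebesgueInvariance.
Variable R : realType.
Local Notation mR := (measurableTypeR R).
Local Notation mu := (@lebesgue_measure R).
Local Open Scope ereal_scope.

Lemma measurable_affine (c d : R) : measurable_fun [set: mR] ((fun x => c * x + d)%R : mR -> mR).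
Proof. by apply: measurable_funD => //; exact: measurable_funM. Qed.

(** Lebesgue measure is determined by its values on intervals ]a, b], so only their preimages are
    computed. For c < 0 the preimage is closed on the left and open on the right, of the same
    length. *)
Lemma lebesgue_measure_affine (c d : R) (A : set mR) : (c != 0)%R -> measurable A ->
  mu A = `|c|%:E * mu ((fun x => c * x + d)%R @^-1` A).
Proof.
move=> c0 mA.
have k0 : (0 <= `|c|)%R by [].
pose k : {nonneg R} := NngNum k0.
pose phi : mR -> mR := (fun x => c * x + d)%R.
have mphi : measurable_fun [set: mR] phi := measurable_affine c d.
suff H : mu A = mscale k (pushforward mu phi) A by rewrite H.
move=> m; apply: lebesgue_measure_unique => // _ [[a b]] _ <-.
transitivity (`|c|%:E * mu (phi @^-1` `]a, b]%classic)); last by [].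
have [cp|cn|c00] := ltgtP c 0%R; last by rewrite c00 eqxx in c0.
- have -> : phi @^-1` `]a, b]%classic = `[((b - d) / c)%R, ((a - d) / c)%R[%classic.
    apply/seteqP; split => x; rewrite /phi /= !in_itv/= => /andP[h1 h2]; apply/andP; split.
    + by rewrite ler_ndivrMr// mulrC; lra.
    + by rewrite ltr_ndivlMr// mulrC; lra.
    + by move: h2; rewrite ltr_ndivlMr// mulrC; lra.
    + by move: h1; rewrite ler_ndivrMr// mulrC; lra.
  rewrite !lebesgue_measure_itv/= !lte_fin ltr_nM2r ?invr_lt0// ltrD2r.
  case: ifP => ab; last by rewrite mule0.
  rewrite -!EFinB -EFinM ltr0_norm//; congr EFin.
  by rewrite -mulrBl mulrCA mulNr mulfV ?mulrN1; [lra|].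
- have -> : phi @^-1` `]a, b]%classic = `]((a - d) / c)%R, ((b - d) / c)%R]%classic.
    apply/seteqP; split => x; rewrite /phi /= !in_itv/= => /andP[h1 h2]; apply/andP; split.
    + by rewrite ltr_pdivrMr// mulrC; lra.
    + by rewrite ler_pdivlMr// mulrC; lra.
    + by move: h1; rewrite ltr_pdivrMr// mulrC; lra.
    + by move: h2; rewrite ler_pdivlMr// mulrC; lra.
  rewrite !lebesgue_measure_itv/= !lte_fin ltr_pM2r ?invr_gt0// ltrD2r.
  case: ifP => ab; last by rewrite mule0.
  rewrite -!EFinB -EFinM gtr0_norm//; congr EFin.
  by rewrite -mulrBl mulrCA mulfV ?mulr1; [lra|].
Qed.

Lemma ge0_integral_affine (f : mR -> \bar R) (c d : R) : (c != 0)%R ->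
  measurable_fun [set: mR] f -> (forall x, 0 <= f x) ->
  `|c|%:E * \int[mu]_x f (c * x + d)%R = \int[mu]_x f x.
Proof.
move=> c0 mf f0.
have k0 : (0 <= `|c|)%R by [].
pose k : {nonneg R} := NngNum k0.
pose phi : mR -> mR := (fun x => c * x + d)%R.
have mphi : measurable_fun [set: mR] phi := measurable_affine c d.
transitivity (k%:num%:E * \int[pushforward mu phi]_x f x).
  by congr (_ * _); rewrite ge0_integral_pushforward// preimage_setT.
rewrite -ge0_integral_mscale//.
apply: eq_measure_integral => A mA _.
exact/esym/lebesgue_measure_affine.
Qed.

Lemma ge0_integral_shift (f : mR -> \bar R) (d : R) :
  measurable_fun [set: mR] f -> (forall x, 0 <= f x) ->
  \int[mu]_x f (x + d)%R = \int[mu]_x f x.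
Proof.
move=> mf f0; rewrite -(ge0_integral_affine d (oner_neq0 R) mf f0) normr1 mul1e.
by apply: eq_integral => x _; rewrite mul1r.
Qed.

Lemma ge0_integral_scale (f : mR -> \bar R) (c : R) : (c != 0)%R ->
  measurable_fun [set: mR] f -> (forall x, 0 <= f x) ->
  `|c|%:E * \int[mu]_x f (c * x)%R = \int[mu]_x f x.
Proof.
move=> c0 mf f0; rewrite -(ge0_integral_affine 0%R c0 mf f0).
by congr (_ * _); apply: eq_integral => x _; rewrite addr0.
Qed.

Implicit Types F : mR * mR -> \bar R.

(** On each horizontal line a shear is a translation; Tonelli does the rest. *)
Lemma ge0_integral_shear1 F (t : R) : measurable_fun [set: mR * mR] F -> (forall z, 0 <= F z) ->
  \int[(mu \x mu)]_z F (z.1 + t * z.2, z.2)%R = \int[(mu \x mu)]_z F z.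
Proof.
move=> mF F0; rewrite !fubini_tonelli2//; last first.
  apply: measurableT_comp => //; apply: measurable_fun_pair => //.
  by apply: measurable_funD => //; exact: measurable_funM.
apply: eq_integral => y _; rewrite /fubini_G/=.
apply: (ge0_integral_shift (f := fun x => F (x, y))) => //.
exact: measurable_fun_pair1.
Qed.

Lemma ge0_integral_shear2 F (t : R) : measurable_fun [set: mR * mR] F -> (forall z, 0 <= F z) ->
  \int[(mu \x mu)]_z F (z.1, z.2 + t * z.1)%R = \int[(mu \x mu)]_z F z.
Proof.
move=> mF F0; rewrite !fubini_tonelli1//; last first.
  apply: measurableT_comp => //; apply: measurable_fun_pair => //.
  by apply: measurable_funD => //; exact: measurable_funM.
apply: eq_integral => x _; rewrite /fubini_F/=.
apply: (ge0_integral_shift (f := fun y => F (x, y))) => //.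
exact: measurable_fun_pair2.
Qed.

Definition plane_rot (c s : R) (z : mR * mR) : mR * mR := ((c * z.1 - s * z.2)%R, (s * z.1 + c * z.2)%R).

Lemma measurable_rot (c s : R) : measurable_fun [set: mR * mR] (plane_rot c s).
Proof.
apply: measurable_fun_pair.
  by apply: measurable_funB; apply: measurable_funM.
by apply: measurable_funD; apply: measurable_funM.
Qed.

(* A rotation other than -id is a product of three shears. *)
Lemma ge0_integral_rot F (c s : R) : (c ^+ 2 + s ^+ 2 = 1)%R -> (c != -1)%R ->
  measurable_fun [set: mR * mR] F -> (forall z, 0 <= F z) ->
  \int[(mu \x mu)]_z F (plane_rot c s z) = \int[(mu \x mu)]_z F z.
Proof.
(* For c = cos(theta) and s = sin(theta), t is -tan(theta / 2), whose pole is the excluded value c =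
   -1. The rotation is the horizontal shear t, the vertical shear s, and the horizontal shear t
   again. *)
move=> cs c1 mF F0; pose t := (- (s / (1 + c)))%R.
have c10 : (1 + c != 0)%R by rewrite addrC addr_eq0.
pose F1 := fun z : mR * mR => F (z.1 + t * z.2, z.2)%R.
have mF1 : measurable_fun [set: mR * mR] F1.
  apply: measurableT_comp => //; apply: measurable_fun_pair => //.
  by apply: measurable_funD => //; exact: measurable_funM.
pose F2 := fun z : mR * mR => F1 (z.1, z.2 + s * z.1)%R.
have mF2 : measurable_fun [set: mR * mR] F2.
  apply: measurableT_comp => //; apply: measurable_fun_pair => //.
  by apply: measurable_funD => //; exact: measurable_funM.
transitivity (\int[(mu \x mu)]_z F2 (z.1 + t * z.2, z.2)%R); last first.
  rewrite (ge0_integral_shear1 t mF2) => [|z]; last exact: F0.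
  rewrite (ge0_integral_shear2 s mF1) => [|z]; last exact: F0.
  exact: (ge0_integral_shear1 t mF F0).
apply: eq_integral => -[x y] _.
rewrite /F2 /F1 /plane_rot /=; congr F; congr pair; rewrite /t.
  have E : (c = 1 - s * (s / (1 + c)))%R.
    have : ((1 - c) * (1 + c) = s * s)%R by rewrite -!expr2 in cs *; nra.
    by move=> e; rewrite mulrA -e mulfK//; ring.
  have E2 : (s / (1 + c) * (1 + c) = s)%R by rewrite divfK.
  move: E E2; set u := (s / (1 + c))%R => E E2.
  transitivity ((1 - s * u) * x - u * (1 + (1 - s * u)) * y)%R; last by ring.
  by rewrite -E E2.
have : ((1 - c) * (1 + c) = s * s)%R by rewrite -!expr2 in cs *; nra.
move=> e; have E : (c = 1 - s * (s / (1 + c)))%R by rewrite mulrA -e mulfK//; ring.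
by move: E; set u := (s / (1 + c))%R => E; rewrite {1}E; ring.
Qed.

Lemma integral_rot F (c s : R) : (c ^+ 2 + s ^+ 2 = 1)%R -> (c != -1)%R ->
  measurable_fun [set: mR * mR] F ->
  \int[(mu \x mu)]_z F (plane_rot c s z) = \int[(mu \x mu)]_z F z.
Proof.
move=> cs c1 mF; rewrite [LHS]integralE [RHS]integralE.
rewrite -(ge0_integral_rot cs c1 (measurable_funepos mF))//.
rewrite -(ge0_integral_rot cs c1 (measurable_funeneg mF))//.
by congr (_ - _); apply: eq_integral => z _; rewrite ?funeposE ?funenegE.
Qed.

Lemma oneDsqr_gt0 (x : R) : (0 < oneDsqr x)%R.
Proof. exact: lt_le_trans ltr01 (oneDsqr_ge1 x). Qed.

Lemma oneDsqr_integral : \int[mu]_u ((oneDsqr u)^-1)%:E = (pi : R)%:E.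
Proof.
rewrite ge0_symfun_integralT; last 3 first.
- by move=> u; rewrite invr_ge0 (ltW (oneDsqr_gt0 _)).
- exact: continuous_oneDsqrV.
- by move=> u; rewrite /= /oneDsqr sqrrN.
rewrite -set_itvcy integral0y_oneDsqr -EFinM; congr EFin.
by rewrite mulrCA divff ?mulr1.
Qed.

Lemma measurable_sqrt_comp (d : measure_display) (T : measurableType d) (g : T -> mR) :
  measurable_fun [set: T] g -> measurable_fun [set: T] (fun z => Num.sqrt (g z) : mR).
Proof.
move=> mg; apply: (measurableT_comp (f := fun x : mR => Num.sqrt x : mR)) => //.
by apply: continuous_measurable_fun; exact: sqrt_continuous.
Qed.

(* Polar coordinates through the substitution y = |x| u, which needs only
   one-dimensional scalings and Tonelli; pi is the integral of 1 / (1 + u^2). *)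
Lemma ge0_integral_radial (h : mR -> \bar R) :
  measurable_fun [set: mR] h -> (forall x, 0 <= h x) ->
  \int[(mu \x mu)]_z h (Num.sqrt (z.1 ^+ 2 + z.2 ^+ 2)%R) =
  (pi : R)%:E * \int[mu]_x ((`|x|%R)%:E * h `|x|%R).
Proof.
move=> mh h0.
have mnorm : measurable_fun [set: mR] (fun x : mR => `|x|%R : mR).
  by apply: measurableT_comp.
pose g (x : mR) := (`|x|%R)%:E * h `|x|%R.
have mg : measurable_fun [set: mR] g.
  apply: emeasurable_funM; first exact/measurable_EFinP.
  exact: measurableT_comp.
have g0 x : 0 <= g x by rewrite mule_ge0.
pose H := fun z : mR * mR => h (Num.sqrt (z.1 ^+ 2 + z.2 ^+ 2)%R).
have mH : measurable_fun [set: mR * mR] H.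
  apply: measurableT_comp => //; apply: measurable_sqrt_comp.
  by apply: measurable_funD; apply: measurable_funX.
pose K := fun z : mR * mR => (`|z.1|%R)%:E * h (`|z.1| * Num.sqrt (oneDsqr z.2))%R.
have mK : measurable_fun [set: mR * mR] K.
  apply: emeasurable_funM; first by apply/measurable_EFinP; apply: measurableT_comp.
  apply: measurableT_comp => //; apply: measurable_funM; first exact: measurableT_comp.
  apply: measurable_sqrt_comp; rewrite /oneDsqr.
  by apply: measurable_funD => //; apply: measurable_funX.
have K0 z : 0 <= K z by rewrite mule_ge0.
rewrite fubini_tonelli1//.
transitivity (\int[mu]_x \int[mu]_u K (x, u)).
  (* The line x = 0 is null and is removed, since the substitution y = x u degenerates there. *)
  have mD : measurable ([set: mR] `\ (0%R : mR)) by exact: measurableD.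
  rewrite -[LHS](integral_setD1 mD); last first.
    by apply: measurable_funTS; exact: measurable_fun_fubini_tonelli_F.
  rewrite -[RHS](integral_setD1 mD); last first.
    apply: measurable_funTS.
    exact: (@measurable_fun_fubini_tonelli_F _ _ _ _ R mu K).
  apply: eq_integral => x /set_mem[_ /= /eqP x0].
  rewrite /fubini_F /=.
  have mHx : measurable_fun [set: mR] (fun y => H (x, y)) by exact: measurable_fun_pair2.
  transitivity (\int[mu]_y H (x, y)) => //.
  rewrite -(ge0_integral_scale x0 mHx) => [|y]; last exact: h0.
  have mHxs : measurable_fun [set: mR] (fun u : mR => H (x, (x * u)%R)).
    by apply: (measurableT_comp mHx); exact: measurable_funM.
  transitivity (\int[mu]_u ((`|x|%R)%:E * H (x, (x * u)%R))).
    by rewrite ge0_integralZl// => u _; exact: h0.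
  apply: eq_integral => u _; rewrite /K /H/=; congr (_ * h _).
  rewrite -[in RHS](sqrtr_sqr x) -sqrtrM ?sqr_ge0//; congr Num.sqrt.
  by rewrite /oneDsqr; ring.
rewrite fubini_tonelli//.
rewrite -oneDsqr_integral -ge0_integralZr//; last 2 first.
- apply/measurable_EFinP; apply: continuous_measurable_fun; exact: continuous_oneDsqrV.
- by apply: integral_ge0 => x _; exact: g0.
apply: eq_integral => u _.
(* With u fixed, rescaling x by c gives one factor 1/c from the measure and one from |x|: together 1
   / (1 + u^2). *)
set c := Num.sqrt (oneDsqr u).
have c0 : (0 < c)%R by rewrite sqrtr_gt0 oneDsqr_gt0.
have cc : (oneDsqr u = c * c)%R by rewrite -expr2 sqr_sqrtr// (ltW (oneDsqr_gt0 _)).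
have mgc : measurable_fun [set: mR] (fun x => g (c * x)%R).
  by apply: (measurableT_comp mg); exact: measurable_funM.
transitivity (\int[mu]_x ((c^-1)%:E * g (c * x)%R)).
  apply: eq_integral => x _; rewrite /K /g/= normrM (gtr0_norm c0) muleA -EFinM mulrA.
  by rewrite mulVf ?mul1r ?gt_eqF// [(c * _)%R]mulrC.
rewrite ge0_integralZl//; last by rewrite lee_fin invr_ge0 ltW.
have c00 : (c != 0)%R by rewrite gt_eqF.
rewrite -(ge0_integral_scale c00 mg g0) (gtr0_norm c0) muleA -EFinM; congr (_%:E * _).
by rewrite cc invfM -mulrA mulVf ?mulr1.
Qed.

End LebesgueInvariance.

(** * The integrals G and J and the moments of the weights *)

Section HalfLine.
Variable R : realType.
Local Notation mR := (measurableTypeR R).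
Local Notation mu := (@lebesgue_measure R).

Lemma measurable_expRN (d : measure_display) (T : measurableType d) (g : T -> mR) :
  measurable_fun [set: T] g -> measurable_fun [set: T] (fun x => expR (- g x)).
Proof.
move=> mg; apply: (measurableT_comp (f := expR)); first exact: measurable_expR.
exact: (measurableT_comp (f := -%R : mR -> mR) (@oppr_measurable R _)).
Qed.

Lemma measurable_norm (d : measure_display) (T : measurableType d) (g : T -> mR) :
  measurable_fun [set: T] g -> measurable_fun [set: T] (fun x => `|g x|).
Proof.
exact: (measurableT_comp (f := Num.Def.normr : mR -> mR) (@normr_measurable R _)).
Qed.

Lemma half_line_FTC (f F : R -> R) (a l : R) : (forall x, a <= x -> 0 <= f x) ->
  (forall x, a <= x -> {for x, continuous f}) ->
  (forall x : R, a <= x -> derivable F x 1 /\ 'D_1 F x = f x) -> F x @[x --> +oo] --> l ->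
  (\int[mu]_(x in `[a, +oo[) (f x)%:E = (l - F a)%:E)%E.
Proof.
move=> f0 cf dF Fl.
have cF x : a <= x -> {for x, continuous F}.
  by move=> ax; apply: differentiable_continuous; apply/derivable1_diffP; have [] := dF x ax.
rewrite (ge0_continuous_FTC2y (F := F) (l := l))//.
- apply: continuous_in_subspaceT => x; rewrite inE/= in_itv/= andbT; exact: cf.
- by move=> x /ltW ax; have [] := dF x ax.
- by apply: cvg_at_right_filter; exact: cF.
- by move=> x; rewrite in_itv/= andbT => /ltW ax; rewrite derive1E; have [_ ->] := dF x ax.
Qed.

Lemma cvg_mulyl (c : R) : 0 < c -> (c * x) @[x --> +oo] --> +oo.
Proof.
move=> c0; apply/cvgryPge => A; near=> x.
by rewrite mulrC -ler_pdivrMr//; near: x; exact: nbhs_pinfty_ge.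
Unshelve. all: end_near. Qed.

Lemma cvg_expRNM (c : R) : 0 < c -> expR (- (c * x)) @[x --> +oo] --> 0.
Proof.
move=> c0; apply: (@cvg_comp _ _ _ (fun x => c * x) (fun x => expR (- x))).
  exact: cvg_mulyl.
exact: cvgr_expR.
Qed.

Lemma integral_expRN (c a : R) : 0 < c ->
  (\int[mu]_(x in `[a, +oo[) (expR (- (c * x)))%:E = (expR (- (c * a)) / c)%:E)%E.
Proof.
move=> c0.
rewrite (@half_line_FTC _ (fun x => - (expR (- (c * x)) / c)) a 0)//.
- by rewrite sub0r opprK.
- move=> x _; apply: continuous_comp; last exact: continuous_expR.
  by apply: cvgN; apply: cvgM; [exact: cvg_cst|exact: cvg_id].
- move=> x _; suff [? ->] : is_derive x 1 (fun x => - (expR (- (c * x)) / c)) (expR (- (c * x))) by [].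
  apply: is_derive_eq.
  by rewrite /GRing.scale/=; field; rewrite gt_eqF.
- rewrite -oppr0 -(mul0r c^-1); apply: cvgN; apply: cvgM; last exact: cvg_cst.
  exact: cvg_expRNM.
Qed.

(** An antiderivative is -exp(-t e^u). This representation of exp(-t) takes the place of an
    integration by parts in the recurrences of Gamma and of G, which become instances of Tonelli's
    theorem. *)
Lemma integral_expRexp (t : R) : 0 < t ->
  (\int[mu]_(u in `[0%R, +oo[) (t * expR u * expR (- (t * expR u)))%:E = (expR (- t))%:E)%E.
Proof.
move=> t0.
rewrite (@half_line_FTC _ (fun u => - expR (- (t * expR u))) 0 0)//.
- by rewrite sub0r opprK expR0 mulr1.
- by move=> x _; rewrite !mulr_ge0 ?expR_ge0// ltW.
- have c1 : continuous (fun u : R => t * expR u).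
    by move=> y; apply: cvgM; [exact: cvg_cst|exact: continuous_expR].
  move=> x _; apply: cvgM; first exact: c1.
  apply: (@cvg_comp _ _ _ (fun u => - (t * expR u)) expR); last exact: continuous_expR.
  by apply: cvgN; exact: c1.
- move=> x _; suff [? ->] : is_derive x 1 (fun u => - expR (- (t * expR u))) (t * expR x * expR (- (t * expR x))) by [].
  apply: is_derive_eq.
  by rewrite /GRing.scale/=; ring.
- rewrite -oppr0; apply: cvgN.
  apply: (@squeeze_cvgr _ _ _ _ (fun=> 0) (fun u => expR (- (t * u)))).
  + apply: nearW => u; rewrite expR_ge0/= ler_expR lerN2 ler_pM2l//.
    by apply: le_trans (expR_ge1Dx u); rewrite lerDr.
  + exact: cvg_cst.
  + exact: cvg_expRNM.
Qed.

Lemma tonelli_sets (D1 D2 : set mR) (K : mR * mR -> \bar R) :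
  measurable D1 -> measurable D2 -> measurable_fun [set: mR * mR] K ->
  (forall x y, D1 x -> D2 y -> (0 <= K (x, y))%E) ->
  (\int[mu]_(x in D1) \int[mu]_(y in D2) K (x, y) = \int[mu]_(y in D2) \int[mu]_(x in D1) K (x, y))%E.
Proof.
move=> m1 m2 mK K0.
pose K' := K \_ (D1 `*` D2).
have mK' : measurable_fun [set: mR * mR] K'.
  apply/(measurable_restrictT _ _).1; first exact: measurableX.
  exact: measurable_funTS.
have K'0 z : (0 <= K' z)%E.
  by rewrite /K' /patch; case: ifPn => // /set_mem; case: z => x y [] /=; exact: K0.
have K'E x y : K' (x, y) = if (x \in D1) && (y \in D2) then K (x, y) else 0%E.
  by rewrite /K' /patch in_setX.
have := @fubini_tonelli _ _ _ _ R mu mu K' mK' K'0.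
rewrite [in X in X -> _](_ : (fun x => _) = (fun x => \int[mu]_(y in D2) K (x, y))%E \_ D1); last first.
  apply/funext => x; rewrite /patch; case: ifPn => xD; last first.
    by apply: integral0_eq => y _; rewrite K'E (negPf xD).
  by rewrite [RHS]integral_mkcond; apply: eq_integral => y _; rewrite K'E xD /patch.
rewrite [in X in _ = X -> _](_ : (fun y => _) = (fun y => \int[mu]_(x in D1) K (x, y))%E \_ D2); last first.
  apply/funext => y; rewrite /patch; case: ifPn => yD; last first.
    by apply: integral0_eq => x _; rewrite K'E (negPf yD) andbF.
  by rewrite [RHS]integral_mkcond; apply: eq_integral => x _; rewrite K'E yD andbT /patch.
by rewrite -!integral_mkcond.
Qed.

(** The extended-real form of [Gamma], which is its [fine]: identities are proved here first and
    read on [Gamma] once the value is known to be finite. *)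
Definition gammaE (s : R) : \bar R :=
  (\int[mu]_(t in `]0%R, +oo[) (t `^ (s - 1) * expR (- t))%:E)%E.

Lemma measurable_gamma_integrand (s c : R) :
  measurable_fun [set: mR] (fun t : mR => (t `^ s * expR (- (c * t)))%:E).
Proof.
apply/measurable_EFinP; apply: measurable_funM; first exact: measurable_powR.
by apply: measurable_expRN; apply: measurable_funM.
Qed.

Lemma gammaE_ge0 s : (0 <= gammaE s)%E.
Proof. by apply: integral_ge0 => t _; rewrite lee_fin mulr_ge0 ?powR_ge0 ?expR_ge0. Qed.

Lemma gammaE_scale (s c : R) : 0 < c ->
  (\int[mu]_(t in `]0%R, +oo[) (t `^ (s - 1) * expR (- (c * t)))%:E = (c `^ (- s))%:E * gammaE s)%E.
Proof.
move=> c0; have c0' : c != 0 by rewrite gt_eqF.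
pose f : mR -> \bar R := (fun t => (t `^ (s - 1) * expR (- (1 * t)))%:E) \_ `]0, +oo[.
have f0 x : (0 <= f x)%E.
  by rewrite /f /patch; case: ifPn => // _; rewrite lee_fin mulr_ge0 ?powR_ge0 ?expR_ge0.
have mf : measurable_fun [set: mR] f.
  by apply/(measurable_restrictT _ _).1 => //; apply: measurable_funTS; exact: measurable_gamma_integrand.
have -> : gammaE s = (\int[mu]_x f x)%E.
  rewrite /gammaE integral_mkcond; apply: eq_integral => x _.
  by rewrite /f /patch; case: ifPn => // _; rewrite mul1r.
rewrite -(ge0_integral_scale c0' mf f0) (gtr0_norm c0) muleA -EFinM.
have mfc : measurable_fun [set: mR] (fun x : mR => f (c * x)%R).
  by apply: (measurableT_comp mf); exact: measurable_funM.
rewrite -ge0_integralZl//; last by rewrite lee_fin mulr_ge0 ?powR_ge0// ltW.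
rewrite [LHS]integral_mkcond; apply: eq_integral => x _.
rewrite /f /patch; have -> : (c * x \in `]0, +oo[%classic) = (x \in `]0, +oo[%classic).
  by apply/idP/idP; rewrite !inE/= !in_itv/= !andbT pmulr_rgt0.
case: ifPn => [|_]; last by rewrite mule0.
rewrite inE/= in_itv/= andbT => x0; rewrite mul1r -EFinM; congr EFin.
rewrite powRM ?(ltW c0) ?(ltW x0)// !mulrA.
suff -> : c `^ (- s) * c * c `^ (s - 1) = 1 by rewrite mul1r.
rewrite -[X in _ * X * _](powRr1 (ltW c0)) -!powRD ?c0' ?implybT//.
by rewrite (_ : _ + _ + _ = 0) ?powRr0//; ring.
Qed.

(* exp(-t) is the integral over u >= 0 of t e^u exp(-t e^u), a dilation of the
   integrand of Gamma(s + 1); Tonelli does the rest. *)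
Lemma gammaE_rec (s : R) : 0 < s -> (gammaE s = (s^-1)%:E * gammaE (s + 1))%E.
Proof.
move=> s0.
pose K (z : mR * mR) := (z.1 `^ s * (expR z.2 * expR (- (z.1 * expR z.2))))%:E.
have mK : measurable_fun [set: mR * mR] K.
  apply/measurable_EFinP; apply: measurable_funM.
    apply: (measurableT_comp (f := fun x => x `^ s)); first exact: measurable_powR.
    exact: measurable_fst.
  have me : measurable_fun [set: mR * mR] (fun z : mR * mR => expR z.2).
    by apply: (measurableT_comp (f := expR)); [exact: measurable_expR|exact: measurable_snd].
  apply: measurable_funM => //.
  by apply: measurable_expRN; apply: measurable_funM.
transitivity (\int[mu]_(t in `]0%R, +oo[) \int[mu]_(u in `[0%R, +oo[) K (t, u))%E.
  apply: eq_integral => t; rewrite inE/= in_itv/= andbT => t0.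
  have -> : (t `^ (s - 1) * expR (- t))%:E = ((t `^ (s - 1))%:E * (expR (- t))%:E)%E by [].
  rewrite -(integral_expRexp t0) -ge0_integralZl//; last 3 first.
  - apply: measurable_funTS; apply/measurable_EFinP.
    apply: measurable_funM.
      by apply: measurable_funM => //; exact: measurable_expR.
    by apply: measurable_expRN; apply: measurable_funM => //; exact: measurable_expR.
  - by move=> u _; rewrite lee_fin !mulr_ge0 ?expR_ge0// ltW.
  - by rewrite lee_fin powR_ge0.
  apply: eq_integral => u _; rewrite -EFinM /K/=; congr EFin.
  rewrite mulrA mulrA; congr (_ * _); rewrite mulrA; congr (_ * _).
  by rewrite -[X in _ * X](powRr1 (ltW t0)) -powRD ?gt_eqF ?implybT// subrK.
rewrite tonelli_sets//; last by move=> t u _ _; rewrite lee_fin !mulr_ge0 ?powR_ge0 ?expR_ge0.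
(* The dilation by e^u leaves e^u e^(-(s+1)u) = e^(-su), whose integral over u >= 0 is the factor
   1/s. *)
transitivity (\int[mu]_(u in `[0%R, +oo[) ((expR (- (s * u)))%:E * gammaE (s + 1)))%E.
  apply: eq_integral => u _.
  transitivity (\int[mu]_(t in `]0%R, +oo[) ((expR u)%:E * (t `^ (s + 1 - 1) * expR (- (expR u * t)))%:E))%E.
    apply: eq_integral => t _; rewrite -EFinM /K/= addrK; congr EFin.
    by rewrite mulrCA; congr (_ * (_ * expR (- _))); rewrite mulrC.
  rewrite ge0_integralZl//; last 2 first.
  - by apply: measurable_funTS; exact: measurable_gamma_integrand.
  - by move=> t _; rewrite lee_fin mulr_ge0 ?powR_ge0 ?expR_ge0.
  rewrite gammaE_scale ?expR_gt0// muleA -EFinM; congr (_%:E * _)%E.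
  rewrite /powR gt_eqF ?expR_gt0// expRK -expRD; congr expR; ring.
rewrite ge0_integralZr//; last 2 first.
- by apply: measurable_funTS; apply/measurable_EFinP; apply: measurable_expRN; exact: measurable_funM.
- exact: gammaE_ge0.
by rewrite integral_expRN// mulr0 oppr0 expR0 mul1r.
Qed.

Definition gaussE (k : R) : \bar R := (\int[mu]_x (`|x| `^ k * expR (- x ^+ 2))%:E)%E.

Lemma measurable_gauss_integrand (k c : R) :
  measurable_fun [set: mR] (fun x : mR => (`|x| `^ k * expR (- (c * x ^+ 2)))%:E).
Proof.
apply/measurable_EFinP; apply: measurable_funM.
  apply: (measurableT_comp (f := fun x => x `^ k)); first exact: measurable_powR.
  exact: measurable_norm.
by apply: measurable_expRN; apply: measurable_funM => //; apply: measurable_funX.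
Qed.

Lemma gaussE_ge0 k : (0 <= gaussE k)%E.
Proof. by apply: integral_ge0 => t _; rewrite lee_fin mulr_ge0 ?powR_ge0 ?expR_ge0. Qed.

Lemma gaussE_scale (k c : R) : 0 < c ->
  (\int[mu]_x (`|x| `^ k * expR (- (c * x ^+ 2)))%:E = (c `^ (- ((k + 1) / 2)))%:E * gaussE k)%E.
Proof.
move=> c0; set r := Num.sqrt c.
have r0 : 0 < r by rewrite sqrtr_gt0.
have r0' : r != 0 by rewrite gt_eqF.
have rr : r ^+ 2 = c by rewrite sqr_sqrtr// ltW.
have cr : c `^ (- ((k + 1) / 2)) = r `^ (- (k + 1)).
  by rewrite /r -powR12_sqrt ?(ltW c0)// -powRrM; congr powR; field.
pose f (x : mR) := (`|x| `^ k * expR (- (1 * x ^+ 2)))%:E.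
have f0 x : (0 <= f x)%E by rewrite lee_fin mulr_ge0 ?powR_ge0 ?expR_ge0.
have mf : measurable_fun [set: mR] f by exact: measurable_gauss_integrand.
have -> : gaussE k = (\int[mu]_x f x)%E by apply: eq_integral => x _; rewrite /f mul1r.
rewrite -(ge0_integral_scale r0' mf f0) (gtr0_norm r0) muleA -EFinM.
have mfc : measurable_fun [set: mR] (fun x : mR => f (r * x)%R).
  by apply: (measurableT_comp mf); exact: measurable_funM.
rewrite -ge0_integralZl//; last by rewrite lee_fin mulr_ge0 ?powR_ge0// ltW.
apply: eq_integral => x _; rewrite /f mul1r -EFinM; congr EFin.
rewrite exprMn rr normrM (gtr0_norm r0) powRM ?(ltW r0)// !mulrA cr.
suff -> : r `^ (- (k + 1)) * r * r `^ k = 1 by rewrite mul1r.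
rewrite -[X in _ * X * _](powRr1 (ltW r0)) -!powRD ?r0' ?implybT//.
by rewrite (_ : _ + _ + _ = 0) ?powRr0//; ring.
Qed.

(** As for Gamma, exp(-x^2) is the integral over u >= 0 of x^2 e^u exp(-x^2 e^u). Rescaling x leaves
    e^(-(k+1)u/2), whose integral is 2 / (k + 1). *)
Lemma gaussE_rec (k : R) : 0 < k -> (gaussE k = (2 / (k + 1))%:E * gaussE (k + 2))%E.
Proof.
move=> k0.
pose K (z : mR * mR) := (`|z.1| `^ (k + 2) * (expR z.2 * expR (- (expR z.2 * z.1 ^+ 2))))%:E.
have mK : measurable_fun [set: mR * mR] K.
  apply/measurable_EFinP; apply: measurable_funM.
    apply: (measurableT_comp (f := fun x => x `^ (k + 2))); first exact: measurable_powR.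
    by apply: measurable_norm; exact: measurable_fst.
  have me : measurable_fun [set: mR * mR] (fun z : mR * mR => expR z.2).
    by apply: (measurableT_comp (f := expR)); [exact: measurable_expR|exact: measurable_snd].
  apply: measurable_funM => //.
  by apply: measurable_expRN; apply: measurable_funM => //; apply: measurable_funX.
transitivity (\int[mu]_(x in [set: mR]) \int[mu]_(u in `[0%R, +oo[) K (x, u))%E.
  apply: eq_integral => x _.
  (* The representation of exp(-x^2) needs x^2 > 0; at x = 0 both sides vanish because k > 0. *)
  have [->|x0] := eqVneq x 0.
    rewrite integral0_eq ?normr0 ?powR0 ?mul0r ?gt_eqF// => u _.
    by rewrite /K/= normr0 powR0 ?mul0r// gt_eqF// addr_gt0.
  have x20 : 0 < x ^+ 2 by rewrite exprn_even_gt0.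
  have -> : (`|x| `^ k * expR (- x ^+ 2))%:E = ((`|x| `^ k)%:E * (expR (- x ^+ 2))%:E)%E by [].
  rewrite -(integral_expRexp x20) -ge0_integralZl//; last 2 first.
  - apply: measurable_funTS; apply/measurable_EFinP.
    apply: measurable_funM.
      by apply: measurable_funM => //; exact: measurable_expR.
    by apply: measurable_expRN; apply: measurable_funM => //; exact: measurable_expR.
  - by move=> u _; rewrite lee_fin mulr_ge0 ?expR_ge0// mulr_ge0 ?expR_ge0// ltW.
  apply: eq_integral => u _; rewrite -EFinM /K/=; congr EFin.
  rewrite [X in expR (- X)]mulrC mulrA mulrA; congr (_ * _); rewrite mulrA; congr (_ * _).
  by rewrite -(real_normK (num_real x)) -powR_mulrn// -powRD ?normr_eq0 ?x0 ?implybT.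
rewrite tonelli_sets//; last by move=> t u _ _; rewrite lee_fin !mulr_ge0 ?powR_ge0 ?expR_ge0.
transitivity (\int[mu]_(u in `[0%R, +oo[) ((expR (- ((k + 1) / 2 * u)))%:E * gaussE (k + 2)))%E.
  apply: eq_integral => u _.
  transitivity (\int[mu]_x ((expR u)%:E * (`|x| `^ (k + 2) * expR (- (expR u * x ^+ 2)))%:E))%E.
    by apply: eq_integral => x _; rewrite -EFinM /K/=; congr EFin; rewrite mulrCA.
  rewrite ge0_integralZl//; last exact: measurable_gauss_integrand.
  rewrite gaussE_scale ?expR_gt0// muleA -EFinM; congr (_%:E * _)%E.
  rewrite /powR gt_eqF ?expR_gt0// expRK -expRD; congr expR; field; done.
rewrite ge0_integralZr//; last 2 first.
- by apply: measurable_funTS; apply/measurable_EFinP; apply: measurable_expRN; exact: measurable_funM.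
- exact: gaussE_ge0.
rewrite integral_expRN ?mulr0 ?oppr0 ?expR0 ?mul1r ?divr_gt0 ?addr_gt0//.
by rewrite invf_div.
Qed.

End HalfLine.

Section Positivity.
Variables (d : measure_display) (T : measurableType d) (R : realType) (mu : {measure set T -> \bar R}).

(** If the integral were 0, f would vanish almost everywhere on D, and D would be negligible. *)
Lemma integral_gt0 (D : set T) (f : T -> \bar R) : measurable D -> (mu D != 0)%E ->
  measurable_fun D f -> (forall x, D x -> (0 < f x)%E) -> (0 < \int[mu]_(x in D) f x)%E.
Proof.
move=> mD D0 mf f0; rewrite lt0e integral_ge0 ?andbT => [|x /f0/ltW//].
apply: contra_neq D0 => i0; apply: measure_negligible => //.
have /(ae_eq_integral_abs mu mD mf)[N [mN N0 sN]] : (\int[mu]_(x in D) `|f x| = 0)%E.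
  by rewrite -[RHS]i0; apply: eq_integral => x /set_mem/f0/ltW/gee0_abs.
exists N; split=> // x Dx; apply: sN => /(_ Dx) fx0.
by have := f0 x Dx; rewrite fx0 ltxx.
Qed.

End Positivity.

(** * Finiteness and positivity of Gamma, G and J, and the recurrence of J *)

Section Special.
Variable R : realType.
Local Notation mR := (measurableTypeR R).
Local Notation mu := (@lebesgue_measure R).

(** The inequality x <= e^x at x = ct/s, raised to the power s. *)
Lemma powR_le_expR (s c t : R) : 0 < s -> 0 < c -> 0 <= t ->
  t `^ s <= (s / c) `^ s * expR (c * t).
Proof.
move=> s0 c0 t0.
have -> : c * t = c / s * t * s by field; rewrite gt_eqF.
have sc0 : 0 <= s / c by rewrite ltW// divr_gt0.
have s0' := ltW s0.
rewrite expRM -powRM ?expR_ge0//; apply: ge0_ler_powR; rewrite // ?nnegrE ?(mulr_ge0 sc0) ?expR_ge0//.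
rewrite -ler_pdivrMl ?divr_gt0// invf_div.
by apply: le_trans (expR_ge1Dx _); rewrite lerDr.
Qed.

Lemma lebesgue_measure_half_line_neq0 (b : bool) (a : R) :
  (mu [set` Interval (BSide b a) +oo%O] != 0)%E.
Proof. by rewrite lebesgue_measure_itv/= ltry. Qed.

Lemma gammaE_gt0 s : (0 < gammaE s :> \bar R)%E.
Proof.
apply: integral_gt0 => //.
- exact: lebesgue_measure_half_line_neq0.
- apply: measurable_funTS; apply: (eq_measurable_fun (fun t => (t `^ (s - 1) * expR (- (1 * t)))%:E)).
    by move=> t _; rewrite mul1r.
  exact: measurable_gamma_integrand.
- by move=> t; rewrite /= in_itv/= andbT => t0; rewrite lte_fin mulr_gt0 ?powR_gt0 ?expR_gt0.
Qed.

(** The recurrence passes to s + 1, whose integrand t^s exp(-t) has no singularity at 0; then t^s <=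
    C exp(t/2). *)
Lemma gammaE_lty s : 0 < s -> (gammaE s < +oo :> \bar R)%E.
Proof.
move=> s0; rewrite gammaE_rec//.
suff : (gammaE (s + 1) < +oo :> \bar R)%E.
  move=> h; have /fineK <- : gammaE (s + 1) \is a fin_num by rewrite ge0_fin_numE// gammaE_ge0.
  by rewrite -EFinM ltry.
pose C : R := (s / 2^-1) `^ s.
have C0 : 0 <= C by exact: powR_ge0.
have mexp : measurable_fun [set: mR] (fun t : mR => (expR (- (2^-1 * t)))%:E).
  by apply/measurable_EFinP; apply: measurable_expRN; exact: measurable_funM.
have h1 : (gammaE (s + 1) <= \int[mu]_(t in `]0%R, +oo[) (C%:E * (expR (- (2^-1 * t)))%:E))%E.
  apply: ge0_le_integral => //.
  - by move=> t _; rewrite lee_fin mulr_ge0 ?powR_ge0 ?expR_ge0.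
  - apply: measurable_funTS; apply: (eq_measurable_fun (fun t => (t `^ (s + 1 - 1) * expR (- (1 * t)))%:E)).
      by move=> t _; rewrite mul1r.
    exact: measurable_gamma_integrand.
  - by apply: measurable_funTS; exact: measurable_funeM.
  - move=> t; rewrite /= in_itv/= andbT => t0; rewrite -EFinM lee_fin addrK.
    have -> : - (2^-1 * t) = 2^-1 * t + - t by field.
    rewrite expRD mulrA ler_wpM2r ?expR_ge0//.
    by apply: powR_le_expR => //; exact: ltW.
apply: (le_lt_trans h1).
rewrite ge0_integralZl//; last exact: measurable_funTS.
have h2 : (\int[mu]_(t in `]0%R, +oo[) (expR (- (2^-1 * t)))%:E <= \int[mu]_(t in `[0%R, +oo[) (expR (- (2^-1 * t)))%:E)%E.
  apply: ge0_subset_integral => //; first exact: measurable_funTS.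
  by apply: subset_itvr; rewrite bnd_simp.
rewrite integral_expRN// in h2.
have h3 := lee_wpmul2l (C0 : (0 <= C%:E)%E) h2.
by apply: (le_lt_trans h3); rewrite -EFinM ltry.
Qed.

Lemma Gamma_gt0 (s : R) : 0 < s -> 0 < Gamma s.
Proof. by move=> s0; apply: fine_gt0; rewrite gammaE_gt0 gammaE_lty. Qed.

Lemma GammaS (s : R) : 0 < s -> Gamma (s + 1) = s * Gamma s.
Proof.
move=> s0; have := gammaE_rec s0.
have /fineK <- : gammaE (s + 1) \is a fin_num.
  by rewrite ge0_fin_numE ?gammaE_ge0// gammaE_lty// addr_gt0.
have /fineK <- : gammaE s \is a fin_num by rewrite ge0_fin_numE ?gammaE_ge0// gammaE_lty.
rewrite -EFinM => -[].
rewrite -[fine (gammaE (s + 1))]/(Gamma (s + 1)) -[fine (gammaE s)]/(Gamma s) => ->.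
by rewrite mulVKf// gt_eqF.
Qed.

Lemma measurable_gaussE_integrand (k : R) :
  measurable_fun [set: mR] (fun x : mR => (`|x| `^ k * expR (- x ^+ 2))%:E).
Proof.
rewrite (_ : (fun _ => _) = (fun x : mR => (`|x| `^ k * expR (- (1 * x ^+ 2)))%:E)).
  exact: measurable_gauss_integrand.
by apply: funext => x; rewrite mul1r.
Qed.

Lemma gaussE_gt0 k : (0 < gaussE k :> \bar R)%E.
Proof.
rewrite /gaussE.
apply: (@lt_le_trans _ _ (\int[mu]_(x in `]0%R, +oo[) (`|x| `^ k * expR (- x ^+ 2))%:E)%E).
  apply: integral_gt0 => //.
  - exact: lebesgue_measure_half_line_neq0.
  - by apply: measurable_funTS; exact: measurable_gaussE_integrand.
  - move=> t; rewrite /= in_itv/= andbT => t0.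
    by rewrite lte_fin mulr_gt0 ?powR_gt0 ?expR_gt0// normr_gt0 gt_eqF.
by apply: ge0_subset_integral => //; exact: measurable_gaussE_integrand.
Qed.

Lemma gaussE0 : (gaussE 0 = (Num.sqrt pi)%:E :> \bar R)%E.
Proof.
by rewrite -integralT_gauss; apply: eq_integral => x _; rewrite powRr0 mul1r.
Qed.

Lemma gaussE_lty k : 0 < k -> (gaussE k < +oo :> \bar R)%E.
Proof.
move=> k0.
pose C : R := (k / 2 / 2^-1) `^ (k / 2).
have C0 : 0 <= C by exact: powR_ge0.
have mexp : measurable_fun [set: mR] (fun x : mR => (`|x| `^ 0 * expR (- (2^-1 * x ^+ 2)))%:E).
  exact: measurable_gauss_integrand.
have h1 : (gaussE k <= \int[mu]_x (C%:E * (`|x| `^ 0 * expR (- (2^-1 * x ^+ 2)))%:E))%E.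
  apply: ge0_le_integral => //.
  - exact: measurable_gaussE_integrand.
  - exact: measurable_funeM.
  - move=> x _; rewrite -EFinM lee_fin powRr0 mul1r.
    have -> : - (2^-1 * x ^+ 2) = 2^-1 * x ^+ 2 + - x ^+ 2 by field.
    rewrite expRD mulrA ler_wpM2r ?expR_ge0//.
    have -> : `|x| `^ k = (x ^+ 2) `^ (k / 2).
      by rewrite -(real_normK (num_real x)) -powR_mulrn// -powRrM; congr powR; field.
    by apply: powR_le_expR => //; rewrite ?divr_gt0 ?sqr_ge0.
apply: (le_lt_trans h1).
rewrite ge0_integralZl//.
by rewrite gaussE_scale// gaussE0 -!EFinM ltry.
Qed.

Definition sinhR (t : R) : R := 2^-1 * (expR t - expR (- t)).

Lemma sinhR0 : sinhR 0 = 0.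
Proof. by rewrite /sinhR oppr0 subrr mulr0. Qed.

Lemma coshR_gt0 (t : R) : 0 < coshR t.
Proof. by rewrite mulr_gt0// addr_gt0// expR_gt0. Qed.

Lemma coshRN (t : R) : coshR (- t) = coshR t.
Proof. by rewrite /coshR opprK addrC. Qed.

Lemma coshR_ge_half_expR (t : R) : 2^-1 * expR t <= coshR t.
Proof. by rewrite ler_pM2l// lerDl expR_ge0. Qed.

Lemma coshR_le_expR (t : R) : coshR t <= expR `|t|.
Proof.
have h (s : R) : s <= `|t| -> expR s <= expR `|t| by rewrite ler_expR.
have h1 := h _ (ler_norm t).
rewrite /coshR; have : expR (- t) <= expR `|t| by apply: h; rewrite -normrN ler_norm.
lra.
Qed.

Lemma sinhR_le_expR (t : R) : `|sinhR t| <= expR `|t|.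
Proof.
apply: le_trans (coshR_le_expR t); rewrite /sinhR /coshR normrM gtr0_norm// ler_pM2l//.
by apply: le_trans (ler_normB _ _) _; rewrite !gtr0_norm ?expR_gt0.
Qed.

Lemma coshRD (s t : R) : coshR (s + t) = coshR s * coshR t + sinhR s * sinhR t.
Proof. by rewrite /coshR /sinhR opprD !expRD; field. Qed.

Lemma is_derive_coshR (b x : R) : is_derive x 1 (fun t => coshR (b * t)) (b * sinhR (b * x)).
Proof. by rewrite /coshR /sinhR; apply: is_derive_eq; rewrite /GRing.scale/=; ring. Qed.

Lemma is_derive_sinhR (b x : R) : is_derive x 1 (fun t => sinhR (b * t)) (b * coshR (b * x)).
Proof. by rewrite /coshR /sinhR; apply: is_derive_eq; rewrite /GRing.scale/=; ring. Qed.

Lemma continuous_coshM (b : R) : continuous (fun t => coshR (b * t)).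
Proof.
move=> x; apply: differentiable_continuous; apply/derivable1_diffP.
by have [] := is_derive_coshR b x.
Qed.

Definition coshp (m t : R) : R := coshR t `^ (- m).

Lemma coshp_ge0 m t : 0 <= coshp m t. Proof. exact: powR_ge0. Qed.

Lemma coshp_gt0 m t : 0 < coshp m t.
Proof. by rewrite powR_gt0// coshR_gt0. Qed.

Lemma coshpS m t : coshp (m + 1) t * coshR t = coshp m t.
Proof.
have c0 : (- (m + 1) + 1 == 0) ==> (coshR t != 0) by rewrite (gt_eqF (coshR_gt0 t)) implybT.
rewrite /coshp -[X in _ * X]powRr1 ?(ltW (coshR_gt0 _))// -powRD//.
by congr powR; ring.
Qed.

Lemma is_derive_coshp (m x : R) : is_derive x 1 (coshp m) (- m * coshp (m + 1) x * sinhR x).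
Proof.
have := is_derive_coshR 1 x; rewrite !mul1r => dc.
have dc' : is_derive x 1 (@coshR R) (sinhR x).
  by rewrite (_ : @coshR R = fun t => coshR (1 * t))//; apply/funext => t; rewrite mul1r.
have dp := @is_derive1_powR R (- m) (coshR x) (coshR_gt0 x).
have := is_derive1_comp dp dc'.
by rewrite /coshp opprD.
Qed.

Lemma continuous_coshp m : continuous (coshp m).
Proof.
move=> x; apply: differentiable_continuous; apply/derivable1_diffP.
by have [] := is_derive_coshp m x.
Qed.

Lemma coshp_le m t : 0 <= m -> coshp m t <= 2 `^ m * expR (- (m * t)).
Proof.
move=> m0; rewrite /coshp powRN.
have -> : 2 `^ m * expR (- (m * t)) = ((2^-1 * expR t) `^ m)^-1 :> R.
  by rewrite powRM ?invr_ge0 ?expR_ge0// invfM -(powR_inv1 (ler0n _ 2)) -powRrM mulN1r powRN invrK -expRM expRN (mulrC t).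
rewrite lef_pV2 ?posrE ?powR_gt0 ?coshR_gt0 ?mulr_gt0 ?expR_gt0//.
apply: ge0_ler_powR; rewrite ?nnegrE ?mulr_ge0 ?expR_ge0// ?(ltW (coshR_gt0 _))//.
exact: coshR_ge_half_expR.
Qed.

Definition JE (m b : R) : \bar R :=
  (\int[mu]_(t in `[0%R, +oo[) (coshR (b * t) * coshp m t)%:E)%E.

Lemma continuous_JE_integrand (m b : R) : continuous (fun t => coshR (b * t) * coshp m t).
Proof. by move=> x; apply: cvgM; [exact: continuous_coshM|exact: continuous_coshp]. Qed.

Lemma measurable_JE_integrand (m b : R) :
  measurable_fun [set: mR] (fun t : mR => (coshR (b * t) * coshp m t)%:E).
Proof.
apply/measurable_EFinP; apply: continuous_measurable_fun; exact: continuous_JE_integrand.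
Qed.

Lemma JE_ge0 m b : (0 <= JE m b)%E.
Proof. by apply: integral_ge0 => t _; rewrite lee_fin mulr_ge0 ?coshp_ge0 ?(ltW (coshR_gt0 _)). Qed.

Lemma JE_gt0 m b : (0 < JE m b)%E.
Proof.
apply: integral_gt0 => //.
- exact: lebesgue_measure_half_line_neq0.
- by apply: measurable_funTS; exact: measurable_JE_integrand.
- by move=> t _; rewrite lte_fin mulr_gt0 ?coshp_gt0 ?coshR_gt0.
Qed.

(** For t >= 0 the integrand is at most 2^m exp(-(m - |b|) t), and |b| < m makes this integrable. *)
Lemma JE_lty m b : `|b| < m -> (JE m b < +oo)%E.
Proof.
move=> bm; have m0 : 0 <= m by apply: le_trans (ltW bm).
have mb : 0 < m - `|b| by rewrite subr_gt0.
have mexp : measurable_fun [set: mR] (fun t : mR => (expR (- ((m - `|b|) * t)))%:E).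
  by apply/measurable_EFinP; apply: measurable_expRN; exact: measurable_funM.
have h1 : (JE m b <= \int[mu]_(t in `[0%R, +oo[) ((2 `^ m)%:E * (expR (- ((m - `|b|) * t)))%:E))%E.
  apply: ge0_le_integral => //.
  - by move=> t _; rewrite lee_fin mulr_ge0 ?coshp_ge0 ?(ltW (coshR_gt0 _)).
  - by apply: measurable_funTS; exact: measurable_JE_integrand.
  - by apply: measurable_funTS; exact: measurable_funeM.
  - move=> t; rewrite /= in_itv/= andbT => t0; rewrite -EFinM lee_fin.
    apply: le_trans (_ : expR `|b * t| * (2 `^ m * expR (- (m * t))) <= _).
      by apply: ler_pM; rewrite ?coshp_ge0 ?(ltW (coshR_gt0 _)) ?coshR_le_expR ?coshp_le.
    rewrite mulrCA -expRD normrM (ger0_norm t0) ler_wpM2l ?powR_ge0// ler_expR.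
    by rewrite mulrBl opprB addrC.
apply: (le_lt_trans h1).
rewrite ge0_integralZl//; last exact: measurable_funTS.
by rewrite integral_expRN// -EFinM ltry.
Qed.

(** On [0, n] the integrals of b and a differ by F(n), which tends to 0. The integrals over [0, n]
    of the nonnegative a and b increase to those over the half line, finite or not. *)
Lemma half_line_integral_eq (a b F : R -> R) :
  continuous a -> continuous b -> (forall x, 0 <= a x) -> (forall x, 0 <= b x) ->
  (forall x : R, is_derive x (1 : R) F (b x - a x)) -> F 0 = 0 -> F x @[x --> +oo] --> 0 ->
  (\int[mu]_(x in `[0%R, +oo[) (a x)%:E = \int[mu]_(x in `[0%R, +oo[) (b x)%:E)%E.
Proof.
move=> ca cb a0 b0 dF F0 Fl.
have ma : measurable_fun [set: mR] a by exact: continuous_measurable_fun.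
have mb : measurable_fun [set: mR] b by exact: continuous_measurable_fun.
have cF : continuous F.
  by move=> x; apply: differentiable_continuous; apply/derivable1_diffP; have [] := dF x.
have step (n : nat) : (0 < n)%N -> (\int[mu]_(x in `[0%R, n%:R]) (b x)%:E =
  \int[mu]_(x in `[0%R, n%:R]) (a x)%:E + (F n%:R)%:E)%E.
  move=> n0.
  have ci (f : R -> R) : continuous f -> mu.-integrable `[0%R, n%:R] (EFin \o f).
    move=> cf; apply: continuous_compact_integrable; first exact: segment_compact.
    exact: continuous_subspaceT.
  have <- : (\int[mu]_(x in `[0%R, n%:R]) (b x - a x)%:E = (F n%:R)%:E)%E.
    rewrite (@continuous_FTC2 _ _ F) ?ltr0n//.
    - by rewrite F0 sube0.
    - by apply: continuous_subspaceT => x; apply: cvgB; [exact: cb|exact: ca].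
    - split=> [x _| |]; first by have [] := dF x.
        by apply: cvg_at_right_filter; exact: cF.
      by apply: cvg_at_left_filter; exact: cF.
    - by move=> x _; rewrite derive1E; have [_ ->] := dF x.
  rewrite -integralD//; first by apply: eq_integral => x _; rewrite -EFinD addrC subrK.
  - exact: ci.
  - by apply: ci => x; apply: cvgB; [exact: cb|exact: ca].
have la := ge0_cvgn_integral (mu := mu) a0 ma.
have lb := ge0_cvgn_integral (mu := mu) b0 mb.
have lF : (F n%:R)%:E @[n --> \oo] --> 0%:E.
  apply: cvg_EFin; first exact: nearW.
  exact: (cvg_comp _ _ (@cvgr_idn R) Fl).
have lD : ((\int[mu]_(x in `[0%R, n%:R]) (a x)%:E + (F n%:R)%:E)%E @[n --> \oo] -->
    (\int[mu]_(x in `[0%R, +oo[) (a x)%:E + 0%:E)%E).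
  by apply: cvgeD => //; rewrite fin_num_adde_defl.
rewrite adde0 in lD.
apply: (cvg_unique _ lD); first exact: ereal_hausdorff.
apply: cvg_trans lb; apply: near_eq_cvg; exists 1%N => // n /= n1; exact: step.
Qed.

(* Integrates the derivative of sinh(bt) cosh(t)^(-m). *)
Lemma JE_rec (m b : R) : `|b| < m -> (m%:E * JE (m + 1) (b + 1) = (m + b)%:E * JE m b)%E.
Proof.
move=> bm; have m0 : 0 <= m by apply: le_trans (ltW bm).
have mb : 0 <= m + b by move: bm; rewrite ltr_norml => /andP[]; lra.
rewrite /JE -ge0_integralZl//; last 2 first.
- by apply: measurable_funTS; exact: measurable_JE_integrand.
- by move=> t _; rewrite lee_fin mulr_ge0 ?coshp_ge0 ?(ltW (coshR_gt0 _)).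
rewrite -ge0_integralZl//; last 2 first.
- by apply: measurable_funTS; exact: measurable_JE_integrand.
- by move=> t _; rewrite lee_fin mulr_ge0 ?coshp_ge0 ?(ltW (coshR_gt0 _)).
apply: (half_line_integral_eq (F := fun t => sinhR (b * t) * coshp m t)
   (a := fun t => m * (coshR ((b + 1) * t) * coshp (m + 1) t))
   (b := fun t => (m + b) * (coshR (b * t) * coshp m t))).
- by move=> x; apply: cvgM; [exact: cvg_cst|exact: continuous_JE_integrand].
- by move=> x; apply: cvgM; [exact: cvg_cst|exact: continuous_JE_integrand].
- by move=> x; rewrite !mulr_ge0 ?coshp_ge0 ?(ltW (coshR_gt0 _)).
- by move=> x; rewrite !mulr_ge0 ?coshp_ge0 ?(ltW (coshR_gt0 _)).
- move=> x; have ds := is_derive_sinhR b x; have dc := is_derive_coshp m x.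
  have [df de] := is_deriveM ds dc; split; [exact: df|apply: (etrans de)].
  (* The addition formula for cosh((b + 1) x), together with one factor cosh taken out of cosh^-m,
     turns the derivative into the difference of the two integrands. *)
  have := coshpS m x; rewrite /GRing.scale/= (mulrDl b) mul1r coshRD => <-.
  by ring.
- by rewrite mulr0 sinhR0 mul0r.
- have mb' : 0 < m - `|b| by rewrite subr_gt0.
  have lim0 : 2 `^ m * expR (- ((m - `|b|) * x)) @[x --> +oo] --> (0 : R).
    rewrite -(mulr0 (2 `^ m)); apply: cvgM; [exact: cvg_cst|exact: cvg_expRNM].
  have lim0' : - (2 `^ m * expR (- ((m - `|b|) * x))) @[x --> +oo] --> (0 : R).
    by rewrite -oppr0; exact: cvgN.
  apply: (squeeze_cvgr _ lim0' lim0); near=> x.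
  have x0 : 0 <= x by near: x; exact: nbhs_pinfty_ge.
  rewrite -ler_norml normrM (ger0_norm (coshp_ge0 _ _)).
  apply: le_trans (_ : expR `|b * x| * (2 `^ m * expR (- (m * x))) <= _).
    by apply: ler_pM; rewrite ?coshp_ge0 ?sinhR_le_expR ?coshp_le.
  rewrite mulrCA -expRD normrM (ger0_norm x0) ler_wpM2l ?powR_ge0// ler_expR.
  by rewrite mulrBl opprB addrC.
Unshelve. all: end_near. Qed.

Lemma JEN m b : JE m (- b) = JE m b.
Proof. by apply: eq_integral => t _; rewrite mulNr coshRN. Qed.

End Special.

(** * Moments of the Macdonald weights *)

Section Moments.
Variable R : realType.
Local Notation mR := (measurableTypeR R).
Local Notation mu := (@lebesgue_measure R).

(** The extended value of the Macdonald integral, infinite at x = 0, where [macdonald] is 0 by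
    default. *)
Definition macE (a x : R) : \bar R :=
  (\int[mu]_(t in `[0%R, +oo[) (expR (- x * coshR t) * coshR (a * t))%:E)%E.

Lemma macE_ge0 a x : (0 <= macE a x)%E.
Proof. by apply: integral_ge0 => t _; rewrite lee_fin mulr_ge0 ?expR_ge0 ?(ltW (coshR_gt0 _)). Qed.

Lemma macdonald_ge0 (a x : R) : 0 <= macdonald a x.
Proof. by apply: fine_ge0; exact: macE_ge0. Qed.

Lemma continuous_coshR : continuous (@coshR R).
Proof.
by move=> x; rewrite (_ : @coshR R = fun t => coshR (1 * t));
  [exact: continuous_coshM|apply: funext => t; rewrite mul1r].
Qed.

Lemma measurable_coshR (d : measure_display) (T : measurableType d) (g : T -> mR) :
  measurable_fun [set: T] g -> measurable_fun [set: T] (fun x => coshR (g x)).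
Proof.
apply: (measurableT_comp (f := @coshR R : mR -> mR)).
by apply: continuous_measurable_fun; exact: continuous_coshR.
Qed.

Lemma measurable_mac_kernel (a : R) : measurable_fun [set: mR * mR]
  (fun z : mR * mR => (expR (- (z.1 * coshR z.2)) * coshR (a * z.2))%:E).
Proof.
apply/measurable_EFinP; apply: measurable_funM.
  by apply: measurable_expRN; apply: measurable_funM => //; exact: measurable_coshR.
by apply: measurable_coshR; exact: measurable_funM.
Qed.

Lemma measurable_macE (a : R) : measurable_fun [set: mR] (macE a : mR -> \bar R).
Proof.
pose K := (fun z : mR * mR => (expR (- (z.1 * coshR z.2)) * coshR (a * z.2))%:E)
  \_ ([set: mR] `*` (`[0%R, +oo[%classic : set mR)).
have mK : measurable_fun [set: mR * mR] K.
  apply/(measurable_restrictT _ _).1; first exact: measurableX.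
  by apply: measurable_funTS; exact: measurable_mac_kernel.
have K0 z : (0 <= K z)%E.
  by rewrite /K /patch; case: ifPn => // _; rewrite lee_fin mulr_ge0 ?expR_ge0 ?(ltW (coshR_gt0 _)).
have := @measurable_fun_fubini_tonelli_F _ _ _ _ R mu K mK K0.
congr measurable_fun; apply: funext => x.
rewrite /macE /fubini_F [RHS]integral_mkcond; apply: eq_integral => t _.
by rewrite /K /patch in_setX in_setT/= mulNr.
Qed.

Lemma measurable_macdonald (a : R) : measurable_fun [set: mR] (macdonald a : mR -> mR).
Proof. exact: (measurableT_comp (fine_measurable measurableT) (measurable_macE a)). Qed.

(** After Tonelli the inner integral in x is a Gaussian one with parameter cosh(t); rescaling it
    gives G(k) times cosh(t)^(-(k+1)/2). *)
Lemma powR_macE_integral (k a : R) :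
  (\int[mu]_x ((`|x| `^ k)%:E * macE a (x ^+ 2)) = gaussE k * JE ((k + 1) / 2) a)%E.
Proof.
pose K (z : mR * mR) : \bar R := (`|z.1| `^ k * (expR (- (z.1 ^+ 2 * coshR z.2)) * coshR (a * z.2)))%:E.
have mc : measurable_fun [set: mR * mR] (fun z : mR * mR => coshR z.2).
  by apply: measurable_coshR; exact: measurable_snd.
have mK : measurable_fun [set: mR * mR] K.
  apply/measurable_EFinP; apply: measurable_funM.
    apply: (measurableT_comp (f := fun x : mR => x `^ k)); first exact: measurable_powR.
    by apply: measurable_norm; exact: measurable_fst.
  apply: measurable_funM.
    by apply: measurable_expRN; apply: measurable_funM => //; apply: measurable_funX.
  by apply: measurable_coshR; exact: measurable_funM.
transitivity (\int[mu]_(x in [set: mR]) \int[mu]_(t in `[0%R, +oo[) K (x, t))%E.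
  apply: eq_integral => x _; rewrite -ge0_integralZl//.
  - by apply: eq_integral => t _; rewrite -EFinM /K/= mulNr.
  - apply: measurable_funTS; apply/measurable_EFinP; apply: measurable_funM.
      apply: (measurableT_comp (f := @expR R : mR -> mR)); first exact: measurable_expR.
      by apply: measurable_funM => //; exact: measurable_coshR.
    by apply: measurable_coshR; exact: measurable_funM.
  - by move=> t _; rewrite lee_fin mulr_ge0 ?expR_ge0 ?(ltW (coshR_gt0 _)).
rewrite tonelli_sets//; last first.
  by move=> x t _ _; rewrite lee_fin !mulr_ge0 ?powR_ge0 ?expR_ge0 ?(ltW (coshR_gt0 _)).
transitivity (\int[mu]_(t in `[0%R, +oo[) (gaussE k * (coshR (a * t) * coshp ((k + 1) / 2) t)%:E))%E.
  apply: eq_integral => t _.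
  transitivity (\int[mu]_x ((coshR (a * t))%:E * (`|x| `^ k * expR (- (coshR t * x ^+ 2)))%:E))%E.
    by apply: eq_integral => x _; rewrite -EFinM /K/=; congr EFin; rewrite (mulrC (coshR t)); ring.
  rewrite ge0_integralZl//; last 2 first.
  - exact: measurable_gauss_integrand.
  - by rewrite lee_fin (ltW (coshR_gt0 _)).
  by rewrite gaussE_scale ?coshR_gt0// muleA -EFinM muleC.
rewrite ge0_integralZl//.
- by apply: measurable_funTS; exact: measurable_JE_integrand.
- by move=> t _; rewrite lee_fin mulr_ge0 ?coshp_ge0 ?(ltW (coshR_gt0 _)).
- exact: gaussE_ge0.
Qed.

(** The extended integral is finite, so its integrand is finite almost everywhere; where x <> 0 this
    makes [macE] finite and equal to [macdonald]. At x = 0 the factor |x|^k is 0. *)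
Lemma powR_macdonald_integral (k a : R) : 0 < k -> `|a| < (k + 1) / 2 ->
  (\int[mu]_x (`|x| `^ k * macdonald a (x ^+ 2))%:E
   = (fine (gaussE k) * fine (JE ((k + 1) / 2) a))%:E)%E.
Proof.
move=> k0 ak.
have gf : gaussE k \is a fin_num by rewrite ge0_fin_numE ?gaussE_ge0// gaussE_lty.
have jf : JE ((k + 1) / 2) a \is a fin_num by rewrite ge0_fin_numE ?JE_ge0// JE_lty.
rewrite EFinM !fineK// -powR_macE_integral.
have m2 : measurable_fun [set: mR] (fun x : mR => x ^+ 2) by exact: measurable_funX.
have mp : measurable_fun [set: mR] (fun x : mR => `|x| `^ k).
  apply: (measurableT_comp (f := fun x : mR => x `^ k)); first exact: measurable_powR.
  exact: measurable_norm.
have mG : measurable_fun [set: mR] (fun x : mR => (`|x| `^ k)%:E * macE a (x ^+ 2))%E.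
  apply: emeasurable_funM; first exact/measurable_EFinP.
  exact: (measurableT_comp (measurable_macE a) m2).
have G0 (x : mR) : (0 <= (`|x| `^ k)%:E * macE a (x ^+ 2))%E.
  by rewrite mule_ge0 ?lee_fin ?powR_ge0 ?macE_ge0.
apply: ge0_ae_eq_integral => //.
- apply/measurable_EFinP; apply: measurable_funM => //.
  exact: (measurableT_comp (measurable_macdonald a) m2).
- by move=> x _; rewrite lee_fin mulr_ge0 ?powR_ge0 ?macdonald_ge0.
have iG : mu.-integrable [set: mR] (fun x : mR => (`|x| `^ k)%:E * macE a (x ^+ 2))%E.
  apply/integrableP; split=> //.
  under eq_integral => x _ do rewrite gee0_abs//.
  by rewrite powR_macE_integral -(fineK gf) -(fineK jf) -EFinM ltry.
have := integrable_ae measurableT iG; apply: filterS => x /(_ I) fx _.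
rewrite EFinM /macdonald -[Rintegral _ _ _]/(fine (macE a (x ^+ 2))).
have [->|x0] := eqVneq x 0; first by rewrite normr0 powR0 ?gt_eqF// !mul0e.
rewrite fineK//; move: fx; rewrite !ge0_fin_numE ?macE_ge0//.
move: (macE a (x ^+ 2)) (macE_ge0 a (x ^+ 2)) => [r _ _|_|//]; first exact: ltry.
have nx : 0 < `|x| by rewrite normr_gt0.
by rewrite gt0_muley// lte_fin; exact: powR_gt0.
Qed.

Definition mac_const (a : R) : R := (pi * 2 `^ a * Gamma (a + 1))^-1.

Lemma mac_const_gt0 (a : R) : -1 < a -> 0 < mac_const a.
Proof.
by move=> a1; rewrite invr_gt0 !mulr_gt0 ?pi_gt0 ?powR_gt0 ?Gamma_gt0//; lra.
Qed.

(** By Gamma(a + 2) = (a + 1) Gamma(a + 1), the factor 2 (alpha + 1) of the odd part of the norm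
    restores the constant of the even part. *)
Lemma mac_constS (a : R) : -1 < a -> 2 * (a + 1) * mac_const (a + 1) = mac_const a.
Proof.
move=> a1; rewrite /mac_const GammaS; last lra.
have G0 : Gamma (a + 1) != 0 by rewrite gt_eqF// Gamma_gt0//; lra.
have p0 : 2 `^ a != 0 :> R by rewrite gt_eqF// powR_gt0.
rewrite powRD ?pnatr_eq0 ?implybT// powRr1//.
have a0 : a + 1 != 0 by rewrite gt_eqF//; lra.
have pi0 : pi != 0 :> R by rewrite gt_eqF// pi_gt0.
have aux (G p q b : R) : G != 0 -> p != 0 -> q != 0 -> b != 0 ->
    2 * b / (q * (p * 2) * (b * G)) = (q * p * G)^-1.
  by move=> G1 p1 q1 b1; field; rewrite G1 p1 q1 b1.
exact: aux.
Qed.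

(** The index a of the constant and of the power is kept apart from the order b of the Macdonald
    function: once 2 (alpha + 1) |p|^-2 is absorbed, the odd part has a = alpha but b = alpha +
    1. *)
Definition fock_moment (a b : R) (n : nat) : R :=
  mac_const a * pi * (fine (gaussE (2 * n%:R + 2 * a + 3)) * fine (JE (n%:R + a + 2) b)).

(** In polar coordinates the exponents add up to 2n from the squared monomial, 2a + 2 from the
    density and 1 from the Jacobian, whence G(2n + 2a + 3). *)
Lemma radial_moment (a b : R) (n : nat) : - 2^-1 <= a -> `|b| < n%:R + a + 2 ->
  (\int[@lebesgue2 R]_z
    (Num.sqrt (z.1 ^+ 2 + z.2 ^+ 2) ^+ n.*2 * (mac_const a *
      (Num.sqrt (z.1 ^+ 2 + z.2 ^+ 2) `^ (2 * a + 2) *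
        macdonald b (Num.sqrt (z.1 ^+ 2 + z.2 ^+ 2) ^+ 2))))%:E
  = (fock_moment a b n)%:E)%E.
Proof.
move=> ha hb; have nr : 0 <= n%:R :> R by exact: ler0n.
have c0 : 0 < mac_const a by apply: mac_const_gt0; lra.
pose h (r : mR) : \bar R := (`|r| ^+ n.*2 * (mac_const a * (`|r| `^ (2 * a + 2) * macdonald b (r ^+ 2))))%:E.
have mn : measurable_fun [set: mR] (fun r : mR => `|r|) by exact: measurable_norm.
have mh : measurable_fun [set: mR] h.
  apply/measurable_EFinP; apply: measurable_funM; first exact: measurable_funX.
  apply: measurable_funM => //; apply: measurable_funM.
    exact: (measurableT_comp (f := fun x : mR => x `^ (2 * a + 2)) (measurable_powR _)).
  apply: (measurableT_comp (measurable_macdonald b)); exact: measurable_funX.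
have h0 r : (0 <= h r)%E.
  by rewrite lee_fin !mulr_ge0 ?exprn_ge0 ?(ltW c0) ?powR_ge0 ?macdonald_ge0.
transitivity (\int[mu \x mu]_z h (Num.sqrt (z.1 ^+ 2 + z.2 ^+ 2)))%E.
  by apply: eq_integral => z _; rewrite /h ger0_norm ?sqrtr_ge0.
rewrite ge0_integral_radial//.
have k0 : 0 < 2 * n%:R + 2 * a + 3 by lra.
have kE : (2 * n%:R + 2 * a + 3 + 1) / 2 = n%:R + a + 2 by field.
have := @powR_macdonald_integral (2 * n%:R + 2 * a + 3) b k0.
rewrite kE => /(_ hb) e.
rewrite /fock_moment (mulrC (mac_const a)) -mulrA [RHS]EFinM.
transitivity ((pi : R)%:E * \int[mu]_x ((mac_const a)%:E * (`|x| `^ (2 * n%:R + 2 * a + 3) * macdonald b (x ^+ 2))%:E))%E.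
  congr (_ * _)%E; apply: eq_integral => x _; rewrite /h normr_id -!EFinM; congr EFin.
  rewrite real_normK ?num_real//.
  have [->|x0] := eqVneq x 0; first by rewrite normr0 mul0r powR0 ?gt_eqF// mul0r mulr0.
  have nx : (`|x| != 0) by rewrite normr_eq0.
  have -> : `|x| `^ (2 * n%:R + 2 * a + 3) = `|x| * `|x| ^+ n.*2 * `|x| `^ (2 * a + 2).
    rewrite -powR_mulrn// -[X in X * _ * _]powRr1// -!powRD ?nx ?implybT//.
    by congr powR; rewrite -muln2 natrM; ring.
  by ring.
rewrite ge0_integralZl//.
- by rewrite e -!EFinM; congr EFin; ring.
- apply/measurable_EFinP; apply: measurable_funM.
    exact: (measurableT_comp (f := fun x : mR => x `^ (2 * n%:R + 2 * a + 3)) (measurable_powR _)).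
  apply: (measurableT_comp (measurable_macdonald b)); exact: measurable_funX.
- by move=> x _; rewrite lee_fin mulr_ge0 ?powR_ge0 ?macdonald_ge0.
- by rewrite lee_fin ltW.
Qed.

Lemma fock_moment_gt0 (a b : R) n : - 2^-1 <= a -> `|b| < n%:R + a + 2 -> 0 < fock_moment a b n.
Proof.
move=> ha hb; have nr : 0 <= n%:R :> R by exact: ler0n.
rewrite !mulr_gt0 ?pi_gt0 ?mac_const_gt0//; first by lra.
  by apply: fine_gt0; rewrite gaussE_gt0 gaussE_lty//; lra.
by apply: fine_gt0; rewrite JE_gt0 JE_lty.
Qed.

Definition fock_coef (a : R) (n : nat) : R := fock_moment a (if odd n then a + 1 else a) n.

Lemma fock_moment_bound (a : R) (n : nat) : - 2^-1 <= a ->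
  `|a| < n%:R + a + 2 /\ `|a + 1| < n%:R + a + 2.
Proof.
move=> ha; have nr : 0 <= n%:R :> R by exact: ler0n.
by split; rewrite ltr_norml; apply/andP; split; lra.
Qed.

Lemma fock_coef_gt0 a n : - 2^-1 <= a -> 0 < fock_coef a n.
Proof.
move=> ha; have [h1 h2] := fock_moment_bound n ha.
by rewrite /fock_coef; case: ifP => _; exact: fock_moment_gt0.
Qed.

Lemma fine_JE_rec (m b : R) : `|b| < m -> m * fine (JE (m + 1) (b + 1)) = (m + b) * fine (JE m b).
Proof.
move=> bm; have jf : JE m b \is a fin_num by rewrite ge0_fin_numE ?JE_ge0// JE_lty.
have jf' : JE (m + 1) (b + 1) \is a fin_num.
  rewrite ge0_fin_numE ?JE_ge0// JE_lty//; move: bm; rewrite !ltr_norml => /andP[? ?].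
  by apply/andP; split; lra.
by have := JE_rec bm; rewrite -(fineK jf) -(fineK jf') -!EFinM => -[].
Qed.

Lemma fock_coefS_aux (m s k A B C G : R) : m != 0 -> k = 2 * m -> m * A = s * B ->
  C * (G * A) = s * (C * (2 / k * G * B)).
Proof.
move=> m0 -> e; have -> : A = m^-1 * (s * B) by rewrite -e mulKf.
by field.
Qed.

(** One step in n raises the argument of G by 2 and m = n + a + 2 by 1. The factor m gained from G
    cancels the one in the recurrence of J, which leaves m + b. *)
Lemma fock_coefS a n : - 2^-1 <= a -> fock_coef a n.+1 = gam a n.+1 * fock_coef a n.
Proof.
move=> ha; have nr : 0 <= n%:R :> R by exact: ler0n.
have [h1 h2] := fock_moment_bound n ha.
have k0 : 0 < 2 * n%:R + 2 * a + 3 by lra.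
have k2f : gaussE (2 * n%:R + 2 * a + 3 + 2) \is a fin_num.
  by rewrite ge0_fin_numE ?gaussE_ge0// gaussE_lty//; lra.
have g := gaussE_rec k0; rewrite -(fineK k2f) -EFinM in g.
rewrite /fock_coef /fock_moment g/=.
have -> : 2 * n.+1%:R + 2 * a + 3 = 2 * n%:R + 2 * a + 3 + 2 by rewrite -natr1; ring.
have -> : n.+1%:R + a + 2 = n%:R + a + 2 + 1 by rewrite -natr1; ring.
set G := fine (gaussE _).
have m0 : n%:R + a + 2 != 0 by rewrite gt_eqF//; lra.
have kE : 2 * n%:R + 2 * a + 3 + 1 = 2 * (n%:R + a + 2) by ring.
rewrite /gam /=; case: (odd n) => /=.
  (* For odd n the order must drop from a + 1 to a, while the recurrence raises it; J is even in b,
     so the recurrence is read from -(a + 1) to -a. *)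
  have := @fine_JE_rec (n%:R + a + 2) (- (a + 1)); rewrite normrN => /(_ h2).
  rewrite JEN (_ : - (a + 1) + 1 = - a); last by ring.
  rewrite JEN => e.
  rewrite [X in _ = X * _](_ : _ = n%:R + a + 2 - (a + 1)); last by rewrite mulr0 -natr1; ring.
  exact: fock_coefS_aux e.
rewrite [X in _ = X * _](_ : _ = n%:R + a + 2 + a); last by rewrite mulr1 -natr1; ring.
apply: fock_coefS_aux (fine_JE_rec h1) => //.
Qed.

End Moments.

(** * Norms and inner products through coefficients *)

Section HasIntegral.
Variables (d : measure_display) (T : measurableType d) (R : realType).
Variable mu : {measure set T -> \bar R}.
Implicit Types (h : T -> R) (c : R).

(** Integrability is bundled with the value, since the real integral alone has a default value. *)
Definition has_integral h c :=
  mu.-integrable [set: T] (EFin \o h) /\ (\int[mu]_z (h z)%:E = c%:E)%E.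

Lemma has_integralE h c : has_integral h c -> (\int[mu]_z h z)%R = c.
Proof. by move=> [_ e]; rewrite /Rintegral e. Qed.

Lemma has_integral0 : has_integral (fun=> 0) 0.
Proof. by split; [exact: integrable0|exact: integral0]. Qed.

Lemma has_integralD h h' c c' : has_integral h c -> has_integral h' c' ->
  has_integral (fun z => h z + h' z) (c + c').
Proof.
move=> [ih e] [ih' e']; split; first exact: (integrableD measurableT ih ih').
rewrite EFinD -e -e' -(integralD measurableT ih ih').
by apply: eq_integral => z _; rewrite EFinD.
Qed.

Lemma has_integralZ (k : R) h c : has_integral h c -> has_integral (fun z => k * h z) (k * c).
Proof.
move=> [ih e]; split; first exact: (integrableZl measurableT k ih).
rewrite EFinM -e -(integralZl measurableT ih).
by apply: eq_integral => z _; rewrite EFinM.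
Qed.

Lemma has_integral_sum (N : nat) (h : nat -> T -> R) (c : nat -> R) :
  (forall n, (n < N)%N -> has_integral (h n) (c n)) ->
  has_integral (fun z => \sum_(n < N) h n z) (\sum_(n < N) c n).
Proof.
elim: N => [|N ih] H.
  rewrite big_ord0 (_ : (fun _ => _) = fun=> 0); first exact: has_integral0.
  by apply: funext => z; rewrite big_ord0.
rewrite big_ord_recr/= (_ : (fun _ => _) = fun z => \sum_(n < N) h n z + h N z).
  by apply: has_integralD; [apply: ih => n nN; apply: H; exact: ltnW|exact: H].
by apply: funext => z; rewrite big_ord_recr.
Qed.

Lemma eq_has_integral h h' c : h =1 h' -> has_integral h c -> has_integral h' c.
Proof. by move=> /funext ->. Qed.

Lemma ge0_has_integral h c : measurable_fun [set: T] h -> (forall z, 0 <= h z) ->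
  (\int[mu]_z (h z)%:E = c%:E)%E -> has_integral h c.
Proof.
move=> mh h0 e; split=> //; apply/integrableP; split; first exact/measurable_EFinP.
under eq_integral => z _ do rewrite /= ger0_norm//.
by rewrite e ltry.
Qed.

Lemma ge0_has_integral_fine h : measurable_fun [set: T] h -> (forall z, 0 <= h z) ->
  (\int[mu]_z (h z)%:E < +oo)%E -> has_integral h (fine (\int[mu]_z (h z)%:E)%E).
Proof.
move=> mh h0 e; apply: ge0_has_integral => //; rewrite fineK// ge0_fin_numE//.
by apply: integral_ge0 => z _; rewrite lee_fin.
Qed.

Lemma fatou_le (u : nat -> T -> R) h (B : \bar R) : (forall n, measurable_fun [set: T] (u n)) ->
  (forall n z, 0 <= u n z) -> (forall z, u n z @[n --> \oo] --> h z) ->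
  (forall n, (\int[mu]_z (u n z)%:E <= B)%E) -> (\int[mu]_z (h z)%:E <= B)%E.
Proof.
move=> mu' u0 uh uB.
have := @fatou _ _ _ mu _ measurableT (fun n z => (u n z)%:E).
have mE n : measurable_fun [set: T] (fun z => (u n z)%:E) by exact/measurable_EFinP.
move=> /(_ mE).
move=> /(_ (fun n z _ => u0 n z)) H.
have -> : (\int[mu]_z (h z)%:E = \int[mu]_z limn_einf (fun n => (u n z)%:E))%E.
  apply: eq_integral => z _; apply/esym.
  by have [] // := @cvg_limn_einf_sup _ (fun n => (u n z)%:E) (h z)%:E;
    apply: cvg_EFin; [exact: nearW|exact: uh].
apply: (le_trans H); rewrite limn_einf_lim; apply: lime_le; first exact: is_cvg_einfs.
by apply: nearW => n; apply: le_trans (uB n); apply: ereal_inf_lbound; exists n => /=.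
Qed.

End HasIntegral.

(** * Orthogonality of powers for rotation-invariant weights *)

Section RadialWeight.
Variable R : realType.
Local Notation mR := (measurableTypeR R).
Local Notation mu2 := (@lebesgue2 R).
Variables (I : quat R) (sI : sphere I).
Local Notation pt := (slice_of I).

(** Abstract so as to cover the even and the odd weight as well as their truncations to discs; m
    lists the integrals of |p|^(2n) W. *)
Definition radial_weight (W : mR * mR -> R) (m : nat -> R) : Prop :=
  [/\ forall z, 0 <= W z, measurable_fun [set: mR * mR] W,
      forall c s z, c ^+ 2 + s ^+ 2 = 1 -> W (plane_rot c s z) = W z
    & forall n, has_integral mu2 (fun z => qabs (pt z) ^+ n.*2 * W z) (m n)].

Lemma continuous_pt : continuous (fun z : R * R => pt z).
Proof.
by move=> z; apply: slice_pt_cvg; [exact: cvg_fst|exact: cvg_snd].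
Qed.

Lemma qabs_pt z : qabs (pt z) = Num.sqrt (z.1 ^+ 2 + z.2 ^+ 2).
Proof. by rewrite /qabs qabs_slice_pt. Qed.

Lemma pt_rot c s z : pt (plane_rot c s z) = slice_pt I c s * pt z.
Proof. rewrite /slice_of (slice_ptM sI) /plane_rot/=; congr (slice_pt _ _ _); ring. Qed.

Lemma qabs_pt_rot c s z : c ^+ 2 + s ^+ 2 = 1 -> qabs (pt (plane_rot c s z)) = qabs (pt z).
Proof.
move=> cs; rewrite pt_rot qabsM [X in X * _](_ : _ = 1) ?mul1r//.
by rewrite /qabs qabs_slice_pt// cs sqrtr1.
Qed.

Lemma measurable_qabs_pt : measurable_fun [set: mR * mR] (fun z : mR * mR => qabs (pt z)).
Proof.
apply: (@continuous_measurable_fun2 R (fun z => qabs (pt z))) => z.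
by apply: cvg_qabs; exact: continuous_pt.
Qed.

Lemma continuous_qre (T : topologicalType) (h : T -> quat R) :
  continuous h -> continuous (fun z => qre (h z)).
Proof. by move=> ch z; apply: cvg_qcoord; exact: ch. Qed.

Lemma continuous_qconj (T : topologicalType) (h : T -> quat R) :
  continuous h -> continuous (fun z => qconj (h z)).
Proof.
move=> ch z; rewrite /qconj; have H i := cvg_qcoord (i := i) (ch z).
by apply: cvg_Quat; try apply: cvgN; exact: H.
Qed.

Lemma continuous_ptX n : continuous (fun z : R * R => pt z ^+ n).
Proof.
elim: n => [|n ih] z; first by under eq_fun do rewrite expr0; exact: cvg_cst.
rewrite /continuous_at exprS; under eq_fun do rewrite exprS.
by apply: cvg_qmul; [exact: continuous_pt|exact: ih].
Qed.

Section Poly.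
Variables (W : mR * mR -> R) (m : nat -> R).
Hypothesis hW : radial_weight W m.

Definition cross (n k : nat) (u v : quat R) (z : mR * mR) : R :=
  qre (qconj (pt z ^+ k * v) * (pt z ^+ n * u)).

Lemma continuous_cross n k u v : continuous (cross n k u v : R * R -> R).
Proof.
apply: continuous_qre; apply: continuous_qmul.
  by apply: continuous_qconj; apply: continuous_qmul; [exact: continuous_ptX|exact: continuous_qcst].
by apply: continuous_qmul; [exact: continuous_ptX|exact: continuous_qcst].
Qed.

(** The inequality (x - y)^2 >= 0 bounds mixed products by even powers of |p|, whose integrals are
    those that [radial_weight] provides. *)
Lemma cross_le n k u v z :
  `|cross n k u v z| <= qabs u * qabs v * (qabs (pt z) ^+ n.*2 + qabs (pt z) ^+ k.*2).
Proof.
apply: le_trans (qre_le_qabs _) _; rewrite qabsM qabs_conj !qabsM !qabsX.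
set r := qabs (pt z); rewrite (_ : _ * _ = qabs u * qabs v * (r ^+ n * r ^+ k)); last by ring.
rewrite ler_wpM2l ?mulr_ge0 ?qabs_ge0//.
have rn : 0 <= r ^+ n by rewrite exprn_ge0 ?qabs_ge0.
have rk : 0 <= r ^+ k by rewrite exprn_ge0 ?qabs_ge0.
rewrite -!mul2n ![(2 * _)%N]mulnC !exprM; move: (r ^+ n) (r ^+ k) rn rk => x y x0 y0.
by have := sqr_ge0 (x - y); nra.
Qed.

Lemma measurable_cross n k u v : measurable_fun [set: mR * mR] (cross n k u v).
Proof. exact: (@continuous_measurable_fun2 R (cross n k u v) (@continuous_cross n k u v)). Qed.

Lemma integrable_cross n k u v :
  mu2.-integrable [set: mR * mR] (EFin \o (fun z => cross n k u v z * W z)).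
Proof.
have [W0 mW rW iW] := hW.
have [ig _] := has_integralZ (qabs u * qabs v) (has_integralD (iW n) (iW k)).
apply: le_integrable ig => //.
  apply/measurable_EFinP; apply: measurable_funM => //.
  exact: measurable_cross.
move=> z _ /=; rewrite lee_fin normrM (ger0_norm (W0 z)) -mulrDl mulrA.
apply: le_trans (ler_norm _); rewrite ler_wpM2r//; exact: cross_le.
Qed.

Lemma qconj_qcis t : qconj (qcis I t) * qcis I t = 1.
Proof. by rewrite qconjMq -qabs_sqr qabs_qcis// expr1n scale1r. Qed.

(* Two rotations by pi / (2 (n - k)) multiply p^n conj(p)^k by I^2 = -1. *)
Lemma cross_rot n k u v z : (k < n)%N ->
  let t := pi / (2 * (n - k)%:R) in
  cross n k u v (plane_rot (cos t) (sin t) (plane_rot (cos t) (sin t) z)) = - cross n k u v z.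
Proof.
move=> kn t; have tn : t * (n - k)%:R + t * (n - k)%:R = pi.
  have n0 : (n - k)%:R != 0 :> R by rewrite pnatr_eq0 subn_eq0 -ltnNge.
  by rewrite /t; field.
have E : pt (plane_rot (cos t) (sin t) (plane_rot (cos t) (sin t) z)) = qcis I (t + t) * pt z.
  by rewrite !pt_rot mulrA (qcisD sI).
rewrite /cross E; set q := qcis I (t + t).
have cq i : (q * pt z) ^+ i = q ^+ i * pt z ^+ i.
  by apply: exprMn_comm; exact: slice_pt_comm.
have e : qconj (q ^+ k) * q ^+ n = -1.
  rewrite -(subnKC (ltnW kn)) exprD mulrA /q !qcisX// qconj_qcis mul1r.
  rewrite -mulr_natr mulrDl tn; exact: qcis_pi.
rewrite !cq -![_ * _ * v]mulrA -![_ * _ * u]mulrA qconjM.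
rewrite -mulrA (mulrA (qconj (q ^+ k))) e mulN1r mulrN.
by rewrite quatE.
Qed.

Lemma cross_integral0 n k u v : (k < n)%N -> has_integral mu2 (fun z => cross n k u v z * W z) 0.
Proof.
move=> kn; have [W0 mW rW iW] := hW; have ic := integrable_cross n k u v.
split=> //; pose t : R := pi / (2 * (n - k)%:R).
pose G (z : mR * mR) := (cross n k u v z * W z)%:E.
have mG : measurable_fun [set: mR * mR] G by have /integrableP[] := ic.
have t2 : cos t ^+ 2 + sin t ^+ 2 = 1 by exact: cos2Dsin2.
(* The half angle is at most pi/2, so its cosine avoids -1. A single rotation by pi / (n - k) would
   be the excluded one when n - k = 1. *)
have t1 : cos t != -1.
  have n1 : 1 <= (n - k)%:R :> R by rewrite ler1n subn_gt0.
  rewrite gt_eqF//; apply: lt_le_trans (_ : 0 <= _); first by rewrite ltrN10.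
  apply: cos_ge0_pihalf; rewrite /t; apply/andP; split.
    apply: le_trans (_ : 0 <= _); first by rewrite oppr_le0 divr_ge0 ?pi_ge0.
    by rewrite divr_ge0 ?pi_ge0// mulr_ge0.
  rewrite ler_pM2l ?pi_gt0// lef_pV2 ?posrE ?mulr_gt0// ?ler_peMr//.
  exact: lt_le_trans n1.
have mG1 : measurable_fun [set: mR * mR] (fun z => G (plane_rot (cos t) (sin t) z)).
  by apply: (measurableT_comp mG); exact: measurable_rot.
have e1 := integral_rot t2 t1 mG1; have e2 := integral_rot t2 t1 mG.
have e3 : (\int[mu2]_z G z = \int[mu2]_z (- G z))%E.
  rewrite -[LHS]e2 -[LHS]e1; apply: eq_integral => z _.
  by rewrite /G cross_rot// !rW// mulNr EFinN.
have fi := integrable_fin_num measurableT ic.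
have {e3}: (\int[mu2]_z G z = - \int[mu2]_z G z)%E.
  rewrite [LHS]e3 integralN//; apply: integrable_add_def => //.
rewrite -[(\int[mu2]_z G z)%E]fineK// -EFinN => -[] e4.
by congr EFin; move: e4; lra.
Qed.

Lemma qabs2_sum_recr N (a : nat -> quat R) (z : mR * mR) : qabs2 (psum a N.+1 (pt z)) =
  qabs2 (psum a N (pt z)) + (\sum_(k < N) 2 * cross N k (a N) (a k) z
     + qabs2 (a N) * qabs (pt z) ^+ N.*2).
Proof.
have e1 : 2 * qre (qconj (psum a N (pt z)) * (pt z ^+ N * a N)) = \sum_(k < N) 2 * cross N k (a N) (a k) z.
  have gen (K : nat) X : 2 * qre (qconj (psum a K (pt z)) * X) =
      \sum_(k < K) 2 * qre (qconj (pt z ^+ k * a k) * X).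
    elim: K => [|K ih]; first by rewrite psum0 big_ord0 qconj0 mul0r quatE mulr0.
    by rewrite psumS big_ord_recr/= qconjD (mulrDl (qconj _)) qreD mulrDr ih.
  exact: gen.
have e2 : qabs2 (pt z ^+ N * a N) = qabs2 (a N) * qabs (pt z) ^+ N.*2.
  by rewrite qabs2M mulrC -(qabs_sqr (_ ^+ N)) qabsX -exprM muln2.
by rewrite psumS qabs2D e1 e2 addrA.
Qed.

Lemma poly_norm N (a : nat -> quat R) : has_integral mu2
  (fun z => qabs (psum a N (pt z)) ^+ 2 * W z) (\sum_(n < N) m n * qabs2 (a n)).
Proof.
have [W0 mW rW iW] := hW.
elim: N => [|N ih].
  rewrite big_ord0; apply: eq_has_integral (has_integral0 _) => z.
  by rewrite psum0 qabs0 expr0n mul0r.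
have hc : has_integral mu2 (fun z => \sum_(k < N) 2 * (cross N k (a N) (a k) z * W z)) (\sum_(k < N) 2 * 0).
  apply: (has_integral_sum (h := fun k z => 2 * (cross N k (a N) (a k) z * W z)) (c := fun=> 2 * 0)).
  by move=> k kN; apply: has_integralZ; exact: cross_integral0.
have := has_integralD ih (has_integralD hc (has_integralZ (qabs2 (a N)) (iW N))).
rewrite big_ord_recr/= [X in _ + (X + _)]big1 ?add0r => [|k _]; last by rewrite mulr0.
rewrite [qabs2 _ * m N]mulrC; apply: eq_has_integral => z.
rewrite !qabs_sqr qabs2_sum_recr !mulrDl mulr_suml !mulrA; congr (_ + (_ + _)).
by apply: eq_bigr => k _; rewrite mulrA.
Qed.

End Poly.

End RadialWeight.

(** * Parseval's identity for a radial weight *)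

Section WeightedNorm.
Variable R : realType.
Local Notation mR := (measurableTypeR R).
Local Notation mu2 := (@lebesgue2 R).
Variables (I : quat R) (sI : sphere I).
Local Notation pt := (slice_of I).

Section Weight.
Variables (W : mR * mR -> R) (m : nat -> R).
Hypothesis hW : radial_weight I W m.

(** On a disc an entire series has bounded partial sums, so dominated convergence applies; the
    truncated weight is still rotation invariant, so the powers stay orthogonal. *)
Definition cutoff (K : R) (z : mR * mR) : R := if qabs (pt z) < K then W z else 0.

Lemma cutoff_ge0 K z : 0 <= cutoff K z.
Proof. by rewrite /cutoff; case: ifP => _ //; have [] := hW. Qed.

Lemma cutoff_le K z : cutoff K z <= W z.
Proof. by rewrite /cutoff; case: ifP => _ //; have [] := hW. Qed.

Lemma measurable_cutoff K : measurable_fun [set: mR * mR] (cutoff K).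
Proof.
have [_ mW _ _] := hW; apply: measurable_fun_ifT => //.
by apply: measurable_fun_ltr => //; exact: measurable_qabs_pt.
Qed.

Lemma radial_weight_cutoff K : exists mK, radial_weight I (cutoff K) mK.
Proof.
have [W0 mW rW iW] := hW.
have mp n : measurable_fun [set: mR * mR] (fun z => qabs (pt z) ^+ n * cutoff K z).
  by apply: measurable_funM; [apply: measurable_funX; exact: measurable_qabs_pt|exact: measurable_cutoff].
exists (fun n => fine (\int[mu2]_z (qabs (pt z) ^+ n.*2 * cutoff K z)%:E)%E).
split; first exact: cutoff_ge0.
- exact: measurable_cutoff.
- by move=> c s z cs; rewrite /cutoff qabs_pt_rot// rW.
- move=> n; apply: ge0_has_integral_fine => //.
    by move=> z; rewrite mulr_ge0 ?exprn_ge0 ?qabs_ge0 ?cutoff_ge0.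
  apply: le_lt_trans (_ : (m n)%:E < +oo)%E; last exact: ltry.
  have [_ <-] := iW n; apply: ge0_le_integral => //.
  + by move=> z _; rewrite lee_fin mulr_ge0 ?exprn_ge0 ?qabs_ge0 ?cutoff_ge0.
  + exact/measurable_EFinP.
  + apply/measurable_EFinP; apply: measurable_funM => //.
    by apply: measurable_funX; exact: measurable_qabs_pt.
  + by move=> z _; rewrite lee_fin ler_wpM2l ?exprn_ge0 ?qabs_ge0 ?cutoff_le.
Qed.

End Weight.

Section Norm.
Variables (W : mR * mR -> R) (m : nat -> R).
Hypothesis hW : radial_weight I W m.

Lemma m_ge0 n : 0 <= m n.
Proof.
have [W0 mW rW iW] := hW; have [_ e] := iW n.
rewrite -lee_fin -e; apply: integral_ge0 => z _.
by rewrite lee_fin mulr_ge0 ?exprn_ge0 ?qabs_ge0.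
Qed.

Definition nsum (a : nat -> quat R) N : R := \sum_(n < N) m n * qabs2 (a n).

Lemma nsumS a N : nsum a N.+1 = nsum a N + m N * qabs2 (a N).
Proof. exact: big_ord_recr. Qed.

Lemma nsum_nd a : nondecreasing_seq (nsum a).
Proof. by apply/nondecreasing_seqP => N; rewrite nsumS lerDl mulr_ge0 ?m_ge0 ?qabs2_ge0. Qed.

Lemma has_integral_nsum (a : nat -> quat R) N : has_integral mu2
  (fun z => \sum_(n < N) qabs2 (a n) * (qabs (pt z) ^+ n.*2 * W z)) (nsum a N).
Proof.
have [_ _ _ iW] := hW; elim: N => [|N ih].
  rewrite /nsum big_ord0; apply: eq_has_integral (has_integral0 _) => z.
  by rewrite big_ord0.
have := has_integralD ih (has_integralZ (qabs2 (a N)) (iW N)).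
rewrite nsumS (mulrC (m N)); apply: eq_has_integral => z.
by rewrite big_ord_recr.
Qed.

Definition wnorm (f : quat R -> quat R) : \bar R := (\int[mu2]_z (qabs (f (pt z)) ^+ 2 * W z)%:E)%E.

Lemma wnorm_ge0 f : (0 <= wnorm f)%E.
Proof.
by have [W0 _ _ _] := hW; apply: integral_ge0 => z _; rewrite lee_fin mulr_ge0 ?sqr_ge0.
Qed.

Lemma measurable_psum_weight a N :
  measurable_fun [set: mR * mR] (fun z : mR * mR => qabs (psum a N (pt z)) ^+ 2 * W z).
Proof. by have [/integrableP[/measurable_EFinP]] := poly_norm sI hW N a. Qed.

Lemma cvg_psum_weight f a z : has_series f a ->
  qabs (psum a N (pt z)) ^+ 2 * W z @[N --> \oo] --> qabs (f (pt z)) ^+ 2 * W z.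
Proof.
move=> fa; apply: cvgM; last exact: cvg_cst.
by rewrite expr2; apply: cvg_eqfun (cvgM (cvg_qabs (fa _)) (cvg_qabs (fa _))) => N; rewrite expr2.
Qed.

Lemma measurable_series_weight f a : has_series f a ->
  measurable_fun [set: mR * mR] (fun z : mR * mR => qabs (f (pt z)) ^+ 2 * W z).
Proof.
move=> fa; apply: (measurable_fun_cvg (measurable_psum_weight a)) => z _.
exact: cvg_psum_weight.
Qed.

(** Fatou's lemma along the partial sums, whose norms are the sums [nsum]. *)
Lemma wnorm_le f a (B : R) : has_series f a -> (forall N, nsum a N <= B) -> (wnorm f <= B%:E)%E.
Proof.
move=> fa aB; have [W0 mW rW iW] := hW.
apply: (@fatou_le _ _ _ mu2 (fun N z => qabs (psum a N (pt z)) ^+ 2 * W z)).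
- exact: measurable_psum_weight.
- by move=> N z; rewrite mulr_ge0 ?sqr_ge0.
- by move=> z; exact: cvg_psum_weight.
- by move=> N; have [_ ->] := poly_norm sI hW N a; rewrite lee_fin; exact: aB.
Qed.

End Norm.

Section Bessel.
Variables (W : mR * mR -> R) (m : nat -> R).
Hypothesis hW : radial_weight I W m.

Lemma psum_bounded f a (K : R) : 0 < K -> has_series f a ->
  exists B : R, forall N q, qabs q < K -> qabs (psum a N q) <= B.
Proof.
move=> K0 fa; have K20 : 0 <= 2 * K by rewrite mulr_ge0// ltW.
have [C C0 hC] := has_series_bounded fa K20.
exists (C * 2) => N q qK; have := @psum_tail _ a (2 * K) C 0 N q.
rewrite psum0 subr0 expr0 mulr1; apply => //; first by rewrite mulr_gt0.
by rewrite ler_pM2l// ltW.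
Qed.

Lemma cutoff_nsum_le f a (K : R) mK N : 0 < K -> has_series f a ->
  radial_weight I (cutoff W K) mK -> ((nsum mK a N)%:E <= wnorm W f)%E.
Proof.
move=> K0 fa hK; have [W0 mW rW iW] := hW; have [c0 mc _ ic] := hK.
have [B hB] := psum_bounded K0 fa.
apply: le_trans (_ : wnorm (cutoff W K) f <= _)%E; last first.
  apply: ge0_le_integral => //.
  - by move=> z _; rewrite lee_fin mulr_ge0 ?sqr_ge0.
  - apply/measurable_EFinP; exact: (measurable_series_weight hK fa).
  - apply/measurable_EFinP; exact: (measurable_series_weight hW fa).
  - by move=> z _; rewrite lee_fin ler_wpM2l ?sqr_ge0// (cutoff_le hW).
have B0 : 0 <= B by apply: le_trans (qabs_ge0 _) (hB 0%N 0 _); rewrite qabs0.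
have [] := @dominated_convergence _ _ _ mu2 _ measurableT
  (fun N z => (qabs (psum a N (pt z)) ^+ 2 * cutoff W K z)%:E)
  (fun z => (qabs (f (pt z)) ^+ 2 * cutoff W K z)%:E)
  (fun z => (B ^+ 2 * (qabs (pt z) ^+ 0 * cutoff W K z))%:E).
- by move=> M; apply/measurable_EFinP; exact: (measurable_psum_weight hK).
- apply/measurable_EFinP; exact: (measurable_series_weight hK fa).
- apply: aeW => z _; apply: cvg_EFin; first exact: nearW.
  exact: (cvg_psum_weight (W := cutoff W K)).
- by have [] := has_integralZ (B ^+ 2) (ic 0%N).
- apply: aeW => z M _; rewrite abse_EFin lee_fin ger0_norm; last by rewrite mulr_ge0 ?sqr_ge0.
  rewrite expr0 mul1r /cutoff; case: ifPn => zK; last by rewrite !mulr0.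
  by rewrite ler_wpM2r// ler_sqr ?nnegrE ?qabs_ge0// hB.
move=> _ _ lim; rewrite /wnorm -(cvg_lim _ lim)//.
apply: lime_ge; first by apply/cvg_ex; eexists; exact: lim.
exists N => // M /= NM.
have [_ ->] := poly_norm sI hK M a; rewrite lee_fin; exact: (nsum_nd hK).
Qed.

(* Bessel's inequality: on a disc the partial sums converge boundedly, and Fatou's
   lemma lets the radius tend to infinity. *)
Lemma nsum_le_wnorm f a N : has_series f a -> ((nsum m a N)%:E <= wnorm W f)%E.
Proof.
move=> fa; have [W0 mW rW iW] := hW.
have [_ <-] := has_integral_nsum hW a N.
apply: (@fatou_le _ _ _ mu2 (fun K z => \sum_(n < N) qabs2 (a n) * (qabs (pt z) ^+ n.*2 * cutoff W K.+1%:R z))).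
- move=> K; apply: measurable_sum => n; apply: measurable_funM => //.
  by apply: measurable_funM; [apply: measurable_funX; exact: measurable_qabs_pt|exact: (measurable_cutoff hW)].
- move=> K z; apply: sumr_ge0 => n _.
  by rewrite !mulr_ge0 ?qabs2_ge0 ?exprn_ge0 ?qabs_ge0 ?(cutoff_ge0 hW).
- move=> z; have [K0 hK0] : exists K0, forall K, (K0 <= K)%N -> qabs (pt z) < K.+1%:R.
    exists (Num.truncn (qabs (pt z))) => K /(leq_ltn_trans) h.
    by apply: lt_le_trans (truncnS_gt _) _; rewrite ler_nat ltnS; have := h _ (ltnSn K).
  apply: cvg_near_cst; exists K0 => // K /= /hK0 zK.
  by apply: eq_bigr => n _; rewrite /cutoff zK.
- move=> K; have [mK hK] := radial_weight_cutoff hW K.+1%:R.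
  apply: le_trans (cutoff_nsum_le N _ fa hK); last by rewrite ltr0n.
  by have [_ ->] := has_integral_nsum hK a N.
Qed.

(** The partial sums increase and stay below the norm by Bessel's inequality, and Fatou bounds the
    norm by their limit. *)
Lemma wnorm_series f a : has_series f a -> (wnorm W f < +oo)%E ->
  has_integral mu2 (fun z => qabs (f (pt z)) ^+ 2 * W z) (fine (wnorm W f)) /\
  nsum m a N @[N --> \oo] --> fine (wnorm W f).
Proof.
move=> fa ff; have [W0 mW rW iW] := hW.
have fin : wnorm W f \is a fin_num by rewrite ge0_fin_numE// (wnorm_ge0 hW).
split.
  apply: ge0_has_integral_fine => //; first exact: (measurable_series_weight hW fa).
  by move=> z; rewrite mulr_ge0 ?sqr_ge0.
have ub N : nsum m a N <= fine (wnorm W f) by rewrite -lee_fin fineK// nsum_le_wnorm.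
have cv : cvgn (nsum m a).
  apply: nondecreasing_is_cvgn; first exact: (nsum_nd hW).
  by exists (fine (wnorm W f)) => _ [N _ <-].
have -> : fine (wnorm W f) = limn (nsum m a); last exact: cv.
apply/eqP; rewrite eq_le; apply/andP; split; last first.
  by apply: limr_le => //; exact: nearW.
rewrite -lee_fin fineK//; apply: (wnorm_le hW fa) => N.
by apply: nondecreasing_cvgn_le => //; exact: (nsum_nd hW).
Qed.

End Bessel.

End WeightedNorm.

(** * Inner products by polarization *)

Section Pairing.
Variable R : realType.
Local Notation mR := (measurableTypeR R).
Local Notation mu2 := (@lebesgue2 R).
Variables (I : quat R) (sI : sphere I).
Local Notation pt := (slice_of I).

Lemma has_series_mulr f a (u : quat R) : has_series f a ->
  has_series (fun q => f q * u) (fun n => a n * u).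
Proof.
move=> fa q; apply: cvg_eqfun (cvg_qmul (fa q) (cvg_cst u)) => N.
by rewrite /psum mulr_suml; apply: eq_bigr => n _; rewrite mulrA.
Qed.

Lemma qabs2_add_le (p q : quat R) : qabs2 (p + q) <= 2 * qabs2 p + 2 * qabs2 q.
Proof.
have h (x y : R) : (x + y) ^+ 2 <= 2 * x ^+ 2 + 2 * y ^+ 2 by have := sqr_ge0 (x - y); nra.
have h0 := h (qre p) (qre q); have h1 := h (qi p) (qi q).
have h2 := h (qj p) (qj q); have h3 := h (qk p) (qk q).
rewrite /qabs2 !quatE; lra.
Qed.

Section Weight.
Variables (W : mR * mR -> R) (m : nat -> R).
Hypothesis hW : radial_weight I W m.

Definition resum (a b : nat -> quat R) N : R := \sum_(n < N) m n * qre (qconj (b n) * a n).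

Lemma nsum_add (a b : nat -> quat R) N :
  nsum m (fun n => b n + a n) N = nsum m b N + 2 * resum a b N + nsum m a N.
Proof.
rewrite /nsum /resum mulr_sumr -!big_split/=; apply: eq_bigr => n _.
by rewrite qabs2D; ring.
Qed.

Lemma nsum_add_le (a b : nat -> quat R) N :
  nsum m (fun n => b n + a n) N <= 2 * nsum m b N + 2 * nsum m a N.
Proof.
rewrite /nsum !mulr_sumr -big_split/=; apply: ler_sum => n _.
apply: le_trans (ler_wpM2l (m_ge0 hW n) (qabs2_add_le (b n) (a n))) _.
suff -> : m n * (2 * qabs2 (b n) + 2 * qabs2 (a n)) = 2 * (m n * qabs2 (b n)) + 2 * (m n * qabs2 (a n)) by [].
by ring.
Qed.

(** Polarization: twice the real part of conj(g) f is |g + f|^2 - |g|^2 - |f|^2. The norm of g + f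
    is finite by a bound on its coefficients. *)
Lemma re_pairing f g a b : has_series f a -> has_series g b ->
  (wnorm I W f < +oo)%E -> (wnorm I W g < +oo)%E ->
  exists c, has_integral mu2 (fun z => W z * qre (qconj (g (pt z)) * f (pt z))) c /\
    resum a b N @[N --> \oo] --> c.
Proof.
move=> fa gb ff gg; have [W0 mW rW iW] := hW.
have ga : has_series (fun q => g q + f q) (fun n => b n + a n) by exact: has_series_add.
have [if_ sf] := wnorm_series sI hW fa ff; have [ig sg] := wnorm_series sI hW gb gg.
have fin h : (wnorm I W h < +oo)%E -> wnorm I W h \is a fin_num.
  by rewrite ge0_fin_numE// (wnorm_ge0 hW).
have fg : (wnorm I W (fun q => g q + f q)%R < +oo)%E.
  apply: le_lt_trans (_ : (2 * fine (wnorm I W g) + 2 * fine (wnorm I W f))%:E < _)%E; last exact: ltry.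
  apply: (wnorm_le sI hW ga) => N; apply: (le_trans (nsum_add_le a b N)).
  by rewrite lerD// ler_pM2l// -lee_fin fineK ?fin//; apply: nsum_le_wnorm.
have [is_ ss] := wnorm_series sI hW ga fg.
set cf := fine _ in if_ sf; set cg := fine _ in ig sg; set cs := fine _ in is_ ss.
exists (2^-1 * (cs + (-1) * (cg + cf))); split.
  have := has_integralZ 2^-1 (has_integralD is_ (has_integralZ (-1) (has_integralD ig if_))).
  apply: eq_has_integral => z; rewrite !qabs_sqr qabs2D; by field.
have -> : resum a b = fun N => 2^-1 * (nsum m (fun n => b n + a n) N + (-1) * (nsum m b N + nsum m a N)).
  by apply: funext => N; rewrite nsum_add; field.
apply: cvgM; first exact: cvg_cst.
by apply: cvgD => //; apply: cvgM; [exact: cvg_cst|exact: cvgD].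
Qed.

Lemma wnorm_mulr f (u : quat R) : qabs u = 1 -> wnorm I W (fun q => f q * u) = wnorm I W f.
Proof. by move=> u1; apply: eq_integral => z _; rewrite qabsM u1 mulr1. Qed.

(** A unit u on the right preserves the norm of f, and the imaginary coordinates of q are minus the
    real parts of q i, q j and q k; so real pairings reach all four coordinates. *)
Lemma re_pairing_mulr f g a b (u : quat R) : qabs u = 1 -> has_series f a -> has_series g b ->
  (wnorm I W f < +oo)%E -> (wnorm I W g < +oo)%E ->
  exists c, has_integral mu2 (fun z => W z * qre (qconj (g (pt z)) * f (pt z) * u)) c /\
    \sum_(n < N) m n * qre (qconj (b n) * a n * u) @[N --> \oo] --> c.
Proof.
move=> u1 fa gb ff gg; have fu := has_series_mulr (u := u) fa.
have ffu : (wnorm I W (fun q => f q * u)%R < +oo)%E by rewrite wnorm_mulr.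
have [c [ic sc]] := re_pairing fu gb ffu gg; exists c; split.
  by apply: eq_has_integral ic => z; rewrite mulrA.
by apply: cvg_eqfun sc => N; rewrite /resum; apply: eq_bigr => n _; rewrite mulrA.
Qed.

Lemma coord_mulr (q : quat R) : [/\ qi q = - qre (q * Quat 0 1 0 0),
  qj q = - qre (q * Quat 0 0 1 0) & qk q = - qre (q * Quat 0 0 0 1)].
Proof. by rewrite !qmul_components; split; rewrite !quatE; ring. Qed.

Lemma qcoord_sum (N : nat) (F : nat -> quat R) : \sum_(n < N) F n =
  Quat (\sum_(n < N) qre (F n)) (\sum_(n < N) qi (F n))
       (\sum_(n < N) qj (F n)) (\sum_(n < N) qk (F n)).
Proof.
elim: N => [|N ih]; first by rewrite !big_ord0; apply: quat_eq; rewrite !quatE.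
by rewrite !big_ord_recr/= ih; apply: quat_eq; rewrite !quatE.
Qed.

Lemma qpairing f g a b : has_series f a -> has_series g b ->
  (wnorm I W f < +oo)%E -> (wnorm I W g < +oo)%E ->
  \sum_(n < N) m n *: (qconj (b n) * a n) @[N --> \oo] -->
  qintegral (fun z => W z *: (qconj (g (pt z)) * f (pt z))).
Proof.
move=> fa gb ff gg.
have u1 : qabs (Quat 0 1 0 0 : quat R) = 1 by rewrite /qabs /qabs2 !quatE !expr0n !addr0 add0r expr1n sqrtr1.
have u2 : qabs (Quat 0 0 1 0 : quat R) = 1 by rewrite /qabs /qabs2 !quatE !expr0n !addr0 !add0r expr1n sqrtr1.
have u3 : qabs (Quat 0 0 0 1 : quat R) = 1 by rewrite /qabs /qabs2 !quatE !expr0n !addr0 !add0r expr1n sqrtr1.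
have [c0 [i0 s0]] := re_pairing fa gb ff gg.
have [c1 [i1 s1]] := re_pairing_mulr u1 fa gb ff gg.
have [c2 [i2 s2]] := re_pairing_mulr u2 fa gb ff gg.
have [c3 [i3 s3]] := re_pairing_mulr u3 fa gb ff gg.
have E (h : quat R -> R) (h' : quat R -> R) c : (forall q, h q = - h' q) ->
    has_integral mu2 (fun z => W z * h' (qconj (g (pt z)) * f (pt z))) c ->
    (\int[mu2]_z (W z * h (qconj (g (pt z)) * f (pt z))))%R = - c.
  move=> hh ic; rewrite -mulN1r; apply: has_integralE.
  apply: eq_has_integral (has_integralZ (-1) ic) => z.
  by rewrite hh; ring.
have S (h : quat R -> R) (h' : quat R -> R) c : (forall q, h q = - h' q) ->
    \sum_(n < N) m n * h' (qconj (b n) * a n) @[N --> \oo] --> c ->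
    \sum_(n < N) m n * h (qconj (b n) * a n) @[N --> \oo] --> - c.
  move=> hh sc; apply: cvg_eqfun (cvgN sc) => N.
  transitivity (- \sum_(n < N) m n * h' (qconj (b n) * a n)); last by [].
  rewrite -sumrN; by apply: eq_bigr => n _; rewrite hh mulrN.
have h1 (q : quat R) : qi q = - qre (q * Quat 0 1 0 0) by have [] := coord_mulr q.
have h2 (q : quat R) : qj q = - qre (q * Quat 0 0 1 0) by have [] := coord_mulr q.
have h3 (q : quat R) : qk q = - qre (q * Quat 0 0 0 1) by have [] := coord_mulr q.
have -> : qintegral (fun z => W z *: (qconj (g (pt z)) * f (pt z))) = Quat c0 (- c1) (- c2) (- c3).
  rewrite /qintegral -(has_integralE i0) -(E _ (fun q => qre (q * Quat 0 1 0 0)) _ h1 i1).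
  rewrite -(E _ (fun q => qre (q * Quat 0 0 1 0)) _ h2 i2) -(E _ (fun q => qre (q * Quat 0 0 0 1)) _ h3 i3).
  by congr Quat; apply: eq_Rintegral => z _; rewrite quatE.
apply: cvg_eqfun (cvg_Quat s0 (S _ (fun q => qre (q * Quat 0 1 0 0)) _ h1 s1)
  (S _ (fun q => qre (q * Quat 0 0 1 0)) _ h2 s2) (S _ (fun q => qre (q * Quat 0 0 0 1)) _ h3 s3)) => N.
rewrite /resum (qcoord_sum N (fun n => m n *: (qconj (b n) * a n))).
by congr Quat; apply: eq_bigr => n _; rewrite quatE.
Qed.

End Weight.

End Pairing.

(** * The two weights of the Fock space *)

Section Fock.
Variable R : realType.
Local Notation mR := (measurableTypeR R).
Local Notation mu2 := (@lebesgue2 R).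
Variables (I : quat R) (sI : sphere I) (alpha : R).
Hypothesis ha : - 2^-1 <= alpha.
Local Notation pt := (slice_of I).

Definition even_weight (z : mR * mR) : R := mac_density alpha (qabs (pt z)).

Definition odd_weight (z : mR * mR) : R :=
  qabs (pt z) ^- 2 * mac_density (alpha + 1) (qabs (pt z)).

Lemma mac_density_ge0 (b r : R) : - 2^-1 <= b -> 0 <= mac_density b r.
Proof.
move=> hb; rewrite /mac_density mulr_ge0 ?macdonald_ge0// mulr_ge0 ?powR_ge0//.
by apply: ltW; apply: mac_const_gt0; lra.
Qed.

Lemma measurable_mac_density (b : R) :
  measurable_fun [set: mR * mR] (fun z : mR * mR => mac_density b (qabs (pt z))).
Proof.
have mq := measurable_qabs_pt I.
apply: measurable_funM.
  apply: measurable_funM => //.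
  exact: (measurableT_comp (f := fun x : mR => x `^ (2 * b + 2)) (measurable_powR _) mq).
by apply: (measurableT_comp (measurable_macdonald b)); exact: measurable_funX.
Qed.

Lemma alpha2_gt0 : 0 < 2 * (alpha + 1).
Proof. by rewrite mulr_gt0//; have := ha; lra. Qed.

Lemma radial_even_weight : radial_weight I even_weight (fock_moment alpha alpha).
Proof.
have mq := measurable_qabs_pt I.
split.
- by move=> z; exact: mac_density_ge0.
- exact: measurable_mac_density.
- by move=> c s z cs; rewrite /even_weight qabs_pt_rot.
- move=> n; have [hb _] := fock_moment_bound n ha.
  apply: ge0_has_integral.
  + by apply: measurable_funM; [exact: measurable_funX|exact: measurable_mac_density].
  + by move=> z; rewrite mulr_ge0 ?exprn_ge0 ?qabs_ge0 ?mac_density_ge0.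
  + rewrite -(radial_moment ha hb); apply: eq_integral => z _.
    by rewrite /even_weight qabs_pt// /mac_density -/(mac_const alpha); congr EFin; ring.
Qed.

(** The odd weight leaves out the factor 2 (alpha + 1) of the norm, so its moments are divided by
    that factor. *)
Definition odd_moment n : R := (2 * (alpha + 1))^-1 * fock_moment alpha (alpha + 1) n.

Lemma radial_odd_weight : radial_weight I odd_weight odd_moment.
Proof.
have mq := measurable_qabs_pt I; have a2 := alpha2_gt0.
have W0 z : 0 <= odd_weight z.
  rewrite mulr_ge0// ?invr_ge0 ?exprn_ge0 ?qabs_ge0 ?mac_density_ge0//; lra.
have mW : measurable_fun [set: mR * mR] odd_weight.
  apply: measurable_funM; last exact: measurable_mac_density.
  rewrite (_ : (fun _ => _) = fun z : mR * mR => qabs (pt z) `^ (-2)).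
    exact: (measurableT_comp (f := fun x : mR => x `^ (-2)) (measurable_powR _) mq).
  by apply: funext => z; rewrite powR_invn ?qabs_ge0.
split; [exact: W0|exact: mW| |].
- by move=> c s z cs; rewrite /odd_weight qabs_pt_rot.
- move=> n; have [_ hb] := fock_moment_bound n ha.
  have H : has_integral mu2 (fun z => (2 * (alpha + 1)) * (qabs (pt z) ^+ n.*2 * odd_weight z))
      (fock_moment alpha (alpha + 1) n).
    apply: ge0_has_integral.
    + by apply: measurable_funM => //; apply: measurable_funM => //; exact: measurable_funX.
    + by move=> z; rewrite mulr_ge0 ?(ltW a2)// mulr_ge0 ?exprn_ge0 ?qabs_ge0.
    + rewrite -(radial_moment ha hb); apply: eq_integral => z _.
      rewrite -(qabs_pt sI) -(mac_constS (a := alpha)); last lra.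
      rewrite /odd_weight /mac_density -/(mac_const (alpha + 1)); congr EFin.
      (* At the origin the powers in the densities vanish, so both sides are 0; elsewhere |p|^-2
         |p|^(2 alpha + 4) = |p|^(2 alpha + 2). *)
      have [->|r0] := eqVneq (qabs (pt z)) 0.
        by rewrite !powR0 ?gt_eqF ?mul0r ?mulr0//; lra.
      have -> : qabs (pt z) `^ (2 * (alpha + 1) + 2) = qabs (pt z) `^ (2 * alpha + 2) * qabs (pt z) ^+ 2.
        rewrite -[X in _ = _ * X]powR_mulrn ?qabs_ge0// -powRD ?r0 ?implybT//.
        by congr powR; ring.
      by field.
  have := has_integralZ (2 * (alpha + 1))^-1 H.
  by apply: eq_has_integral => z; rewrite mulKf// gt_eqF.
Qed.

Lemma fock_normsqE f : fock_normsq alpha I f =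
  (wnorm I even_weight (even_part f) + (2 * (alpha + 1))%:E * wnorm I odd_weight (odd_part f))%E.
Proof.
congr (_ + _ * _)%E; apply: eq_integral => z _.
by rewrite /odd_weight; congr EFin; exact/esym/mulrA.
Qed.

Lemma fock_innerE f g : fock_inner alpha I f g =
  qintegral (fun z => even_weight z *: (qconj (even_part g (pt z)) * even_part f (pt z)))
  + (2 * (alpha + 1)) *:
    qintegral (fun z => odd_weight z *: (qconj (odd_part g (pt z)) * odd_part f (pt z))).
Proof. by []. Qed.

Definition csum (a : nat -> quat R) N : R := \sum_(n < N) fock_coef alpha n * qabs2 (a n).

Lemma csumE a N : csum a N = nsum (fock_moment alpha alpha) (even_coef a) N +
  2 * (alpha + 1) * nsum odd_moment (odd_coef a) N.
Proof.
have a2 := alpha2_gt0; rewrite /csum /nsum mulr_sumr -big_split/=; apply: eq_bigr => n _.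
rewrite /fock_coef /even_coef /odd_coef /odd_moment mulrA mulVKf ?gt_eqF//.
have q0 : qabs2 (0 : quat R) = 0 by apply/eqP; rewrite qabs2_eq0.
by case: (odd n); rewrite q0 mulr0 ?add0r ?addr0.
Qed.

Lemma fock_space_fin f : fock_space alpha I f ->
  (wnorm I even_weight (even_part f) < +oo)%E /\ (wnorm I odd_weight (odd_part f) < +oo)%E.
Proof.
move=> [_]; rewrite fock_normsqE => h.
have n1 := wnorm_ge0 radial_even_weight (even_part f).
have n2 := wnorm_ge0 radial_odd_weight (odd_part f).
have a2 := alpha2_gt0.
have n3 : (0 <= (2 * (alpha + 1))%:E * wnorm I odd_weight (odd_part f))%E by rewrite mule_ge0// lee_fin ltW.
split; first by apply: le_lt_trans h; rewrite leeDl.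
have : ((2 * (alpha + 1))%:E * wnorm I odd_weight (odd_part f) < +oo)%E.
  by apply: le_lt_trans h; rewrite leeDr.
move: (wnorm I odd_weight _) n2 => [r _ _|_|//]; first exact: ltry.
by rewrite gt0_muley// lte_fin.
Qed.

Lemma fock_space_bounded f a : fock_space alpha I f -> has_series f a ->
  exists B, forall N, csum a N <= B.
Proof.
move=> Ff fa; have [h1 h2] := fock_space_fin Ff; have a2 := alpha2_gt0.
have f1 : wnorm I even_weight (even_part f) \is a fin_num.
  by rewrite ge0_fin_numE// (wnorm_ge0 radial_even_weight).
have f2 : wnorm I odd_weight (odd_part f) \is a fin_num.
  by rewrite ge0_fin_numE// (wnorm_ge0 radial_odd_weight).
exists (fine (wnorm I even_weight (even_part f)) + 2 * (alpha + 1) * fine (wnorm I odd_weight (odd_part f))).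
move=> N; rewrite csumE; apply: lerD.
  by rewrite -lee_fin fineK//; apply: (nsum_le_wnorm sI radial_even_weight); exact: has_series_even.
rewrite ler_pM2l// -lee_fin fineK//; apply: (nsum_le_wnorm sI radial_odd_weight).
exact: has_series_odd.
Qed.

(** Together with [fock_space_bounded], this replaces membership in the space by boundedness of the
    sums [csum], for regular functions. *)
Lemma fock_spaceI f a (B : R) : slice_regular f -> has_series f a ->
  (forall N, csum a N <= B) -> fock_space alpha I f.
Proof.
move=> rf fa hB; split=> //; rewrite fock_normsqE; have a2 := alpha2_gt0.
have p1 N : 0 <= nsum (fock_moment alpha alpha) (even_coef a) N.
  by apply: sumr_ge0 => n _; rewrite mulr_ge0 ?qabs2_ge0 ?(m_ge0 radial_even_weight).
have p2 N : 0 <= 2 * (alpha + 1) * nsum odd_moment (odd_coef a) N.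
  rewrite mulr_ge0 ?(ltW a2)//.
  by apply: sumr_ge0 => n _; rewrite mulr_ge0 ?qabs2_ge0 ?(m_ge0 radial_odd_weight).
have w1 : (wnorm I even_weight (even_part f) <= B%:E)%E.
  apply: (wnorm_le sI radial_even_weight (has_series_even fa)) => N.
  by apply: le_trans (hB N); rewrite csumE lerDl.
have w2 : (wnorm I odd_weight (odd_part f) <= ((2 * (alpha + 1))^-1 * B)%:E)%E.
  apply: (wnorm_le sI radial_odd_weight (has_series_odd fa)) => N.
  by rewrite ler_pdivlMl//; apply: le_trans (hB N); rewrite csumE lerDr.
have w2' : ((2 * (alpha + 1))%:E * wnorm I odd_weight (odd_part f) <= B%:E)%E.
  apply: le_trans (lee_wpmul2l _ w2) _; first by rewrite lee_fin ltW.
  by rewrite -EFinM mulVKf// gt_eqF.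
by apply: le_lt_trans (leeD w1 w2') _; rewrite -EFinD ltry.
Qed.

Lemma fock_inner_cvg f g a b : fock_space alpha I f -> fock_space alpha I g ->
  has_series f a -> has_series g b ->
  \sum_(n < N) fock_coef alpha n *: (qconj (b n) * a n) @[N --> \oo] --> fock_inner alpha I f g.
Proof.
move=> Ff Fg fa gb; have [f1 f2] := fock_space_fin Ff; have [g1 g2] := fock_space_fin Fg.
rewrite fock_innerE.
have e1 := qpairing sI radial_even_weight (has_series_even fa) (has_series_even gb) f1 g1.
have e2 := qpairing sI radial_odd_weight (has_series_odd fa) (has_series_odd gb) f2 g2.
apply: cvg_eqfun (cvgD e1 (cvgZ (cvg_cst (2 * (alpha + 1))) e2)) => N.
have a2 := alpha2_gt0.
transitivity (\sum_(n < N) fock_moment alpha alpha n *: (qconj (even_coef b n) * even_coef a n)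
  + (2 * (alpha + 1)) *: \sum_(n < N) odd_moment n
    *: (qconj (odd_coef b n) * odd_coef a n)); last by [].
rewrite scaler_sumr -big_split/=; apply: eq_bigr => n _.
rewrite /fock_coef /even_coef /odd_coef /odd_moment scalerA mulVKf ?gt_eqF//.
by case: (odd n); rewrite mulr0 scaler0 ?add0r ?addr0.
Qed.

End Fock.

(** * Weighted shifts on the Fock space *)

Section FockOperators.
Variable R : realType.
Variables (I : quat R) (sI : sphere I) (alpha : R).
Hypothesis ha : - 2^-1 <= alpha.
Local Notation V := (quat R -> quat R).
Local Notation F := (fock_space alpha I).
Local Notation ip := (fock_inner alpha I).
Local Notation c := (fock_coef alpha).
Implicit Types (f g h : V) (a b : nat -> quat R).

Lemma c_gt0 n : 0 < c n. Proof. exact: fock_coef_gt0. Qed.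

Lemma fock_space_regular f : F f -> slice_regular f. Proof. by case. Qed.

Lemma fock_space_series f : F f -> exists a, has_series f a.
Proof. by move=> /fock_space_regular; exact: (slice_regular_has_series sI). Qed.

Lemma csumS a N : csum alpha a N.+1 = csum alpha a N + c N * qabs2 (a N).
Proof. exact: big_ord_recr. Qed.

Lemma csum_nd a : nondecreasing_seq (csum alpha a).
Proof.
by apply/nondecreasing_seqP => N; rewrite csumS lerDl mulr_ge0 ?qabs2_ge0// ltW// c_gt0.
Qed.

Lemma csum_lin a b (u v : quat R) N : csum alpha (fun n => a n * u + b n * v) N <=
  2 * qabs2 u * csum alpha a N + 2 * qabs2 v * csum alpha b N.
Proof.
rewrite /csum !mulr_sumr -big_split/=; apply: ler_sum => n _.
apply: le_trans (ler_wpM2l (ltW (c_gt0 n)) (qabs2_add_le (a n * u) (b n * v))) _.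
suff -> : c n * (2 * qabs2 (a n * u) + 2 * qabs2 (b n * v)) =
  2 * qabs2 u * (c n * qabs2 (a n)) + 2 * qabs2 v * (c n * qabs2 (b n)) by [].
by rewrite !qabs2M; ring.
Qed.

Lemma fock_space_lin f g (u v : quat R) : F f -> F g -> F (fun q => f q * u + g q * v).
Proof.
move=> Ff Fg; have [a fa] := fock_space_series Ff; have [b gb] := fock_space_series Fg.
have [A hA] := fock_space_bounded sI ha Ff fa; have [B hB] := fock_space_bounded sI ha Fg gb.
apply: (fock_spaceI sI ha (a := fun n => a n * u + b n * v) (B := 2 * qabs2 u * A + 2 * qabs2 v * B)).
- by apply: slice_regular_lin; exact: fock_space_regular.
- exact: has_series_lin.
- by move=> N; apply: le_trans (csum_lin a b u v N) _; rewrite lerD// ler_wpM2l ?mulr_ge0 ?qabs2_ge0.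
Qed.

Lemma sub_lin f g : f \- g = fun q => f q * 1 + g q * (-1).
Proof. by apply: funext => q; rewrite mulr1 mulrN1. Qed.

Lemma fock_space_sub f g : F f -> F g -> F (f \- g).
Proof. by move=> Ff Fg; rewrite sub_lin; exact: fock_space_lin. Qed.

Lemma has_series_sub f g a b : has_series f a -> has_series g b ->
  has_series (f \- g) (fun n => a n - b n).
Proof.
move=> fa gb; have := has_series_lin (u := 1) (v := -1) fa gb; rewrite -sub_lin.
by congr has_series; apply: funext => n; rewrite mulr1 mulrN1.
Qed.

Definition finite_coef a N := forall n, (N <= n)%N -> a n = 0.

Lemma has_series_poly_fun a N : finite_coef a N -> has_series (poly_fun a N) a.
Proof.
move=> aN; have := @has_series_poly R a N; congr has_series.
by apply: funext => n; case: ltnP => // /aN.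
Qed.

Lemma csum_finite a N M : finite_coef a N -> csum alpha a M <= csum alpha a N.
Proof.
move=> aN; have h := csum_nd a (leq_addl N M); apply: (le_trans h).
have q0 : qabs2 (0 : quat R) = 0 by apply/eqP; rewrite qabs2_eq0.
elim: M {h} => [|M ih]; first by rewrite addn0.
by rewrite addnS csumS aN ?leq_addr// q0 mulr0 addr0.
Qed.

Lemma fock_space_finite f a N : has_series f a -> finite_coef a N -> F f.
Proof.
move=> fa aN; have -> : f = poly_fun a N by exact: has_series_fun_unique fa (has_series_poly_fun aN).
apply: (fock_spaceI sI ha (a := a) (B := csum alpha a N)).
- exact: slice_regular_poly.
- exact: has_series_poly_fun.
- by move=> M; exact: csum_finite.
Qed.

Lemma csum_cvg f a : F f -> has_series f a -> csum alpha a N @[N --> \oo] --> qre (ip f f).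
Proof.
move=> Ff fa; have H := fock_inner_cvg sI ha Ff Ff fa fa.
have E : csum alpha a = fun N => qre (\sum_(n < N) c n *: (qconj (a n) * a n)).
  apply: funext => N; elim: N => [|N ih]; first by rewrite /csum !big_ord0 quatE.
  by rewrite csumS ih big_ord_recr/= qreD qreZ qconjMq qreZ qre_one mulr1.
by rewrite E; exact: cvg_qcoord H.
Qed.

Lemma seq_limit_le (u : nat -> R) (l B : R) : u n @[n --> \oo] --> l ->
  (forall n, u n <= B) -> l <= B.
Proof.
move=> ul uB; rewrite -(cvg_lim _ ul)//; apply: limr_le; last exact: nearW.
by apply/cvg_ex; exists l.
Qed.

Lemma csum_le_ip f a N : F f -> has_series f a -> csum alpha a N <= qre (ip f f).
Proof.
move=> Ff fa; have H := csum_cvg Ff fa; rewrite -(cvg_lim _ H)//.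
apply: nondecreasing_cvgn_le; first exact: csum_nd.
by apply/cvg_ex; exists (qre (ip f f)).
Qed.

(** A single term c_n |a_n|^2 is at most the whole sum, so each coefficient is continuous in the
    norm; closedness rests on this. *)
Lemma coef_le_ip_norm f a n : F f -> has_series f a ->
  qabs (a n) <= (Num.sqrt (c n))^-1 * ip_norm ip f.
Proof.
move=> Ff fa; have cn := c_gt0 n; rewrite ler_pdivlMl ?sqrtr_gt0// /ip_norm /qabs -sqrtrM ?(ltW cn)//.
rewrite ler_wsqrtr//; apply: le_trans (csum_le_ip n.+1 Ff fa).
by rewrite csumS lerDr; apply: sumr_ge0 => k _; rewrite mulr_ge0 ?qabs2_ge0 ?(ltW (c_gt0 _)).
Qed.

Lemma cvg_coef (u : nat -> V) f (a : nat -> nat -> quat R) b n : (forall k, F (u k)) -> F f ->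
  (forall k, has_series (u k) (a k)) -> has_series f b ->
  ip_norm ip (u k \- f) @[k --> \oo] --> (0 : R) -> a k n @[k --> \oo] --> b n.
Proof.
move=> Fu Ff ua fb lim.
apply/cvgrPdist_le => e e0; near=> k.
apply: le_trans (norm_le_qabs _) _; rewrite -[b n - a k n]opprB qabsN.
apply: le_trans (coef_le_ip_norm n (fock_space_sub (Fu k) Ff) (has_series_sub (ua k) fb)) _.
rewrite ler_pdivrMl ?sqrtr_gt0 ?c_gt0//; apply: le_trans (ler_norm _) _.
near: k; have e1 : 0 < Num.sqrt (c n) * e by rewrite mulr_gt0 ?sqrtr_gt0 ?c_gt0.
have /cvgrPdist_le/(_ _ e1) := lim; apply: filterS => k.
by rewrite sub0r normrN.
Unshelve. all: end_near. Qed.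

(** * Operators acting on coefficients by weighted shifts *)

Section WeightedShift.
Variables (T : V -> V) (s : nat -> R) (j : nat -> nat).
(** A common frame for both operators, with j the predecessor for M and the successor for D. The
    condition [j_le] keeps finitely many coefficients finite in number, so that polynomials lie in
    the domain. *)
Hypothesis T_series : forall f a, slice_regular f -> has_series f a ->
  has_series (T f) (fun k => s k *: a (j k)).
Hypothesis j_le : forall k, (k <= (j k).+1)%N.
Local Notation op := (max_operator F T).

Lemma finite_coef_dom f a N : has_series f a -> finite_coef a N -> op_dom op f.
Proof.
move=> fa aN; have Ff := fock_space_finite fa aN; split; first exact: Ff.
apply: (fock_space_finite (N := N.+1) (T_series (fock_space_regular Ff) fa)) => k Nk.
by rewrite aN ?scaler0// -ltnS (leq_trans Nk)// j_le.
Qed.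

Lemma fock_space_op_eq f g a : F f -> F g -> has_series f a ->
  has_series g (fun k => s k *: a (j k)) -> op_dom op f /\ T f = g.
Proof.
move=> Ff Fg fa gb.
have E : T f = g by exact: has_series_fun_unique (T_series (fock_space_regular Ff) fa) gb.
split; last exact: E.
by split; [exact: Ff|rewrite E; exact: Fg].
Qed.

Lemma shift_right_linear : right_linear_operator F op.
Proof.
have cst0 : has_series (fun _ : quat R => (0 : quat R)) (fun _ => 0).
  by have := @has_series_cst R 0; congr has_series; apply: funext => n; case: ifP.
split; [by move=> f []|by move=> f []| |].
  exact: (finite_coef_dom (N := 0%N) cst0).
move=> f g u v [Ff FTf] [Fg FTg].
have [a fa] := fock_space_series Ff; have [b gb] := fock_space_series Fg.
have Hs : has_series (fun q => T f q * u + T g q * v) (fun k => s k *: (a (j k) * u + b (j k) * v)).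
  have := has_series_lin (u := u) (v := v) (T_series (fock_space_regular Ff) fa)
    (T_series (fock_space_regular Fg) gb).
  by congr has_series; apply: funext => n; rewrite scalerDr !scalerAl.
have FL := fock_space_lin u v Ff Fg; have FTL := fock_space_lin u v FTf FTg.
by have [d e] := fock_space_op_eq FL FTL (has_series_lin fa gb) Hs.
Qed.

(** The Taylor polynomials approximate f: the squared norm of the N-th remainder is at most that of
    f minus [csum alpha a N], which tends to 0. *)
Lemma shift_densely_defined : densely_defined F ip op.
Proof.
move=> f Ff e e0; have [a fa] := fock_space_series Ff.
have L := csum_cvg Ff fa; have e2 : 0 < e ^+ 2 by rewrite exprn_gt0.
have [N hN] : exists N, qre (ip f f) - csum alpha a N < e ^+ 2.
  have /cvgrPdist_lt/(_ _ e2)[N _ /(_ N (leqnn N))/= h] := L.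
  by exists N; apply: le_lt_trans h; exact: ler_norm.
pose p n := if (n < N)%N then a n else 0.
have pN : finite_coef p N by move=> n; rewrite /p ltnNge => ->.
have hp : has_series (poly_fun a N) p by exact: has_series_poly.
have dp := finite_coef_dom hp pN; exists (poly_fun a N) => //.
have Fp := dp.1; have Fd := fock_space_sub Ff Fp; have hd := has_series_sub fa hp.
have Ld := csum_cvg Fd hd.
have q0 : qabs2 (0 : quat R) = 0 by apply/eqP; rewrite qabs2_eq0.
have E M : csum alpha (fun n => a n - p n) (N + M) = csum alpha a (N + M) - csum alpha a N.
  elim: M => [|M ih].
    rewrite addn0 subrr /csum big1// => n _.
    by rewrite /p ltn_ord subrr q0 mulr0.
  by rewrite addnS !csumS ih /p ltnNge leq_addr/= subr0 addrAC.
have le : qre (ip (f \- poly_fun a N) (f \- poly_fun a N)) <= qre (ip f f) - csum alpha a N.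
  apply: (seq_limit_le Ld) => M; have h := csum_nd (fun n => a n - p n) (leq_addl N M); apply: (le_trans h).
  by rewrite E lerD2r; exact: csum_le_ip.
rewrite /ip_norm -[e]gtr0_norm// -sqrtr_sqr ltr_sqrt//.
exact: le_lt_trans le hN.
Qed.

(** Norm convergence gives convergence of each coefficient, so the shift relation passes to the
    limit; the maximal domain then contains f because T f = g lies in the space. *)
Lemma shift_closed : closed_operator F ip op.
Proof.
move=> u f g du Ff Fg limf limg.
have [b fb] := fock_space_series Ff; have [d gd] := fock_space_series Fg.
have /choice[a ua] : forall k, exists a, has_series (u k) a.
  by move=> k; exact: fock_space_series (du k).1.
apply: (fock_space_op_eq Ff Fg fb).
have Ta k := T_series (fock_space_regular (du k).1) (ua k).
suff -> : (fun k => s k *: b (j k)) = d by [].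
apply: funext => n.
have L1 := cvg_coef (n := j n) (fun k => (du k).1) Ff ua fb limf.
have L2 := cvg_coef (n := n) (fun k => (du k).2) Fg Ta gd limg.
have L3 : s n *: a k (j n) @[k --> \oo] --> s n *: b (j n) by apply: cvgZ; [exact: cvg_cst|exact: L1].
by apply: (cvg_unique _ L3); [exact: norm_hausdorff|exact: L2].
Qed.

End WeightedShift.

(** * Adjoints and the commutation rule *)

Definition delta (n k : nat) : quat R := if k == n then 1 else 0.

Definition monomial (n : nat) : V := poly_fun (delta n) n.+1.

Lemma finite_delta n : finite_coef (delta n) n.+1.
Proof. by move=> k nk; rewrite /delta gtn_eqF. Qed.

Lemma has_series_monomial n : has_series (monomial n) (delta n).
Proof. exact/has_series_poly_fun/finite_delta. Qed.

(** Pairing with a monomial reads off one coefficient: the partial sums are constant from index n +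
    1 on. *)
Lemma ip_single f g b n (u : quat R) : F f -> F g ->
  has_series f (fun k => if k == n then u else 0) -> has_series g b ->
  ip f g = c n *: (qconj (b n) * u).
Proof.
move=> Ff Fg fa gb; have H := fock_inner_cvg sI ha Ff Fg fa gb.
apply: (cvg_unique _ H); first exact: norm_hausdorff.
apply: cvg_near_cst; exists n.+1 => // N /= nN.
rewrite (bigD1 (Ordinal nN))//= eqxx big1 ?addr0// => k /negPf kn.
by rewrite -val_eqE/= in kn; rewrite kn mulr0 scaler0.
Qed.

Definition mul_coef a n : quat R := if n is m.+1 then a m else 0.
Definition dunkl_coef a n : quat R := gam alpha n.+1 *: a n.+1.

Lemma mul_series f a : has_series f a -> has_series (Defs.mul_fun f) (mul_coef a).
Proof. exact: has_series_mul. Qed.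

Lemma dunkl_series f a : slice_regular f -> has_series f a ->
  has_series (dunkl_fun alpha f) (dunkl_coef a).
Proof. exact: (@has_series_dunkl R alpha I f a sI). Qed.

(** The constant term of M f is 0, so the sum for the left side, started at n + 1, matches the right
    side term by term through c_(n+1) = gam_(n+1) c_n. *)
Lemma mul_dunkl_pairing f g : op_dom (mul_op alpha I) f -> op_dom (dunkl_op alpha I) g ->
  ip (Defs.mul_fun f) g = ip f (dunkl_fun alpha g).
Proof.
move=> [Ff FMf] [Fg FDg].
have [a fa] := fock_space_series Ff; have [b gb] := fock_space_series Fg.
have L1 := fock_inner_cvg sI ha FMf Fg (mul_series fa) gb.
have L2 := fock_inner_cvg sI ha Ff FDg fa (dunkl_series (fock_space_regular Fg) gb).
apply: (cvg_unique _ L1); first exact: norm_hausdorff.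
apply: cvg_shiftSW; apply: cvg_eqfun L2 => N; rewrite big_ord_recl/= mulr0 scaler0 add0r; apply: eq_bigr => n _.
by rewrite /dunkl_coef fock_coefS// qconjZ -scalerAl scalerA mulrC.
Qed.

Lemma qconj_inj : injective (@qconj R).
Proof. by move=> p q e; rewrite -(qconjK p) e qconjK. Qed.

Lemma coef_eq (k : R) (p q : quat R) : k != 0 -> k *: (qconj p * 1) = k *: (qconj q * 1) -> p = q.
Proof. by move=> k0 /(scalerI k0); rewrite !mulr1 => /qconj_inj. Qed.

Lemma mul_dom_monomial n : op_dom (mul_op alpha I) (monomial n).
Proof.
have hd := @has_series_monomial n; have Fd := fock_space_finite hd (@finite_delta n).
split; first exact: Fd.
apply: (fock_space_finite (N := n.+2) (mul_series hd)) => -[//|k].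
by rewrite ltnS; exact: finite_delta.
Qed.

Lemma dunkl_dom_monomial n : op_dom (dunkl_op alpha I) (monomial n).
Proof.
have hd := @has_series_monomial n; have Fd := fock_space_finite hd (@finite_delta n).
split; first exact: Fd.
apply: (fock_space_finite (N := n) (dunkl_series (fock_space_regular Fd) hd)) => k nk.
by rewrite /dunkl_coef finite_delta ?scaler0.
Qed.

(** For the converse, H is tested on each q^n and gives c_(n+1) conj(b_(n+1)) = c_n conj(d_n), so h
    has the coefficients of D g; as h lies in the space, g is in the maximal domain. *)
Lemma mul_adjoint : is_adjoint F ip (mul_op alpha I) (dunkl_op alpha I).
Proof.
move=> g h; split=> [[dg <-]|[Fg Fh H]].
  by split=> [| |f df]; [exact: dg.1|exact: dg.2|exact: mul_dunkl_pairing].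
have [b gb] := fock_space_series Fg; have [d hd] := fock_space_series Fh.
have Dg := dunkl_series (fock_space_regular Fg) gb.
suff E : dunkl_fun alpha g = h.
  by split; [split; [exact: Fg|rewrite /= E; exact: Fh]|exact: E].
apply: (has_series_fun_unique (a := d)) => //; move: Dg; congr has_series.
apply: funext => n; have [Fm FMm] := mul_dom_monomial n.
have := H _ (mul_dom_monomial n).
rewrite (ip_single (n := n) (u := 1) Fm Fh (@has_series_monomial n) hd).
have hM : has_series (Defs.mul_fun (monomial n)) (fun k => if k == n.+1 then 1 else 0).
  have := mul_series (@has_series_monomial n); congr has_series.
  by apply: funext => -[|k].
rewrite (ip_single FMm Fg hM gb) fock_coefS// => e.
apply: (coef_eq (k := c n)); first by rewrite gt_eqF ?c_gt0.
by rewrite -e /dunkl_coef qconjZ -scalerAl scalerA mulrC.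
Qed.

Lemma qre_ip_conj f g : F f -> F g -> ip g f = qconj (ip f g).
Proof.
move=> Ff Fg; have [a fa] := fock_space_series Ff; have [b gb] := fock_space_series Fg.
have L1 := fock_inner_cvg sI ha Ff Fg fa gb; have L2 := fock_inner_cvg sI ha Fg Ff gb fa.
apply: (cvg_unique _ L2); first exact: norm_hausdorff.
have L3 : qconj (\sum_(n < N) c n *: (qconj (b n) * a n)) @[N --> \oo] --> qconj (ip f g).
  have C i := cvg_qcoord (i := i) L1.
  by rewrite /qconj; apply: cvg_Quat; try apply: cvgN; exact: C.
apply: cvg_eqfun L3 => N; elim: N => [|N ih]; first by rewrite !big_ord0 qconj0.
by rewrite !big_ord_recr/= ih qconjD qconjZ qconjM qconjK.
Qed.

Lemma dunkl_adjoint : is_adjoint F ip (dunkl_op alpha I) (mul_op alpha I).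
Proof.
move=> g h; split=> [[dg <-]|[Fg Fh H]].
  split=> [| |f df]; [exact: dg.1|exact: dg.2|].
  rewrite /= (qre_ip_conj dg.1 df.2) (qre_ip_conj dg.2 df.1).
  by rewrite (mul_dunkl_pairing dg df).
have [b gb] := fock_space_series Fg; have [d hd] := fock_space_series Fh.
have Mg := mul_series gb.
suff E : Defs.mul_fun g = h.
  by split; [split; [exact: Fg|rewrite /= E; exact: Fh]|exact: E].
apply: (has_series_fun_unique (a := d)) => //; move: Mg; congr has_series.
apply: funext => n; have [Fm FDm] := dunkl_dom_monomial n.
have := H _ (dunkl_dom_monomial n).
rewrite (ip_single (n := n) (u := 1) Fm Fh (@has_series_monomial n) hd).
(* D kills the constants: at n = 0 the index n.-1 is a placeholder with coefficient 0, and testing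
   then gives d_0 = 0, the constant term of M g. *)
have hD : has_series (dunkl_fun alpha (monomial n))
    (fun k => if k == n.-1 then (if n == 0%N then 0 else gam alpha n *: 1) else 0).
  have := dunkl_series (fock_space_regular Fm) (@has_series_monomial n); congr has_series.
  apply: funext => k; rewrite /dunkl_coef /delta; case: n {Fm FDm} => [|n]/=.
    by case: ifP => _; rewrite scaler0.
  by rewrite eqSS; case: eqP => [->|_]; rewrite ?scaler0.
rewrite (ip_single FDm Fg hD gb); case: n {Fm FDm hD} => [|n]/= e.
  apply: (coef_eq (k := c 0)); first by rewrite gt_eqF ?c_gt0.
  by rewrite -e mulr0 qconj0 mul0r.
apply: (coef_eq (k := c n.+1)); first by rewrite gt_eqF ?c_gt0.
have e1 : qconj (b n) * (gam alpha n.+1)%:A = gam alpha n.+1 *: (qconj (b n) * 1) by rewrite scalerAr.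
by rewrite -e e1 fock_coefS// scalerA mulrC.
Qed.

Lemma commutator_series f : slice_regular f ->
  commutator (dunkl_fun alpha) (@Defs.mul_fun R) f
  = (fun q => f q + (2 * alpha + 1) *: reflect_fun f q).
Proof.
move=> rf; have [a fa] := slice_regular_has_series sI rf.
have h1 := dunkl_series (slice_regular_mul rf) (mul_series fa).
have h2 := mul_series (dunkl_series rf fa).
have h3 := has_series_add fa (has_series_scale (c := 2 * alpha + 1) (has_series_reflect fa)).
apply: (has_series_fun_unique (has_series_sub h1 h2)); move: h3; congr has_series.
apply: funext => n.
(* The formula also holds at n = 0, where M D f has no constant term, because gam_0 = 0. *)
have -> : mul_coef (dunkl_coef a) n = gam alpha n *: a n.
  by case: n => [|n] //=; rewrite /gam/= mulr0 addr0 scale0r.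
rewrite /dunkl_coef/= -scalerBl scalerA -[X in X + _]scale1r -scalerDl; congr (_ *: _).
by rewrite /gam -signr_odd -natr1 /=; case: (odd n) => /=; rewrite ?expr1 ?expr0; ring.
Qed.

(** The weight 0 at k = 0 cancels the spurious a_0 that the truncated predecessor would bring in. *)
Lemma mul_shift f a : slice_regular f -> has_series f a ->
  has_series (@Defs.mul_fun R f) (fun k => (k != 0%N)%:R *: a k.-1).
Proof.
move=> _ /mul_series; congr has_series; apply: funext => -[|k]/=; by rewrite ?scale0r ?scale1r.
Qed.

End FockOperators.

Theorem theorem5p5 (R : realType) (alpha : R) (halpha : - 2^-1 <= alpha)
  (I : quat R) (hI : sphere I) :
  let F := fock_space alpha I in
  let ip := fock_inner alpha I in
  let M := mul_op alpha I in
  let D := dunkl_op alpha I in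
  [/\ [/\ right_linear_operator F M, densely_defined F ip M
        & closed_operator F ip M],
      [/\ right_linear_operator F D, densely_defined F ip D
        & closed_operator F ip D],
      is_adjoint F ip M D /\ is_adjoint F ip D M
    & forall f, F f ->
        commutator (op_map D) (op_map M) f
        = (fun q => f q + (2 * alpha + 1) *: reflect_fun f q)].
Proof.
move=> F ip M D.
have jM k : (k <= k.-1.+1)%N by exact: leqSpred.
have jD k : (k <= k.+2)%N by rewrite ltnW.
split.
- split.
  + exact: (shift_right_linear hI halpha (@mul_shift R) jM).
  + exact: (shift_densely_defined hI halpha (@mul_shift R) jM).
  + exact: (shift_closed hI halpha (@mul_shift R)).
- split.
  + exact: (shift_right_linear hI halpha (s := fun k => gam alpha k.+1) (j := succn) (@dunkl_series R I hI alpha) jD).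
  + exact: (shift_densely_defined hI halpha (s := fun k => gam alpha k.+1) (j := succn) (@dunkl_series R I hI alpha) jD).
  + exact: (shift_closed hI halpha (s := fun k => gam alpha k.+1) (j := succn) (@dunkl_series R I hI alpha)).
- by split; [exact: mul_adjoint|exact: dunkl_adjoint].
- by move=> f Ff; apply: (commutator_series hI); exact: Ff.1.
Qed.
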